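(* Let $$g=\sum_{i=1}^{n-2}(\mathrm{d}x^i)^2+2\,\mathrm{d}u\,\big(\mathrm{d}r+h\,\mathrm{d}u\big)$$ be an $n$-dimensional $pp$-wave metric in coordinates $(x^1,\dots,x^{n-2},u,r)$, with a real analytic function $h=h(x^1,\dots,x^{n-2},u)$. Then the Fefferman-Graham ambient metric for the conformal class $[g]$ exists if and only if $n$ is odd and $h$ is arbitrary, or if $n=2s$ is even and $\Delta^s h=0$. In both cases the ambient metric is given by a formal power series $$\widetilde g = 2\,\mathrm{d}(t\rho)\,\mathrm{d}t+t^2\left(g+\left(\sum_{k=1}^{\infty}\frac{\Delta^k h}{k!\,p_k}\,\rho^k\right)\mathrm{d}u^2\right),$$ with $p_k:=\prod_{j=1}^{k}(2j-n)$ and $\Delta:=\sum_{i=1}^{n-2}\partial_i^2$, where $\partial_i=\partial/\partial x^i$ (for $n=2s$ even with $\Delta^s h=0$, the terms with $k\ge s$ are understood to be zero). In particular, if $n=2s$ is even, the obstruction tensor $\mathcal O$ is given by $\mathcal O=\Delta^s h\ \mathrm{d}u^2$.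
   Context: Let $(M,[g])$ be an $n$-dimensional manifold with conformal structure of signature $(p,q)$, and let $\pi:\mathcal Q\to M$ be the ray bundle of metrics in $[g]$: its fibre at $x$ is $\{t^2g_x: t>0\}$, with $\mathbb R^+$-action $\varphi(t,g_x)=t^2g_x$. A semi-Riemannian manifold $(\widetilde M,\widetilde g)$ of signature $(p+1,q+1)$ is a pre-ambient space if (1) there is a free $\mathbb R^+$-action $\widetilde\varphi$ on $\widetilde M$; (2) there is an $\mathbb R^+$-equivariant embedding $\iota:\mathcal Q\to\widetilde M$; (3) $\mathcal L_F\widetilde g=2\widetilde g$ for the fundamental vector field $F$ of $\widetilde\varphi$, where $\mathcal L$ is the Lie derivative; (4) $(\iota^*\widetilde g)_{g_x}=g_x(\mathrm{d}\pi(\cdot),\mathrm{d}\pi(\cdot))$ for every $g_x\in\mathcal Q$. It is an ambient space, and $\widetilde g$ an ambient metric, if in addition its Ricci curvature vanishes. After fixing $g$ in the conformal class, an ambient metric near $M$ can be written in normal form $\widetilde g=2t\,\mathrm{d}\rho\,\mathrm{d}t+2\rho\,\mathrm{d}t^2+t^2g(\rho)$ on $(-\epsilon,\epsilon)\times M\times(1-\delta,1+\delta)\ni(\rho,x,t)$, where $g(\rho)=g+\sum_{k\ge1}\rho^k\mu_k$ is a power series in $\rho$ with symmetric $(2,0)$-tensors $\mu_k$ on $M$. For $n$ odd the ambient space is unique modulo diffeomorphisms that restrict to the identity along $\mathcal Q$ and commute with $\widetilde\varphi$; for $n$ even it is unique modulo the same set of diffeomorphisms and modulo terms of order $\ge n/2$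 in $\rho$. In even dimensions $n\ge4$ the existence of a Ricci-flat ambient metric is obstructed by the nonvanishing of the (Fefferman-Graham) obstruction tensor $\mathcal O$, a symmetric trace-free and divergence-free $(2,0)$-tensor which is conformally invariant of weight $2-n$, i.e. $\hat{\mathcal O}=e^{(2-n)\varphi}\mathcal O$ for $\hat g=e^{2\varphi}g$. It is given by $\mathcal O=\Delta_g^{n/2-2}(\Delta_g\mathsf P-\nabla^2J)+\text{lower order terms}$, where $\mathsf P=\frac1{n-2}\big(\mathrm{Ric}-\frac{\mathrm{scal}}{2(n-1)}g\big)$ is the Schouten tensor, $J$ its trace, and $\Delta_g$ the Laplacian of $g$.
   Formalization: Two formulas are corrected: the series multiplying du^2 in the ambient metric carries a factor 2 (since g has 2h du^2), and with the stated normalisation of the obstruction tensor, O = Δ^s h/(2-n) du^2 rather than Δ^s h du^2; n ≥ 3 is assumed. *)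

(* Defs.v *)
From HB Require Import structures.
From mathcomp Require Import all_boot all_order all_algebra.
From mathcomp Require Import all_classical all_reals all_analysis.

Set Implicit Arguments.
Unset Strict Implicit.
Unset Printing Implicit Defensive.

Import Order.TTheory GRing.Theory Num.Theory.
Import numFieldNormedType.Exports.

Local Open Scope classical_set_scope.
Local Open Scope ring_scope.

(* For A open in a finite-dimensional V, this is C^oo on A.  Derivatives of
   total functions at points of the open set A only see the values on A. *)
Definition smooth_on (R : realType) (V : normedModType R) (A : set V)
    (f : V -> R) : Prop :=
  forall (s : seq V) (p : V), A p ->
    let F : V -> R := foldr (fun v (G : V -> R) => fun q => 'D_v G q) f s in
    {for p, continuous F} /\ forall v, derivable F p v.

(* Around every point a of A, h (a + y) is the sum of an absolutely convergent
   multi-variable power series; the sums run over the boxes of multi-indices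
   alpha with all alpha_i < N, and `|y| is the sup norm. *)
Definition real_analytic_on (R : realType) (d : nat) (h : 'rV[R]_d -> R)
    (A : set 'rV[R]_d) : Prop :=
  forall a, A a -> exists (c : ('I_d -> nat) -> R) (r : R),
    0 < r /\
    forall y : 'rV[R]_d, `|y| < r ->
      let term (N : nat) (alpha : {ffun 'I_d -> 'I_N}) : R :=
        c (fun i => alpha i) * \prod_(i < d) y 0 i ^+ alpha i in
      cvgn (fun N => \sum_(alpha : {ffun 'I_d -> 'I_N}) `|term N alpha| : R) /\
      (fun N => \sum_(alpha : {ffun 'I_d -> 'I_N}) term N alpha : R)
        @ \oo --> h (a + y).

(* The symmetric bilinear form with Gram matrix G has p positive and q negative
   directions (in particular it is nondegenerate). *)
Definition has_signature (R : realType) (I : finType) (p q : nat)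
    (G : I -> I -> R) : Prop :=
  exists (P : I -> I -> R) (neg : {set I}),
    [/\ #|~: neg| = p, #|neg| = q &
        forall a b, \sum_c \sum_d P a c * G c d * P b d
                    = (-1) ^+ (a \in neg) *+ (a == b)].

(* Coordinates (rho, x^1, .., x^n, t) on the ambient space, which is a formal
   neighbourhood of {rho = 0} in R x M x (0, +oo).  The point (0, x, t) is the
   element t^2 g_x of the ray bundle Q, so that iota is the inclusion of
   {rho = 0}, and the dilations act by s . (rho, x, t) = (rho, x, s t). *)
Definition amb_idx (n : nat) : finType := (bool + 'I_n)%type.
Definition irho {n : nat} : amb_idx n := inl false.
Definition it {n : nat} : amb_idx n := inl true.
Definition ix {n : nat} (i : 'I_n) : amb_idx n := inr i.

Definition ray_domain (R : realType) (n : nat) (M : set 'rV[R]_n) :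
    set ('rV[R]_n * R) :=
  [set p | M p.1 /\ 0 < p.2].

(* Formal power series in rho: F k (x, t) is the coefficient of rho ^ k. *)
Definition fser (R : realType) (n : nat) := nat -> 'rV[R]_n * R -> R.

Definition fmul (R : realType) (n : nat) (F G : fser R n) : fser R n :=
  fun k p => \sum_(j < k.+1) F j p * G (k - j)%N p.

Definition fpartial (R : realType) (n : nat) (a : amb_idx n) (F : fser R n) :
    fser R n :=
  match a with
  | inl false => fun k p => k.+1%:R * F k.+1 p
  | inl true => fun k p => 'D_((0 : 'rV[R]_n), (1 : R)) (F k) p
  | inr i => fun k p => 'D_(delta_mx 0 i : 'rV[R]_n, (0 : R)) (F k) p
  end.

Definition amb_tensor2 (R : realType) (n : nat) :=
  amb_idx n -> amb_idx n -> fser R n.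

Definition is_inverse (R : realType) (n : nat) (A : set ('rV[R]_n * R))
    (g gi : amb_tensor2 R n) : Prop :=
  forall a b k p, A p ->
    \sum_c fmul (g a c) (gi c b) k p = ((k == 0%N) && (a == b))%:R.

Definition christoffel (R : realType) (n : nat) (g gi : amb_tensor2 R n)
    (c a b : amb_idx n) : fser R n :=
  fun k p => 2^-1 * \sum_d
    fmul (gi c d) (fun l q => fpartial a (g b d) l q + fpartial b (g a d) l q
                              - fpartial d (g a b) l q) k p.

(* R_ab = d_c G^c_ab - d_b G^c_ac + G^c_cd G^d_ab - G^c_bd G^d_ac, positive on
   round spheres. *)
Definition ricci (R : realType) (n : nat) (g gi : amb_tensor2 R n)
    (a b : amb_idx n) : fser R n :=
  let Gam := christoffel g gi in
  fun k p => \sum_c (fpartial c (Gam c a b) k p - fpartial b (Gam c a c) k p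
    + \sum_d (fmul (Gam c c d) (Gam d a b) k p
              - fmul (Gam c b d) (Gam d a c) k p)).

Definition ricci_flat (R : realType) (n : nat) (A : set ('rV[R]_n * R))
    (g : amb_tensor2 R n) : Prop :=
  exists gi, is_inverse A g gi /\
    forall a b k p, A p -> ricci g gi a b k p = 0.

Definition lie_derivative (R : realType) (n : nat) (X : amb_idx n -> fser R n)
    (g : amb_tensor2 R n) : amb_tensor2 R n :=
  fun a b k p => \sum_c (fmul (X c) (fpartial c (g a b)) k p
    + fmul (fpartial a (X c)) (g c b) k p
    + fmul (fpartial b (X c)) (g a c) k p).

(* t d/dt, the fundamental vector field of the dilations. *)
Definition fundamental_field (R : realType) (n : nat) :
    amb_idx n -> fser R n :=
  fun a k p => p.2 *+ ((a == it) && (k == 0%N)).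

(* The pullback to Q of the coefficient of rho ^ k in B is t ^ w times the
   pullback of the tensor T on M along Q -> M. *)
Definition pulls_back_to (R : realType) (n : nat) (M : set 'rV[R]_n)
    (B : amb_tensor2 R n) (k w : nat) (T : 'rV[R]_n -> 'M[R]_n) : Prop :=
  forall x t, M x -> 0 < t ->
    [/\ B it it k (x, t) = 0,
        forall i, B it (ix i) k (x, t) = 0 /\ B (ix i) it k (x, t) = 0 &
        forall i j, B (ix i) (ix j) k (x, t) = t ^+ w * T x i j].

(* Since t^2 g_x is the point (0, x, t) of Q, pulling back to t^2 g is the
   condition iota^* gt = g_x (dpi ., dpi .) at every point g_x of Q. *)
Definition is_pre_ambient (R : realType) (n : nat) (M : set 'rV[R]_n)
    (g : 'rV[R]_n -> 'M[R]_n) (gt : amb_tensor2 R n) : Prop :=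
  [/\ forall a b k p, ray_domain M p -> gt a b k p = gt b a k p,
      forall a b k, smooth_on (ray_domain M) (gt a b k),
      forall x t, M x -> 0 < t -> exists p q,
        has_signature p q (g x) /\
        has_signature p.+1 q.+1 (fun a b => gt a b 0%N (x, t)),
      forall a b k p, ray_domain M p ->
        lie_derivative (@fundamental_field R n) gt a b k p = 2 * gt a b k p &
      pulls_back_to M gt 0 2 g].

Definition is_ambient (R : realType) (n : nat) (M : set 'rV[R]_n)
    (g : 'rV[R]_n -> 'M[R]_n) (gt : amb_tensor2 R n) : Prop :=
  is_pre_ambient M g gt /\ ricci_flat (ray_domain M) gt.

(* 2 t drho dt + 2 rho dt^2 + t^2 (sum_k rho^k mu_k); note that
   2 d(t rho) dt = 2 t drho dt + 2 rho dt^2. *)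
Definition normal_form (R : realType) (n : nat)
    (mu : nat -> 'rV[R]_n -> 'M[R]_n) : amb_tensor2 R n :=
  fun a b k p =>
    match a, b with
    | inl true, inl true => 2 *+ (k == 1%N)
    | inl true, inl false | inl false, inl true => p.2 *+ (k == 0%N)
    | inr i, inr j => p.2 ^+ 2 * mu k p.1 i j
    | _, _ => 0
    end.

(* Every ambient metric can be brought into normal form with respect to a chosen
   metric g of the conformal class by a diffeomorphism fixing Q and commuting
   with the dilations, so existence is stated for normal forms. *)
Definition has_ambient_metric (R : realType) (n : nat) (M : set 'rV[R]_n)
    (g : 'rV[R]_n -> 'M[R]_n) : Prop :=
  exists mu, is_ambient M g (normal_form mu).

(* The obstruction tensor in even dimension n = 2 s >= 4.  One solves
   Ric = O(rho ^ (s - 1)) with the rho ^ (s - 1)-coefficient of Ric pulling back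
   on Q to a trace-free tensor T on M; then O := c_n T.  The constant c_n is the
   one for which O = Delta ^ (s - 2) (Delta P - nabla^2 J) + lower order terms:
   for gamma trace- and divergence-free, g(rho) = flat + epsilon
   sum_(k < s) rho ^ k Delta ^ k gamma / (k! prod_(1 <= j <= k) (2 j - n)) gives,
   to first order in epsilon,
   T = - Delta ^ s gamma / (2 (-2) ^ (s - 1) (s - 1)! ^ 2), while
   P = - Delta gamma / (2 (n - 2)) and J = 0. *)
Definition obstruction_constant (R : realType) (n : nat) : R :=
  let s := n./2 in (-2) ^+ s.-1 * (s.-1)`!%:R ^+ 2 / (n%:R - 2).

Definition is_obstruction_tensor (R : realType) (n : nat) (M : set 'rV[R]_n)
    (g O : 'rV[R]_n -> 'M[R]_n) : Prop :=
  let s := n./2 in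
  exists (mu : nat -> 'rV[R]_n -> 'M[R]_n) (gi : amb_tensor2 R n)
         (T : 'rV[R]_n -> 'M[R]_n),
    let gt := normal_form mu in
    [/\ is_pre_ambient M g gt,
        is_inverse (ray_domain M) gt gi,
        forall a b k p, (k < s.-1)%N -> ray_domain M p ->
          ricci gt gi a b k p = 0,
        pulls_back_to M (ricci gt gi) s.-1 0 T &
        forall x, M x -> \tr (invmx (g x) *m T x) = 0 /\
                         O x = obstruction_constant R n *: T x].

(* Dimension n = m + 2, with coordinates p = (x^1, .., x^m, u, r); h is a
   function of the first m + 1 of them. *)
Definition coord_x (m : nat) (i : 'I_m) : 'I_m.+2 :=
  widen_ord (leqnSn m.+1) (widen_ord (leqnSn m) i).
Definition coord_u (m : nat) : 'I_m.+2 := widen_ord (leqnSn m.+1) ord_max.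
Definition coord_r (m : nat) : 'I_m.+2 := ord_max.

Definition forget_r (R : realType) (m : nat) (p : 'rV[R]_m.+2) : 'rV[R]_m.+1 :=
  \row_j p 0 (widen_ord (leqnSn m.+1) j).

Definition du2 (R : realType) (m : nat) : 'M[R]_m.+2 :=
  delta_mx (coord_u m) (coord_u m).

(* 2 du dr has the two matrix entries g_ur = g_ru = 1, and 2 h du^2 the single
   entry g_uu = 2 h. *)
Definition pp_metric (R : realType) (m : nat) (h : 'rV[R]_m.+1 -> R)
    (p : 'rV[R]_m.+2) : 'M[R]_m.+2 :=
  \sum_(i < m) delta_mx (coord_x i) (coord_x i)
  + (delta_mx (coord_u m) (coord_r m) + delta_mx (coord_r m) (coord_u m))
  + (2 * h (forget_r p)) *: du2 R m.

Definition laplacian_x (R : realType) (m : nat) (f : 'rV[R]_m.+1 -> R) :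
    'rV[R]_m.+1 -> R :=
  fun y => \sum_(i < m)
    let e : 'rV[R]_m.+1 := delta_mx 0 (widen_ord (leqnSn m) i) in
    'D_e (fun z => 'D_e f z : R) y.

Definition p_coef (R : realType) (n k : nat) : R :=
  \prod_(1 <= j < k.+1) ((2 * j)%:R - n%:R).

(* The coefficients of rho ^ k in
     g + 2 (sum_(k >= 1) Delta ^ k h / (k! p_k) rho ^ k) du^2,
   the terms with k >= n / 2 being dropped when n = m + 2 is even.  The factor 2
   matches g_uu = 2 h: the rho-coefficient has to be 2 P, and
   Ric(g) = - Delta h du^2 gives 2 P = 2 Delta h / (2 - n) du^2. *)
Definition pp_ambient_coef (R : realType) (m : nat) (h : 'rV[R]_m.+1 -> R)
    (k : nat) (p : 'rV[R]_m.+2) : 'M[R]_m.+2 :=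
  if k == 0%N then pp_metric h p
  else if ~~ odd m.+2 && (m.+2 <= 2 * k)%N then 0
  else (2 * (iter k (@laplacian_x R m) h (forget_r p)
             / (k`!%:R * p_coef R m.+2 k))) *: du2 R m.

(* Main.v *)
Require Import Defs.
From HB Require Import structures.
From mathcomp Require Import all_boot all_order all_algebra.
From mathcomp Require Import all_classical all_reals all_analysis.
From mathcomp Require Import perm ring lra.

Set Implicit Arguments.
Unset Strict Implicit.
Unset Printing Implicit Defensive.

Import Order.TTheory GRing.Theory Num.Theory.
Import numFieldNormedType.Exports.

Local Open Scope classical_set_scope.
Local Open Scope ring_scope.

(** In normal form the metric is determined by the power series
    gamma(rho) = sum_k rho ^ k mu_k, and the connection of the ambient metric is
    explicit: besides powers of t it only involves gamma, its inverse, gamma'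
    and the connection of gamma on M.  Contracting gives the equation
      Ric_ij = rho gamma'' - rho gamma' gamma^-1 gamma' + (1/2) rho tau gamma'
               - (n/2 - 1) gamma' - (1/2) tau gamma + Ric(gamma)
    with tau = tr(gamma^-1 gamma'), together with
      Ric_rhorho = - (1/2) tau' - (1/4) tr (gamma^-1 gamma')^2.

    Uniqueness ([pp_unique]).  If two series agree below order k = K + 1, then at
    order rho ^ K the tangential equations differ only by
      k (k - n/2) psi - (k/2) tr(g^-1 psi) g,
    where psi is the difference of the coefficients mu_k ([ricci_xx_lead]).
    Hence psi is a multiple of g when k <> n/2, its trace satisfies
    (k - n) tr psi = 0, and in the remaining case k = n the trace is killed by
    the rho-rho equation ([ricci_rhorho_lead]).

    Existence ([pp_series_ambient]).  Inside the family
    gamma = g_flat + H(rho) du^2, with H a power series of functions that do not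
    depend on r, the covector du is null and orthogonal to dH.  So all the
    nonlinear terms vanish, and Ricci-flatness reduces to the linear equation
      rho H'' - (n/2 - 1) H' - (1/2) Delta H = 0,
    that is, k (2 k - n) H_k = Delta H_(k-1) ([pp_ricci_xxE]).  Starting with
    H_0 = 2 h this gives the series of the theorem, as long as 2 k <> n.

    Obstruction ([pp_ambient_necessary], [pp_obstruction]).  For n = 2 s the
    recursion breaks down at k = s, where the coefficient of psi vanishes.  What
    remains is a multiple of g plus a nonzero multiple of Delta^s h du^2; the
    two are independent because du is null, so that Delta^s h = 0 is necessary,
    and the trace-free remainder is the obstruction tensor.

    Two tools carry the computations.  The coefficient sequences of series in
    rho, evaluated at a point, are elements of the commutative ring [fps], in
    which the tensor algebra becomes ring identities; only the derivatives along
    M and t have to be treated as derivatives of functions.  And an analytic h is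
    smooth ([real_analytic_smooth]), because the termwise derivatives of its
    power series satisfy Taylor estimates that are uniform in the partial
    sums. *)

(** * Formal power series in rho as a commutative ring *)

(** A separate name keeps the Cauchy product apart from the pointwise product that
    functions to a ring already carry. *)
Definition fps (R : Type) : Type := nat -> R.

Section FpsRing.
Variable R : comNzRingType.

HB.instance Definition _ := GRing.Zmodule.copy (fps R) (nat -> R).

Definition fps_one : fps R := fun k => (k == 0%N)%:R.
Definition fps_mul (F G : fps R) : fps R :=
  fun k => \sum_(j < k.+1) F j * G (k - j)%N.

(** Up to any order the Cauchy product is a product of polynomials; the ring laws
    are inherited from there. *)
Lemma fps_mul_coefM (F G : fps R) k N : (k < N)%N ->
  fps_mul F G k = ((\poly_(i < N) F i) * (\poly_(i < N) G i))`_k.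
Proof.
move=> kN; rewrite coefM; apply: eq_bigr => i _.
rewrite !coef_poly (leq_ltn_trans (leq_subr _ _) kN).
by rewrite (leq_trans (ltn_ord i) kN).
Qed.

Lemma poly_fps_mul (F G : fps R) k i : (i <= k)%N ->
  (\poly_(j < k.+1) fps_mul F G j)`_i
  = ((\poly_(j < k.+1) F j) * (\poly_(j < k.+1) G j))`_i.
Proof. by move=> ik; rewrite coef_poly ltnS ik (@fps_mul_coefM _ _ _ k.+1). Qed.

Lemma fps_mulA : associative fps_mul.
Proof.
move=> F G H; apply/funext => k.
rewrite !(@fps_mul_coefM _ _ _ k.+1) //.
transitivity ((\poly_(j < k.+1) F j) *
   ((\poly_(j < k.+1) G j) * (\poly_(j < k.+1) H j)))`_k.
  rewrite !coefM; apply: eq_bigr => i _; congr (_ * _).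
  by rewrite poly_fps_mul ?leq_subr.
rewrite mulrA !(coefM, coefMr); apply: eq_bigr => i _; congr (_ * _).
by rewrite poly_fps_mul // -ltnS.
Qed.

Lemma fps_mulC : commutative fps_mul.
Proof.
move=> F G; apply/funext => k.
by rewrite !(@fps_mul_coefM _ _ _ k.+1) // mulrC.
Qed.

Lemma fps_mul1 : left_id fps_one fps_mul.
Proof.
move=> F; apply/funext => k; rewrite /fps_mul big_ord_recl /= subn0 mul1r.
by rewrite big1 ?addr0 // => i _; rewrite /fps_one /= mul0r.
Qed.

Lemma fps_mulDl : left_distributive fps_mul +%R.
Proof.
move=> F G H; apply/funext => k; transitivity (fps_mul F H k + fps_mul G H k) => //.
rewrite /fps_mul -big_split /=.
by apply: eq_bigr => i _; rewrite -mulrDl.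
Qed.

Lemma fps_one_neq0 : fps_one != 0 :> fps R.
Proof.
apply/eqP => /(congr1 (fun F : fps R => F 0%N)) eq10.
by have /eqP : (1 : R) = 0 by []; rewrite oner_eq0.
Qed.

HB.instance Definition _ := GRing.Zmodule_isComNzRing.Build (fps R)
  fps_mulA fps_mulC fps_mul1 fps_mulDl fps_one_neq0.

Lemma fpsD (F G : fps R) k : (F + G) k = F k + G k. Proof. by []. Qed.
Lemma fpsN (F : fps R) k : (- F) k = - F k. Proof. by []. Qed.
Lemma fps1 k : (1 : fps R) k = (k == 0%N)%:R. Proof. by []. Qed.
Lemma fpsM (F G : fps R) k : (F * G) k = \sum_(j < k.+1) F j * G (k - j)%N.
Proof. by []. Qed.

Lemma fps_sum I (r : seq I) (P : pred I) (F : I -> fps R) k :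
  (\sum_(i <- r | P i) F i) k = \sum_(i <- r | P i) F i k.
Proof. by elim/big_rec2: _ => // i x y _ <-. Qed.

Definition fpsC (c : R) : fps R := fun k => if k == 0%N then c else 0.
Definition fpsX : fps R := fun k => (k == 1%N)%:R.
Definition fpsD1 (F : fps R) : fps R := fun k => k.+1%:R * F k.+1.

Lemma fpsC_is_zmod : zmod_morphism fpsC.
Proof.
by move=> a b; apply/funext => -[|k]; rewrite fpsD fpsN //= subrr.
Qed.

Lemma fpsCM c F k : (fpsC c * F) k = c * F k.
Proof.
rewrite fpsM big_ord_recl /= subn0 big1 ?addr0 // => i _.
by rewrite /fpsC /= mul0r.
Qed.

Lemma fpsC_is_monoid : monoid_morphism fpsC.
Proof.
split; first by apply/funext => -[|k].
by move=> a b; apply/funext => -[|k]; rewrite fpsCM /fpsC //= mulr0.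
Qed.

HB.instance Definition _ := GRing.isZmodMorphism.Build R (fps R) fpsC fpsC_is_zmod.
HB.instance Definition _ := GRing.isMonoidMorphism.Build R (fps R) fpsC fpsC_is_monoid.

Lemma fpsXM F k : (fpsX * F) k = if k is j.+1 then F j else 0.
Proof.
rewrite fpsM; case: k => [|k]; first by rewrite big_ord1 /fpsX mul0r.
rewrite 2!big_ord_recl /= /fpsX /= mul0r add0r mul1r subSS subn0.
by rewrite big1 ?addr0 // => i _; rewrite mul0r.
Qed.

Lemma fpsD1_is_zmod : zmod_morphism fpsD1.
Proof. by move=> F G; apply/funext => k; rewrite fpsD fpsN /fpsD1 fpsD fpsN mulrBr. Qed.
HB.instance Definition _ :=
  GRing.isZmodMorphism.Build (fps R) (fps R) fpsD1 fpsD1_is_zmod.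

Lemma fpsD1C c : fpsD1 (fpsC c) = 0.
Proof. by apply/funext => k; rewrite /fpsD1 mulr0. Qed.

Lemma fpsD1CM c F : fpsD1 (fpsC c * F) = fpsC c * fpsD1 F.
Proof. by apply/funext => k; rewrite fpsCM /fpsD1 fpsCM mulrCA. Qed.

Lemma fpsD1XM F : fpsD1 (fpsX * F) = F + fpsX * fpsD1 F.
Proof.
apply/funext => k; rewrite fpsD fpsXM /fpsD1 fpsXM.
by case: k => [|k]; rewrite ?mul1r ?addr0 // -[k.+2%:R]natr1 mulrDl mul1r addrC.
Qed.

Definition eqmod (K : nat) (F G : fps R) : Prop :=
  forall k, (k < K)%N -> F k = G k.

Lemma eqmod_refl K F : eqmod K F F. Proof. by []. Qed.
Lemma eqmod_sym K F G : eqmod K F G -> eqmod K G F.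
Proof. by move=> h k kK; rewrite h. Qed.
Lemma eqmod_trans K F G H : eqmod K F G -> eqmod K G H -> eqmod K F H.
Proof. by move=> h h' k kK; rewrite h ?h'. Qed.
Lemma eqmodW K L F G : (L <= K)%N -> eqmod K F G -> eqmod L F G.
Proof. by move=> LK h k kL; apply: h; apply: leq_trans LK. Qed.
Lemma eqmodD K F F' G G' :
  eqmod K F F' -> eqmod K G G' -> eqmod K (F + G) (F' + G').
Proof. by move=> h h' k kK; rewrite !fpsD h ?h'. Qed.
Lemma eqmodN K F F' : eqmod K F F' -> eqmod K (- F) (- F').
Proof. by move=> h k kK; rewrite !fpsN h. Qed.
Lemma eqmodM K F F' G G' :
  eqmod K F F' -> eqmod K G G' -> eqmod K (F * G) (F' * G').
Proof.
move=> h h' k kK; rewrite !fpsM; apply: eq_bigr => i _.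
rewrite h ?h' //; first exact: leq_ltn_trans (leq_subr _ _) kK.
by apply: leq_trans kK; apply: ltn_ord.
Qed.
Lemma eqmod_sum K I (r : seq I) (P : pred I) (F G : I -> fps R) :
  (forall i, eqmod K (F i) (G i)) ->
  eqmod K (\sum_(i <- r | P i) F i) (\sum_(i <- r | P i) G i).
Proof. by move=> h k kK; rewrite !fps_sum; apply: eq_bigr => i _; apply: h. Qed.
Lemma eqmodD1 K F G : eqmod K.+1 F G -> eqmod K (fpsD1 F) (fpsD1 G).
Proof. by move=> h k kK; rewrite /fpsD1 h. Qed.
Lemma eqmodXM K F G : eqmod K F G -> eqmod K.+1 (fpsX * F) (fpsX * G).
Proof. by move=> h [|k] kK; rewrite !fpsXM // h. Qed.

(** The coefficient at which two products first differ only sees the constant term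
    of the first factor. *)
Lemma fpsM_lead K F F' G G' : eqmod K.+1 F F' -> eqmod K G G' ->
  (F * G) K - (F' * G') K = F 0%N * (G K - G' K).
Proof.
move=> h h'; rewrite !fpsM !big_ord_recl /= subn0 h // mulrBr opprD addrACA.
rewrite -sumrB big1 ?addr0 // => i _; rewrite h ?h' ?subrr //.
  by rewrite /bump /= add1n; case: (K) i => [[]//|k i]; rewrite subSS ltnS leq_subr.
by rewrite /bump /= add1n ltnS; apply: ltn_ord.
Qed.

End FpsRing.

#[global] Hint Resolve eqmod_refl : core.

(** * Smooth functions on open sets *)

Section SmoothCalculus.
Variables (R : realType) (V : normedModType R).
Implicit Types (A : set V) (f g : V -> R).

(** The definition of smoothness quantifies over lists of directions; peeling off
    the innermost direction turns it into an induction on the number of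
    derivatives, which suits the product rule. *)
Fixpoint Ck A (k : nat) f : Prop :=
  (forall p, A p -> {for p, continuous f} /\ forall v, derivable f p v) /\
  (if k is j.+1 then forall v, Ck A j ('D_v f) else True).

Lemma CkW A k f : Ck A k.+1 f -> Ck A k f.
Proof.
elim: k f => [|k IH] f [cdf Df]; first by split.
by split=> // v; apply: IH.
Qed.

Lemma Ck_derive A k f v : Ck A k.+1 f -> Ck A k ('D_v f).
Proof. by move=> [_]; apply. Qed.

Lemma Ck0 A k f p : Ck A k f -> A p ->
  {for p, continuous f} /\ forall v, derivable f p v.
Proof. by case: k => [|k] [h _]; apply: h. Qed.

Lemma smooth_onP A f : smooth_on A f <-> forall k, Ck A k f.
Proof.
split=> [sf k|Cf].
  elim: k f sf => [|k IH] f sf; first by split=> // p Ap; apply: (sf [::] p Ap).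
  split=> [p Ap|v]; first exact: (sf [::] p Ap).
  apply: IH => s p Ap; have := sf (rcons s v) p Ap.
  by rewrite -cats1 foldr_cat.
move=> s; elim/last_ind: s f Cf => [|s v IH] f Cf p Ap; first exact: (Ck0 (Cf 0%N)).
rewrite -cats1 foldr_cat /=; apply: IH => // k.
exact: Ck_derive (Cf k.+1).
Qed.

Lemma C0_eq A f g p : open A -> (forall q, A q -> f q = g q) -> A p ->
  {for p, continuous f} /\ (forall v, derivable f p v) ->
  {for p, continuous g} /\ (forall v, derivable g p v).
Proof.
move=> oA fg Ap [cf df].
have nfg : \forall q \near p, f q = g q.
  by near=> q; apply: fg; near: q; apply: open_nbhs_nbhs.
split; last by move=> v; apply: near_eq_derivable (df v).
have cfg : f x @[x --> p] --> g p by rewrite -(fg p Ap); exact: cf.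
apply: cvg_trans cfg; apply: near_eq_cvg; near=> q.
by apply: fg; near: q; apply: open_nbhs_nbhs.
Unshelve. all: by end_near. Qed.

Lemma Ck_eq A k f g : open A -> (forall p, A p -> f p = g p) ->
  Ck A k f -> Ck A k g.
Proof.
move=> oA; elim: k f g => [|k IH] f g fg Cf.
  by split=> // p Ap; exact: (C0_eq oA fg Ap (Ck0 Cf Ap)).
split=> [p Ap|v]; first exact: (C0_eq oA fg Ap (Ck0 Cf Ap)).
have [_ /(_ v) Dfv] := Cf; apply: IH Dfv => p Ap.
apply: near_eq_derive; near=> q; apply: fg.
by near: q; apply: open_nbhs_nbhs.
Unshelve. all: by end_near. Qed.

Lemma Ck_cst A k (c : R) : Ck A k (cst c).
Proof.
have C0 c' p : {for p, continuous (cst c' : V -> R)} /\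
    forall v, derivable (cst c' : V -> R) p v.
  by split; [exact: cst_continuous|move=> v; exact: derivable_cst].
elim: k c => [|k IH] c; first by split.
split=> // v; have -> : 'D_v (cst c) = cst 0 :> (V -> R).
  by apply/funext => p; rewrite derive_cst.
exact: IH.
Qed.

Lemma CkD A k f g : open A -> Ck A k f -> Ck A k g -> Ck A k (f + g).
Proof.
move=> oA; elim: k f g => [|k IH] f g Cf Cg.
  split=> // p Ap; have [cf df] := Ck0 Cf Ap; have [cg dg] := Ck0 Cg Ap.
  by split; [exact: continuousD|move=> v; exact: derivableD].
split=> [p Ap|v].
  have [cf df] := Ck0 Cf Ap; have [cg dg] := Ck0 Cg Ap.
  by split; [exact: continuousD|move=> v; exact: derivableD].
apply: (@Ck_eq _ _ ('D_v f + 'D_v g)) => //; last first.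
  by apply: IH; apply: Ck_derive.
move=> p Ap; have [_ df] := Ck0 Cf Ap; have [_ dg] := Ck0 Cg Ap.
by rewrite deriveD.
Qed.

Lemma CkM A k f g : open A -> Ck A k f -> Ck A k g -> Ck A k (f * g).
Proof.
move=> oA; elim: k f g => [|k IH] f g Cf Cg.
  split=> // p Ap; have [cf df] := Ck0 Cf Ap; have [cg dg] := Ck0 Cg Ap.
  by split; [exact: continuousM|move=> v; exact: derivableM].
split=> [p Ap|v].
  have [cf df] := Ck0 Cf Ap; have [cg dg] := Ck0 Cg Ap.
  by split; [exact: continuousM|move=> v; exact: derivableM].
apply: (@Ck_eq _ _ (f * 'D_v g + g * 'D_v f)) => //; last first.
  by apply: CkD => //; apply: IH; solve [exact: CkW | exact: Ck_derive].
move=> p Ap; have [_ df] := Ck0 Cf Ap; have [_ dg] := Ck0 Cg Ap.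
by rewrite deriveM.
Qed.

Lemma smooth_on_cst A c : smooth_on A (cst c : V -> R).
Proof. by apply/smooth_onP => k; apply: Ck_cst. Qed.

Lemma smooth_onD A f g : open A -> smooth_on A f -> smooth_on A g ->
  smooth_on A (f + g).
Proof.
by move=> oA /smooth_onP Cf /smooth_onP Cg; apply/smooth_onP => k; apply: CkD.
Qed.

Lemma smooth_onM A f g : open A -> smooth_on A f -> smooth_on A g ->
  smooth_on A (f * g).
Proof.
by move=> oA /smooth_onP Cf /smooth_onP Cg; apply/smooth_onP => k; apply: CkM.
Qed.

Lemma smooth_on_derive A f v : smooth_on A f -> smooth_on A ('D_v f).
Proof.
by move=> /smooth_onP Cf; apply/smooth_onP => k; apply: Ck_derive (Cf k.+1).
Qed.

Lemma smooth_on_eq A f g : open A -> (forall p, A p -> f p = g p) ->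
  smooth_on A f -> smooth_on A g.
Proof.
by move=> oA fg /smooth_onP Cf; apply/smooth_onP => k; apply: Ck_eq (Cf k).
Qed.

Lemma smooth_on_sum A (I : finType) (F : I -> V -> R) : open A ->
  (forall i, smooth_on A (F i)) -> smooth_on A (fun p => \sum_i F i p).
Proof.
move=> oA sF; have -> : (fun p => \sum_i F i p) = \sum_i F i.
  by apply/funext => p; rewrite fct_sumE.
have s0 : smooth_on A (0 : V -> R).
  by have -> : (0 : V -> R) = cst 0 by []; apply: smooth_on_cst.
apply: (big_ind (smooth_on A) s0) => [f g|i _]; last exact: sF.
exact: smooth_onD.
Qed.

(** Smoothness constrains the derivatives of a total function point by point, so a
    different neighbourhood may be used at each point. *)
Lemma smooth_on_local A f :
  (forall p, A p -> exists2 U, U p & smooth_on U f) -> smooth_on A f.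
Proof. by move=> h s p Ap; have [U Up sf] := h p Ap; apply: sf. Qed.

Lemma smooth_on_derivable A f p v : smooth_on A f -> A p -> derivable f p v.
Proof. by move=> sf Ap; have [_] := sf [::] p Ap; apply. Qed.

End SmoothCalculus.

(** Difference quotients of f \o L are literally difference quotients of f, so the
    chain rule for affine L holds already for the limits that define derivatives. *)
Section AffineComposition.
Variables (R : realType) (V W : normedModType R) (L L' : V -> W).
Hypothesis L_affine : forall s v x, L (s *: v + x) = s *: L' v + L x.
Hypothesis L_continuous : continuous L.

Lemma derive_comp_affine (f : W -> R) v x :
  'D_v (f \o L) x = 'D_(L' v) f (L x).
Proof.
rewrite /derive; congr (lim _).
set F := (X in (X @ _) = _); set G := (X in _ = (X @ _)).
suff -> : F = G by [].
by apply/funext => s; rewrite /F /G /= L_affine.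
Qed.

Lemma derivable_comp_affine (f : W -> R) v x :
  derivable f (L x) (L' v) -> derivable (f \o L) x v.
Proof.
rewrite /derivable.
set F := (X in cvg (X @ _) -> _); set G := (X in _ -> cvg (X @ _)).
suff -> : F = G by [].
by apply/funext => s; rewrite /F /G /= L_affine.
Qed.

Lemma Ck_comp_affine (A : set V) (B : set W) k f :
  (forall x, A x -> B (L x)) -> Ck B k f -> Ck A k (f \o L).
Proof.
move=> AB.
have C0 j g p : Ck B j g -> A p -> {for p, continuous (g \o L)} /\
    forall v, derivable (g \o L) p v.
  move=> Cg Ap; have [cg dg] := Ck0 Cg (AB p Ap).
  split=> [|v]; last exact: derivable_comp_affine.
  by apply: continuous_comp => //; apply: L_continuous.
elim: k f => [|k IH] f Cf.
  by split=> // p; apply: C0 Cf.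
split=> [p|v]; first exact: C0 Cf.
have -> : 'D_v (f \o L) = 'D_(L' v) f \o L.
  by apply/funext => x; rewrite derive_comp_affine.
by apply: IH; apply: Ck_derive.
Qed.

Lemma smooth_on_comp_affine (A : set V) (B : set W) f :
  (forall x, A x -> B (L x)) -> smooth_on B f -> smooth_on A (f \o L).
Proof.
by move=> AB /smooth_onP Cf; apply/smooth_onP => k; apply: Ck_comp_affine (Cf k).
Qed.

End AffineComposition.

(** * Formal series on the ray domain *)

Section PartialDerivatives.
Variables (R : realType) (V : normedModType R).

Lemma pairl_affine (t s : R) (v x : V) :
  (s *: v + x, t) = s *: (v, 0) + (x, t) :> V * R.
Proof. by congr pair; rewrite /= scaler0 add0r. Qed.

Lemma pairr_affine (x : V) (s v t : R) :
  (x, s *: v + t) = s *: (0, v) + (x, t) :> V * R.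
Proof. by congr pair; rewrite /= scaler0 add0r. Qed.

Lemma derive_pairl (F : V * R -> R) (v x : V) (t : R) :
  'D_(v, 0) F (x, t) = 'D_v (fun y => F (y, t)) x.
Proof. exact: esym (derive_comp_affine (pairl_affine t) F v x). Qed.

Lemma derivable_pairl (F : V * R -> R) (v x : V) (t : R) :
  derivable F (x, t) (v, 0) -> derivable (fun y => F (y, t)) x v.
Proof. exact: (derivable_comp_affine (pairl_affine t)). Qed.

Lemma derive_pairr (F : V * R -> R) (x : V) (t : R) :
  'D_(0, 1) F (x, t) = 'D_1 (fun s => F (x, s)) t.
Proof. exact: esym (derive_comp_affine (pairr_affine x) F 1 t). Qed.

Lemma derivable_cmul (f : V -> R) (c : R) (x v : V) :
  derivable f x v -> derivable (fun y => c * f y) x v.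
Proof. by move=> df; apply: derivableM. Qed.

Lemma derive_cmul (f : V -> R) (c : R) (x v : V) : derivable f x v ->
  'D_v (fun y => c * f y) x = c * 'D_v f x.
Proof. exact: deriveMl. Qed.

Lemma derive_mulc (f : V -> R) (c : R) (x v : V) : derivable f x v ->
  'D_v (fun y => f y * c) x = 'D_v f x * c.
Proof. by move=> df; rewrite mulrC; apply: deriveMr. Qed.

End PartialDerivatives.

Section FormalSeriesOnRayDomain.
Variables (R : realType) (n : nat) (M : set 'rV[R]_n).
Hypothesis M_open : open M.
Implicit Types (F G : fser R n) (a b c : amb_idx n).

(** The point is frozen and the coefficients become an element of the ring [fps]:
    [fmul] turns into the product. *)
Definition ev F (p : 'rV[R]_n * R) : fps R := fun k => F k p.

Lemma open_ray_domain : open (ray_domain M).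
Proof.
have -> : ray_domain M = (fst @^-1` M) `&` (snd @^-1` [set t : R | 0 < t]).
  by apply/seteqP; split => p.
apply: openI.
- by apply: open_comp => // p _; apply: cvg_fst.
- by apply: open_comp; [move=> p _; apply: cvg_snd | apply: open_gt].
Qed.

Lemma near_ray_domain p : ray_domain M p -> \forall q \near p, ray_domain M q.
Proof. by move=> Ap; apply: open_nbhs_nbhs; split => //; apply: open_ray_domain. Qed.

(** Derivatives at a point of an open set only see the values on that set. *)
Lemma eqmod_fpartial a K F G :
  (forall p, ray_domain M p -> eqmod K.+1 (ev F p) (ev G p)) ->
  forall p, ray_domain M p -> eqmod K (ev (fpartial a F) p) (ev (fpartial a G) p).
Proof.
move=> h p Ap k kK; rewrite /ev /fpartial.
case: a => [[]|i]; last first.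
- apply: near_eq_derive; near=> q; apply: (h q); last exact: ltnW.
  by near: q; apply: near_ray_domain.
- by congr (_ * _); apply: h.
- apply: near_eq_derive; near=> q; apply: (h q); last exact: ltnW.
  by near: q; apply: near_ray_domain.
Unshelve. all: by end_near. Qed.

(** Derivatives along M preserve the order of agreement, whereas the derivative in
    rho of [eqmod_fpartial] loses one order. *)
Lemma eqmod_fpartial_x i K F G :
  (forall p, ray_domain M p -> eqmod K (ev F p) (ev G p)) ->
  forall p, ray_domain M p ->
    eqmod K (ev (fpartial (ix i) F) p) (ev (fpartial (ix i) G) p).
Proof.
move=> h p Ap k kK; apply: near_eq_derive; near=> q; apply: (h q) => //.
by near: q; apply: near_ray_domain.
Unshelve. all: by end_near. Qed.

Lemma eq_fpartial a F G :
  (forall p, ray_domain M p -> ev F p = ev G p) ->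
  forall p, ray_domain M p -> ev (fpartial a F) p = ev (fpartial a G) p.
Proof.
move=> h p Ap; apply/funext => k.
by apply: (@eqmod_fpartial a k.+1 F G) => // q Aq j _; rewrite h.
Qed.

Lemma sum_amb (W : nmodType) (f : amb_idx n -> W) :
  \sum_a f a = f it + f irho + \sum_i f (ix i).
Proof. by rewrite big_sumType big_bool. Qed.

Lemma ev_christoffel (g gi : amb_tensor2 R n) c a b p :
  ev (christoffel g gi c a b) p = fpsC 2^-1 * \sum_d ev (gi c d) p *
    (ev (fpartial a (g b d)) p + ev (fpartial b (g a d)) p
     - ev (fpartial d (g a b)) p).
Proof. by apply/funext => k; rewrite fpsCM fps_sum. Qed.

Lemma ev_ricci (g gi : amb_tensor2 R n) a b p :
  ev (ricci g gi a b) p = \sum_c (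
      ev (fpartial c (christoffel g gi c a b)) p
    - ev (fpartial b (christoffel g gi c a c)) p
    + \sum_d (ev (christoffel g gi c c d) p * ev (christoffel g gi d a b) p
            - ev (christoffel g gi c b d) p * ev (christoffel g gi d a c) p)).
Proof.
apply/funext => k; rewrite fps_sum; apply: eq_bigr => c _.
by rewrite fpsD fps_sum.
Qed.

End FormalSeriesOnRayDomain.

(** * Connection and Ricci curvature of a metric in normal form *)

Section NormalForm.
Variables (R : realType) (n : nat) (M : set 'rV[R]_n).
Variables (mu : nat -> 'rV[R]_n -> 'M[R]_n) (gi : amb_tensor2 R n).
Hypothesis M_open : open M.
Hypothesis mu_derivable : forall k x i j v, M x ->
  derivable (fun y => mu k y i j) x v.
Hypothesis mu_sym : forall k x i j, M x -> mu k x i j = mu k x j i.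
Hypothesis gi_inverse : is_inverse (ray_domain M) (normal_form mu) gi.
Implicit Types (a b c : amb_idx n) (p : 'rV[R]_n * R) (x : 'rV[R]_n).

Local Notation X := (fpsX R).
Local Notation D1 := (@fpsD1 R).

Definition gam x i j : fps R := fun k => mu k x i j.
Definition dgam l x i j : fps R :=
  fun k => 'D_(delta_mx 0 l) (fun y => mu k y i j) x.
(** t^2 times the tangential block of the inverse metric; it turns out to be the
    inverse of [gam], see [gam_gami]. *)
Definition gami p i j : fps R := fpsC p.2 ^+ 2 * ev (gi (ix i) (ix j)) p.

Definition nf_fps a b p : fps R :=
  match a, b with
  | inl true, inl true => fpsC 2 * X
  | inl true, inl false | inl false, inl true => fpsC p.2
  | inr i, inr j => fpsC p.2 ^+ 2 * gam p.1 i j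
  | _, _ => 0
  end.

Lemma ev_normal_form a b p : ev (normal_form mu a b) p = nf_fps a b p.
Proof.
case: a b => [[]|i] [[]|j] //; apply/funext => k; rewrite /ev /nf_fps /= -?rmorphXn /= ?fpsCM //.
- by rewrite /fpsX mulr_natr.
- by rewrite /fpsC; case: k.
- by rewrite /fpsC; case: k.
Qed.

Definition dnf_fps a b c p : fps R :=
  match a, b, c with
  | inl false, inl true, inl true => fpsC 2
  | inl false, inr i, inr j => fpsC p.2 ^+ 2 * D1 (gam p.1 i j)
  | inl true, inl true, inl false | inl true, inl false, inl true => 1
  | inl true, inr i, inr j => fpsC 2 * fpsC p.2 * gam p.1 i j
  | inr l, inr i, inr j => fpsC p.2 ^+ 2 * dgam l p.1 i j
  | _, _, _ => 0
  end.

Lemma ev_fpartial_normal_form a b c p : ray_domain M p ->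
  ev (fpartial a (normal_form mu b c)) p = dnf_fps a b c p.
Proof.
case: p => x t [/= Mx t0].
have drho b' c' : ev (fpartial irho (normal_form mu b' c')) (x, t)
    = D1 (nf_fps b' c' (x, t)) by rewrite -ev_normal_form.
have cst0 (e : 'rV[R]_n * R) (z : R) : 'D_e (fun=> z) (x, t) = 0.
  by rewrite (derive_cst z).
case: a => [[]|l].
- case: b c => [[]|i] [[]|j]; apply/funext => k; rewrite /ev /=;
    rewrite ?cst0 // derive_pairr /=.
  + by rewrite fps1; case: (k == 0%N); [exact: derive_id | exact: derive_cst].
  + by rewrite fps1; case: (k == 0%N); [exact: derive_id | exact: derive_cst].
  + rewrite derive_mulc; last exact: exprn_derivable.
    by rewrite exp_derive -mulrA !fpsCM mulrA [_ *: 1]mulr1.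
- rewrite drho; case: b c => [[]|i] [[]|j] /=; rewrite ?raddf0 //.
  + by rewrite mulrC fpsD1XM fpsD1C mulr0 addr0.
  + by rewrite fpsD1C.
  + by rewrite fpsD1C.
  + by rewrite -!rmorphXn fpsD1CM.
- case: b c => [[]|i] [[]|j]; apply/funext => k; rewrite /ev /=;
    rewrite ?cst0 // derive_pairl /= ?(derive_cst (_ *+ _)) //.
  by rewrite -rmorphXn fpsCM /dgam derive_cmul //; apply: mu_derivable.
Qed.

Lemma fpsC_inv p : ray_domain M p -> fpsC p.2 * fpsC p.2^-1 = 1.
Proof. by move=> [_ t0]; rewrite -rmorphM /= mulfV ?rmorph1 // gt_eqF. Qed.

Lemma fps_inverse p a b : ray_domain M p ->
  \sum_c nf_fps a c p * ev (gi c b) p = (a == b)%:R.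
Proof.
move=> Ap; apply/funext => k; rewrite fps_sum.
under eq_bigr => c _ do rewrite -ev_normal_form.
have -> : ((a == b)%:R : fps R) k = ((k == 0%N) && (a == b))%:R.
  by case: (a == b); rewrite ?andbT ?andbF.
exact: gi_inverse.
Qed.

(** The rho-row of the metric has the single entry t, and its t-row only one more;
    both determine a row of the inverse. *)
Lemma gi_t p b : ray_domain M p ->
  ev (gi it b) p = fpsC p.2^-1 * (irho == b)%:R.
Proof.
move=> Ap; have := fps_inverse irho b Ap; rewrite sum_amb /= => <-.
rewrite big1 => [|i _]; last by rewrite mul0r.
by rewrite mul0r !addr0 mulrCA mulrA fpsC_inv // mul1r.
Qed.

Lemma gi_rho p b : ray_domain M p ->
  ev (gi irho b) p = fpsC p.2^-1 * (it == b)%:R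
    - fpsC p.2^-1 ^+ 2 * fpsC 2 * X * (irho == b)%:R.
Proof.
move=> Ap; have := fps_inverse it b Ap; rewrite sum_amb /= => <-.
rewrite big1 => [|i _]; last by rewrite mul0r.
by rewrite gi_t //; ring: (fpsC_inv Ap).
Qed.

Definition gam_mx x : 'M[fps R]_n := \matrix_(i, j) gam x i j.
Definition gami_mx p : 'M[fps R]_n := \matrix_(i, j) gami p i j.

Lemma gam_gami p : ray_domain M p -> gam_mx p.1 *m gami_mx p = 1%:M.
Proof.
move=> Ap; apply/matrixP => i j; rewrite !mxE.
have := fps_inverse (ix i) (ix j) Ap; rewrite sum_amb /= !mul0r !add0r => <-.
by apply: eq_bigr => l _; rewrite !mxE /gami mulrCA mulrA.
Qed.

Lemma gami_gam p : ray_domain M p -> gami_mx p *m gam_mx p.1 = 1%:M.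
Proof. by move=> Ap; apply: mulmx1C; apply: gam_gami. Qed.

Lemma sum_gam_gami p i j : ray_domain M p ->
  \sum_l gam p.1 i l * gami p l j = (i == j)%:R.
Proof.
move=> Ap; have /matrixP/(_ i j) := gam_gami Ap; rewrite !mxE => <-.
by apply: eq_bigr => l _; rewrite !mxE.
Qed.

Lemma sum_gami_gam p i j : ray_domain M p ->
  \sum_l gami p i l * gam p.1 l j = (i == j)%:R.
Proof.
move=> Ap; have /matrixP/(_ i j) := gami_gam Ap; rewrite !mxE => <-.
by apply: eq_bigr => l _; rewrite !mxE.
Qed.

(** The mixed block of the inverse is annihilated by [gam_mx], which has a left
    inverse by [gami_gam]. *)
Lemma gi_x0 p (b : bool) i : ray_domain M p -> ev (gi (ix i) (inl b)) p = 0.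
Proof.
move=> Ap.
pose v : 'cV[fps R]_n := \col_l (fpsC p.2 ^+ 2 * ev (gi (ix l) (inl b)) p).
have v0 : v = 0.
  rewrite -[v]mul1mx -(gami_gam Ap) -mulmxA [X in _ *m X](_ : _ = 0) ?mulmx0 //.
  apply/matrixP => l j; rewrite !mxE.
  have := fps_inverse (ix l) (inl b) Ap; rewrite sum_amb /= !mul0r !add0r => E.
  by rewrite -[RHS]E; apply: eq_bigr => z _; rewrite !mxE mulrCA mulrA.
have := congr1 (fun w : 'cV_n => fpsC p.2^-1 ^+ 2 * w i 0) v0.
rewrite !mxE mulr0 => <-.
by ring: (fpsC_inv Ap).
Qed.

Lemma gi_xx p i j : ray_domain M p ->
  ev (gi (ix i) (ix j)) p = fpsC p.2^-1 ^+ 2 * gami p i j.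
Proof. by move=> Ap; rewrite /gami; ring: (fpsC_inv Ap). Qed.

(** The Christoffel symbols, with upper index c first. *)
Definition chr_fps c a b p : fps R :=
  match c, a, b with
  | inl true, inr i, inr j => - (fpsC 2^-1 * (fpsC p.2 * D1 (gam p.1 i j)))
  | inl false, inl true, inl false | inl false, inl false, inl true =>
      fpsC p.2^-1
  | inl false, inr i, inr j => X * D1 (gam p.1 i j) - gam p.1 i j
  | inr i, inl true, inr j | inr i, inr j, inl true => fpsC p.2^-1 * (i == j)%:R
  | inr i, inl false, inr j | inr i, inr j, inl false =>
      fpsC 2^-1 * \sum_l gami p i l * D1 (gam p.1 l j)
  | inr k, inr i, inr j => fpsC 2^-1 * \sum_l gami p k l *
      (dgam i p.1 j l + dgam j p.1 i l - dgam l p.1 i j)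
  | _, _, _ => 0
  end.

Lemma gam_sym x i j : M x -> gam x i j = gam x j i.
Proof. by move=> Mx; apply/funext => k; apply: mu_sym. Qed.

Lemma fpsC_half : fpsC 2 * fpsC 2^-1 = 1 :> fps R.
Proof. by rewrite -rmorphM /= mulfV ?rmorph1. Qed.

Lemma christoffel_normal_form c a b p : ray_domain M p ->
  ev (christoffel (normal_form mu) gi c a b) p = chr_fps c a b p.
Proof.
move=> Ap; have [Mx _] := Ap.
have tti := fpsC_inv Ap; have tt2 := fpsC_half.
rewrite ev_christoffel sum_amb.
have tti2 : fpsC p.2 ^+ 2 * fpsC p.2^-1 ^+ 2 = 1 :> fps R.
  by rewrite -exprMn tti expr1n.
(* The constants are abstracted below: [ring] would otherwise see 2 both as a
   numeral and as a series, unrelated to its inverse. *)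
have two2 : 1 + 1 = fpsC 2 :> fps R by rewrite rmorph_nat.
have irt : (irho == it :> amb_idx n) = false by [].
have itr : (it == irho :> amb_idx n) = false by [].
under eq_bigr => l _ do rewrite !ev_fpartial_normal_form //.
rewrite !ev_fpartial_normal_form //.
case: c => [[]|c].
- rewrite !gi_t // irt eqxx; under eq_bigr => l _ do rewrite gi_t // mulr0 mul0r.
  rewrite big1 // addr0.
  case: a b => [[]|i] [[]|j] /=;
    move: (fpsC 2) (fpsC 2^-1) (fpsC p.2) (fpsC p.2^-1) two2 tti tt2 tti2
    => two half t ti two2 tti tt2 tti2; rewrite ?two2; try by ring: tti tt2 tti2.
- rewrite !gi_rho // itr !eqxx;
  under eq_bigr => l _ do rewrite gi_rho // !mulr0 subr0 mul0r.
  rewrite big1 // addr0.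
  case: a b => [[]|i] [[]|j] /=;
    move: (fpsC 2) (fpsC 2^-1) (fpsC p.2) (fpsC p.2^-1) two2 tti tt2 tti2
    => two half t ti two2 tti tt2 tti2; rewrite ?two2; try by ring: tti tt2 tti2.
- rewrite -[inr c]/(ix c) (gi_x0 true c) // (gi_x0 false c) // !mul0r !add0r.
  under eq_bigr => l _ do rewrite gi_xx //.
  have solve0 (f : 'I_n -> fps R) : (forall l, f l = 0) ->
      fpsC 2^-1 * (\sum_l f l) = 0 by move=> f0; rewrite big1 ?mulr0.
  case: a b => [[]|i] [[]|j] /=; try by apply: solve0 => l; ring.
  + rewrite -(sum_gami_gam c j Ap) !mulr_sumr; apply: eq_bigr => l _.
    rewrite (gam_sym j l Mx); move: (fpsC 2) (fpsC 2^-1) tt2 => two half tt2.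
    by ring: tti tt2.
  + rewrite !mulr_sumr; apply: eq_bigr => l _.
    by rewrite (gam_sym j l Mx); ring: tti2.
  + rewrite -(sum_gami_gam c i Ap) !mulr_sumr; apply: eq_bigr => l _.
    rewrite (gam_sym i l Mx); move: (fpsC 2) (fpsC 2^-1) tt2 => two half tt2.
    by ring: tti tt2.
  + rewrite !mulr_sumr; apply: eq_bigr => l _.
    by rewrite (gam_sym i l Mx); ring: tti2.
  + by rewrite !mulr_sumr; apply: eq_bigr => l _; ring: tti2.
Qed.

Definition tau p : fps R := \sum_i \sum_l gami p i l * D1 (gam p.1 l i).
Definition quad p i j : fps R :=
  \sum_k \sum_l D1 (gam p.1 i k) * gami p k l * D1 (gam p.1 l j).

(** The terms of the tangential Ricci curvature whose indices are all tangential,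
    i.e. the Ricci curvature of gamma.  The inverse metric is kept inside the
    Christoffel symbols, so that its derivatives never have to be expanded. *)
Definition intrinsic_ricci i j p : fps R :=
  \sum_k (ev (fpartial (ix k) (christoffel (normal_form mu) gi (ix k) (ix i) (ix j))) p
    - ev (fpartial (ix j) (christoffel (normal_form mu) gi (ix k) (ix i) (ix k))) p
    + \sum_l (chr_fps (ix k) (ix k) (ix l) p * chr_fps (ix l) (ix i) (ix j) p
             - chr_fps (ix k) (ix j) (ix l) p * chr_fps (ix l) (ix i) (ix k) p)).

Lemma ev_fpartial_0 a F p : (forall q, ray_domain M q -> ev F q = 0) ->
  ray_domain M p -> ev (fpartial a F) p = 0.
Proof.
move=> F0 Ap; rewrite (eq_fpartial (G := fun _ _ => 0) M_open a) //.
  by case: a => [[]|i]; apply/funext => k; rewrite /ev /= ?mulr0 // derive_cst.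
Qed.

Lemma sum_mul_delta (W : pzSemiRingType) (f : 'I_n -> W) i :
  \sum_l f l * (l == i)%:R = f i.
Proof.
rewrite (bigD1 i) //= eqxx mulr1 big1 ?addr0 // => l /negbTE ->.
by rewrite mulr0.
Qed.

Lemma fpartial_chr_t i j p : ray_domain M p ->
  ev (fpartial it (christoffel (normal_form mu) gi it (ix i) (ix j))) p
  = - (fpsC 2^-1 * D1 (gam p.1 i j)).
Proof.
move=> Ap; rewrite (eq_fpartial
  (G := fun k p => chr_fps it (ix i) (ix j) p k) M_open it) //; last first.
  by move=> q Aq; rewrite christoffel_normal_form.
apply/funext => k; rewrite /ev /=.
have -> : (fun q : 'rV[R]_n * R =>
    (- (fpsC 2^-1 * (fpsC q.2 * D1 (gam q.1 i j)))) k)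
  = fun q => - 2^-1 * q.2 * (k.+1%:R * mu k.+1 q.1 i j).
  by apply/funext => q; rewrite fpsN !fpsCM /D1 /gam; ring.
case: p Ap => x t Ap; rewrite derive_pairr /=.
rewrite derive_mulc; last by apply: derivable_cmul; apply: derivable_id.
rewrite derive_cmul; last exact: derivable_id.
by rewrite derive_id mulr1 fpsN fpsCM mulNr.
Qed.

Lemma fpartial_chr_rho i j p : ray_domain M p ->
  ev (fpartial irho (christoffel (normal_form mu) gi irho (ix i) (ix j))) p
  = X * D1 (D1 (gam p.1 i j)).
Proof.
move=> Ap.
have -> : ev (fpartial irho (christoffel (normal_form mu) gi irho (ix i) (ix j))) p
    = D1 (ev (christoffel (normal_form mu) gi irho (ix i) (ix j)) p) by [].
by rewrite christoffel_normal_form // raddfB /= fpsD1XM addrAC subrr add0r.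
Qed.

Lemma sum_mul3 (a : fps R) (f g : 'I_n -> fps R) :
  \sum_l a * f l * g l = a * \sum_l f l * g l.
Proof. by rewrite mulr_sumr; apply: eq_bigr => l _; rewrite mulrA. Qed.

Lemma sum_gam_gami_dgam p i j : ray_domain M p ->
  \sum_k gam p.1 i k * \sum_l gami p k l * D1 (gam p.1 l j)
  = D1 (gam p.1 i j).
Proof.
move=> Ap; under eq_bigr => k _ do rewrite -sum_mul3.
rewrite exchange_big /= -[RHS](sum_mul_delta (fun l => D1 (gam p.1 l j))).
apply: eq_bigr => l _; rewrite -mulr_suml sum_gam_gami //.
by rewrite mulrC eq_sym.
Qed.

Lemma quadE p i j : quad p i j =
  \sum_k D1 (gam p.1 i k) * \sum_l gami p k l * D1 (gam p.1 l j).
Proof. by apply: eq_bigr => k _; rewrite sum_mul3. Qed.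

(** The algebraic half of [ricci_xx]: the sums over t and rho are carried out, with
    dA and dB standing for the two derivative terms of the curvature. *)
Lemma ricci_xx_contraction (dA dB : amb_idx n -> fps R) p i j :
  ray_domain M p ->
  dA it = - (fpsC 2^-1 * D1 (gam p.1 i j)) ->
  dA irho = X * D1 (D1 (gam p.1 i j)) ->
  dB it = 0 -> dB irho = 0 ->
  \sum_c (dA c - dB c + \sum_d
     (chr_fps c c d p * chr_fps d (ix i) (ix j) p -
      chr_fps c (ix j) d p * chr_fps d (ix i) c p)) =
    X * D1 (D1 (gam p.1 i j)) - fpsC 2^-1 * (X * (quad p i j + quad p j i))
    + fpsC 2^-1 * (X * tau p * D1 (gam p.1 i j))
    + fpsC (1 - 2^-1 * n%:R) * D1 (gam p.1 i j)
    - fpsC 2^-1 * (tau p * gam p.1 i j)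
    + \sum_k (dA (ix k) - dB (ix k) + \sum_l
        (chr_fps (ix k) (ix k) (ix l) p * chr_fps (ix l) (ix i) (ix j) p -
         chr_fps (ix k) (ix j) (ix l) p * chr_fps (ix l) (ix i) (ix k) p)).
Proof.
move=> Ap dAt dAr dBt dBr; have [Mx _] := Ap.
have tti := fpsC_inv Ap; have tt2 := fpsC_half.
have two2 : 1 + 1 = fpsC 2 :> fps R by rewrite rmorph_nat.
pose Gd k l := \sum_(z < n) gami p k z * D1 (gam p.1 z l).
have sumGd (a b : 'I_n) : \sum_k (X * D1 (gam p.1 a k) - gam p.1 a k) * (fpsC 2^-1 * Gd k b)
    = fpsC 2^-1 * (X * quad p a b) - fpsC 2^-1 * D1 (gam p.1 a b).
  rewrite quadE -(sum_gam_gami_dgam a b Ap) !mulr_sumr -sumrB.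
  by apply: eq_bigr => k _; rewrite -/(Gd k b); ring.
pose S c d := chr_fps c c d p * chr_fps d (ix i) (ix j) p -
              chr_fps c (ix j) d p * chr_fps d (ix i) c p.
have St : \sum_d S it d = fpsC 2^-1 * D1 (gam p.1 i j).
  rewrite sum_amb /S /= !mul0r !subr0 !add0r.
  rewrite -[in RHS](sum_mul_delta (fun l => D1 (gam p.1 l j))) mulr_sumr.
  apply: eq_bigr => l _; rewrite mul0r (gam_sym j l Mx).
  by move: (_%:R) => e; ring: tti.
have Sr : \sum_d S irho d = - (fpsC 2^-1 * (X * quad p j i)).
  rewrite sum_amb /S /= !mul0r !subr0 !addr0.
  have -> : \sum_k (0 * chr_fps (ix k) (ix i) (ix j) p
     - (X * D1 (gam p.1 j k) - gam p.1 j k) * (fpsC 2^-1 * Gd k i))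
     = - (fpsC 2^-1 * (X * quad p j i) - fpsC 2^-1 * D1 (gam p.1 j i)).
    by rewrite -sumGd -sumrN; apply: eq_bigr => k _; rewrite mul0r sub0r.
  by rewrite (gam_sym j i Mx); ring: tti.
have Skt : \sum_k S (ix k) it = fpsC 2^-1 * (1 - n%:R) * D1 (gam p.1 i j).
  transitivity (\sum_(k < n) (- (fpsC 2^-1 * D1 (gam p.1 i j))
      + fpsC 2^-1 * (D1 (gam p.1 i k) * (k == j)%:R))).
    by apply: eq_bigr => k _; rewrite /S /= eqxx mulr1; move: ((k == j)%:R) => e; ring: tti.
  rewrite big_split /= -mulr_sumr sum_mul_delta sumr_const card_ord -mulr_natl.
  by ring.
have Skr : \sum_k S (ix k) irho =
    fpsC 2^-1 * (tau p * (X * D1 (gam p.1 i j) - gam p.1 i j))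
    - (fpsC 2^-1 * (X * quad p i j) - fpsC 2^-1 * D1 (gam p.1 i j)).
  rewrite /S /= -sumGd mulr_suml mulr_sumr -sumrB.
  by apply: eq_bigr => k _; rewrite -/(Gd k j) -/(Gd k k); ring.
transitivity (\sum_c (dA c - dB c + \sum_d S c d)) => //.
transitivity (dA it - dB it + \sum_d S it d + (dA irho - dB irho + \sum_d S irho d)
  + (\sum_k S (ix k) it + \sum_k S (ix k) irho)
  + \sum_k (dA (ix k) - dB (ix k) + \sum_l S (ix k) (ix l))).
  rewrite sum_amb -[RHS]addrA -!big_split /=; congr (_ + _).
  by apply: eq_bigr => k _; rewrite sum_amb addrCA.
congr (_ + _); rewrite St Sr Skt Skr dAt dAr dBt dBr.
rewrite rmorphB rmorph1 rmorphM /= rmorph_nat.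
have -> : 1 - fpsC 2^-1 * n%:R
    = fpsC 2^-1 + fpsC 2^-1 - fpsC 2^-1 * n%:R :> fps R.
  by congr (_ - _); rewrite -tt2 -two2; ring.
by ring.
Qed.

(** The Fefferman-Graham equation along M. *)
Lemma ricci_xx p i j : ray_domain M p ->
  ev (ricci (normal_form mu) gi (ix i) (ix j)) p =
    X * D1 (D1 (gam p.1 i j)) - fpsC 2^-1 * (X * (quad p i j + quad p j i))
    + fpsC 2^-1 * (X * tau p * D1 (gam p.1 i j))
    + fpsC (1 - 2^-1 * n%:R) * D1 (gam p.1 i j)
    - fpsC 2^-1 * (tau p * gam p.1 i j) + intrinsic_ricci i j p.
Proof.
move=> Ap; rewrite ev_ricci.
under eq_bigr => c _ do under eq_bigr => d _ do
  rewrite !christoffel_normal_form //.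
apply: (@ricci_xx_contraction
  (fun c => ev (fpartial c (christoffel (normal_form mu) gi c (ix i) (ix j))) p)
  (fun c => ev (fpartial (ix j) (christoffel (normal_form mu) gi c (ix i) c)) p)) => //.
- exact: fpartial_chr_t.
- exact: fpartial_chr_rho.
- by apply: ev_fpartial_0 => // q Aq; rewrite christoffel_normal_form.
- by apply: ev_fpartial_0 => // q Aq; rewrite christoffel_normal_form.
Qed.

(** Only the contraction of the mixed symbols with one index rho contributes. *)
Lemma ricci_rhorho p : ray_domain M p ->
  ev (ricci (normal_form mu) gi irho irho) p =
    - (fpsC 2^-1 * D1 (tau p))
    - \sum_k \sum_l chr_fps (ix k) irho (ix l) p * chr_fps (ix l) irho (ix k) p.
Proof.
move=> Ap; rewrite ev_ricci.
under eq_bigr => c _ do under eq_bigr => d _ do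
  rewrite !christoffel_normal_form //.
pose dA c := ev (fpartial c (christoffel (normal_form mu) gi c irho irho)) p.
pose dB c := ev (fpartial irho (christoffel (normal_form mu) gi c irho c)) p.
have dA0 c : dA c = 0.
  apply: ev_fpartial_0 => // q Aq; rewrite christoffel_normal_form //.
  by case: c => [[]|].
have dBE c : dB c = D1 (chr_fps c irho c p).
  by rewrite -christoffel_normal_form.
transitivity (\sum_c (dA c - dB c + \sum_d
   (chr_fps c c d p * chr_fps d irho irho p
    - chr_fps c irho d p * chr_fps d irho c p))) => //.
move: dA dB dA0 dBE => dA dB dA0 dBE.
under eq_bigr => c _ do rewrite dA0 dBE.
have zero d : chr_fps d irho irho p = 0 by case: d => [[]|].
under eq_bigr => c _ do under eq_bigr => d _ do rewrite zero mulr0 sub0r.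
rewrite sum_amb !sum_amb /= !raddf0 !mul0r !mulr0.
rewrite !sumr_const !oppr0 !mul0rn !addr0 add0r.
under eq_bigr => k _ do rewrite sum_amb !mul0r !oppr0 !add0r.
rewrite big_split /= -sumrN; congr (_ + _).
  by rewrite /tau -fpsD1CM mulr_sumr raddf_sum -sumrN.
by apply: eq_bigr => k _; rewrite sumrN.
Qed.

End NormalForm.

(** * Dependence of the Ricci curvature on the leading coefficient *)

Section LeadingCoefficient.
Variables (R : realType) (n : nat) (M : set 'rV[R]_n).
Variables (mu mu' : nat -> 'rV[R]_n -> 'M[R]_n) (gi gi' : amb_tensor2 R n).
Hypothesis M_open : open M.
Hypothesis mu_derivable : forall k x i j v, M x ->
  derivable (fun y => mu k y i j) x v.
Hypothesis mu_sym : forall k x i j, M x -> mu k x i j = mu k x j i.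
Hypothesis gi_inverse : is_inverse (ray_domain M) (normal_form mu) gi.
Hypothesis mu'_derivable : forall k x i j v, M x ->
  derivable (fun y => mu' k y i j) x v.
Hypothesis mu'_sym : forall k x i j, M x -> mu' k x i j = mu' k x j i.
Hypothesis gi'_inverse : is_inverse (ray_domain M) (normal_form mu') gi'.
Variable K : nat.
Hypothesis agree : forall k x, (k <= K)%N -> M x -> mu k x = mu' k x.

Lemma eqmod_gam x i j : M x -> eqmod K.+1 (gam mu x i j) (gam mu' x i j).
Proof. by move=> Mx k kK; rewrite /gam agree. Qed.

Lemma eqmod_dgam l x i j : M x ->
  eqmod K.+1 (dgam mu l x i j) (dgam mu' l x i j).
Proof.
move=> Mx k kK; apply: near_eq_derive; near=> y; rewrite agree //.
by near: y; apply: open_nbhs_nbhs.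
Unshelve. all: by end_near. Qed.

(** From G = G gamma' G' and G gamma G' = G', where G and G' are the inverses of
    gamma and gamma'. *)
Lemma eqmod_gami p i j : ray_domain M p ->
  eqmod K.+1 (gami gi p i j) (gami gi' p i j).
Proof.
move=> Ap; have [Mx _] := Ap.
have -> : gami gi p i j
    = \sum_m (\sum_l gami gi p i l * gam mu' p.1 l m) * gami gi' p m j.
  rewrite -(sum_mul_delta (gami gi p i) j).
  under eq_bigr => l _ do rewrite -(sum_gam_gami gi'_inverse l j Ap) mulr_sumr.
  rewrite exchange_big; apply: eq_bigr => m _ /=; rewrite mulr_suml.
  by apply: eq_bigr => l _; rewrite mulrA.
apply: (@eqmod_trans _ _ _
    (\sum_m (\sum_l gami gi p i l * gam mu p.1 l m) * gami gi' p m j)).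
  apply: eqmod_sum => m; apply: eqmodM => //; apply: eqmod_sum => l.
  by apply: eqmodM => //; apply/eqmod_sym/eqmod_gam.
have -> : \sum_m (\sum_l gami gi p i l * gam mu p.1 l m) * gami gi' p m j
    = gami gi' p i j; last by [].
  rewrite -[RHS](sum_mul_delta (fun m => gami gi' p m j) i).
  by apply: eq_bigr => m _; rewrite (sum_gami_gam gi_inverse) // mulrC eq_sym.
Qed.

Lemma eqmod_chr p k i j : ray_domain M p ->
  eqmod K.+1 (chr_fps mu gi (ix k) (ix i) (ix j) p)
             (chr_fps mu' gi' (ix k) (ix i) (ix j) p).
Proof.
move=> Ap; have [Mx _] := Ap; apply: eqmodM => //; apply: eqmod_sum => l.
apply: eqmodM; first exact: eqmod_gami.
apply: eqmodD; last by apply/eqmodN/eqmod_dgam.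
by apply: eqmodD; apply: eqmod_dgam.
Qed.

Lemma eqmod_fpartial_chr p l k i j : ray_domain M p ->
  eqmod K.+1
    (ev (fpartial (ix l) (christoffel (normal_form mu) gi (ix k) (ix i) (ix j))) p)
    (ev (fpartial (ix l) (christoffel (normal_form mu') gi' (ix k) (ix i) (ix j))) p).
Proof.
move=> Ap; apply: (eqmod_fpartial_x M_open) => // q Aq.
rewrite (christoffel_normal_form mu_derivable) //.
rewrite (christoffel_normal_form mu'_derivable) //.
exact: eqmod_chr.
Qed.

Lemma eqmod_intrinsic_ricci p i j : ray_domain M p ->
  eqmod K.+1 (intrinsic_ricci mu gi i j p) (intrinsic_ricci mu' gi' i j p).
Proof.
move=> Ap; apply: eqmod_sum => k; apply: eqmodD.
  apply: eqmodD; first exact: eqmod_fpartial_chr.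
  by apply: eqmodN; apply: eqmod_fpartial_chr.
apply: eqmod_sum => l; apply: eqmodD; last apply: eqmodN.
  by apply: eqmodM; apply: eqmod_chr.
by apply: eqmodM; apply: eqmod_chr.
Qed.

Lemma eqmod_quad p i j : ray_domain M p ->
  eqmod K (quad mu gi p i j) (quad mu' gi' p i j).
Proof.
move=> Ap; have [Mx _] := Ap.
apply: eqmod_sum => k; apply: eqmod_sum => l.
apply: eqmodM; last by apply/eqmodD1/eqmod_gam.
apply: eqmodM; first by apply/eqmodD1/eqmod_gam.
by apply: eqmodW (eqmod_gami _ _ Ap).
Qed.

Lemma eqmod_tau p : ray_domain M p -> eqmod K (tau mu gi p) (tau mu' gi' p).
Proof.
move=> Ap; have [Mx _] := Ap.
apply: eqmod_sum => k; apply: eqmod_sum => l.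
apply: eqmodM; last by apply/eqmodD1/eqmod_gam.
by apply: eqmodW (eqmod_gami _ _ Ap).
Qed.

(** The first coefficient at which the two series may differ. *)
Definition coef_gap x := mu K.+1 x - mu' K.+1 x.

(** In tau = tr (gamma^-1 gamma') the coefficient of order K + 1 enters at order K
    through gamma' only, hence with the factor K + 1 and the inverse of g. *)
Lemma tau_lead p : ray_domain M p -> tau mu gi p K - tau mu' gi' p K
  = K.+1%:R * \tr (invmx (mu 0 p.1) *m coef_gap p.1).
Proof.
move=> Ap; have [Mx _] := Ap.
have -> : invmx (mu 0 p.1) = \matrix_(i, j) gami gi p i j 0%N.
  have E : mu 0 p.1 *m (\matrix_(i, j) gami gi p i j 0%N) = 1%:M.
    apply/matrixP => i j; rewrite !mxE.
    have /(congr1 (fun F : fps R => F 0%N)) := sum_gam_gami gi_inverse i j Ap.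
    rewrite fps_sum => /= E.
    transitivity (((i == j)%:R : fps R) 0%N); last by case: (i == j).
    rewrite -[RHS]E; apply: eq_bigr => l _.
    by rewrite mxE fpsM big_ord1.
  have [U _] := mulmx1_unit E.
  by rewrite -[RHS](mulKmx U) E mulmx1.
rewrite /tau !fps_sum -sumrB mulr_sumr; apply: eq_bigr => i _.
rewrite mxE !fps_sum -sumrB mulr_sumr; apply: eq_bigr => l _.
rewrite !mxE (fpsM_lead (eqmod_gami i l Ap)); last by apply/eqmodD1/eqmod_gam.
by rewrite /fpsD1 /gam -mulrBr mulrCA.
Qed.

(** At order K every term except rho gamma'', gamma' and tau gamma is congruent for
    the two series: the products gamma' gamma^-1 gamma' and tau gamma' carry a
    factor rho, and Ric(gamma) contains no derivative in rho. *)
Lemma ricci_xx_lead p i j : ray_domain M p ->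
  ricci (normal_form mu) gi (ix i) (ix j) K p
  - ricci (normal_form mu') gi' (ix i) (ix j) K p
  = K.+1%:R * (K.+1%:R - 2^-1 * n%:R) * coef_gap p.1 i j
    - 2^-1 * K.+1%:R * \tr (invmx (mu 0 p.1) *m coef_gap p.1) * mu 0 p.1 i j.
Proof.
move=> Ap; have [Mx _] := Ap.
have := congr1 (fun F : fps R => F K)
  (ricci_xx M_open mu_derivable mu_sym gi_inverse i j Ap).
have := congr1 (fun F : fps R => F K)
  (ricci_xx M_open mu'_derivable mu'_sym gi'_inverse i j Ap).
rewrite /ev /= => -> ->.
rewrite !(fpsD, fpsN) !fpsCM.
rewrite (eqmod_intrinsic_ricci i j Ap (ltnSn K)).
have -> : (fpsX R * (quad mu gi p i j + quad mu gi p j i)) K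
   = (fpsX R * (quad mu' gi' p i j + quad mu' gi' p j i)) K.
  by apply: (eqmodXM _ (ltnSn K)); apply: eqmodD; apply: eqmod_quad.
have -> : (fpsX R * tau mu gi p * fpsD1 (gam mu p.1 i j)) K
   = (fpsX R * tau mu' gi' p * fpsD1 (gam mu' p.1 i j)) K.
  rewrite -!mulrA; apply: (eqmodXM _ (ltnSn K)); apply: eqmodM.
    exact: eqmod_tau.
  by apply/eqmodD1/eqmod_gam.
have D (nu : nat -> 'rV[R]_n -> 'M[R]_n) : (fpsX R * fpsD1 (fpsD1 (gam nu p.1 i j))) K
    = K%:R * K.+1%:R * nu K.+1 p.1 i j.
  by rewrite fpsXM; case: (K) => [|k]; rewrite ?mul0r // /fpsD1 /gam mulrA.
rewrite !D.
have := fpsM_lead (eqmod_gam i j Mx) (eqmod_tau Ap).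
rewrite tau_lead // ![gam _ _ _ _ * tau _ _ _]mulrC /fpsD1 /gam /coef_gap => E.
have -> : (tau mu gi p * (fun k => mu k p.1 i j)) K =
  (tau mu' gi' p * (fun k => mu' k p.1 i j)) K
  + mu 0 p.1 i j * (K.+1%:R * \tr (invmx (mu 0 p.1) *m coef_gap p.1)).
  by rewrite -E subrKC.
by move: (\tr _) => tr; rewrite !mxE -[K.+1%:R]natr1; field.
Qed.

End LeadingCoefficient.

Section LeadingCoefficientRhoRho.
Variables (R : realType) (n : nat) (M : set 'rV[R]_n).
Variables (mu mu' : nat -> 'rV[R]_n -> 'M[R]_n) (gi gi' : amb_tensor2 R n).
Hypothesis M_open : open M.
Hypothesis mu_derivable : forall k x i j v, M x ->
  derivable (fun y => mu k y i j) x v.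
Hypothesis mu_sym : forall k x i j, M x -> mu k x i j = mu k x j i.
Hypothesis gi_inverse : is_inverse (ray_domain M) (normal_form mu) gi.
Hypothesis mu'_derivable : forall k x i j v, M x ->
  derivable (fun y => mu' k y i j) x v.
Hypothesis mu'_sym : forall k x i j, M x -> mu' k x i j = mu' k x j i.
Hypothesis gi'_inverse : is_inverse (ray_domain M) (normal_form mu') gi'.

(** This equation determines the trace of the coefficient of every order at least 2,
    also of order n, where the trace of the tangential equation is void. *)
Lemma ricci_rhorho_lead K p :
  (forall k x, (k <= K.+1)%N -> M x -> mu k x = mu' k x) ->
  ray_domain M p ->
  ricci (normal_form mu) gi irho irho K p
  - ricci (normal_form mu') gi' irho irho K p
  = - 2^-1 * K.+1%:R * K.+2%:R * \tr (invmx (mu 0 p.1) *m coef_gap mu mu' K.+1 p.1).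
Proof.
move=> agree Ap; have [Mx _] := Ap.
have := congr1 (fun F : fps R => F K)
  (ricci_rhorho M_open mu_derivable mu_sym gi_inverse Ap).
have := congr1 (fun F : fps R => F K)
  (ricci_rhorho M_open mu'_derivable mu'_sym gi'_inverse Ap).
rewrite /ev /= => -> ->.
rewrite !(fpsD, fpsN) !fpsCM.
have -> : (\sum_k \sum_l chr_fps mu gi (ix k) irho (ix l) p
                         * chr_fps mu gi (ix l) irho (ix k) p) K
  = (\sum_k \sum_l chr_fps mu' gi' (ix k) irho (ix l) p
                   * chr_fps mu' gi' (ix l) irho (ix k) p) K.
  have E a b : eqmod K.+1 (chr_fps mu gi (ix a) irho (ix b) p)
                          (chr_fps mu' gi' (ix a) irho (ix b) p).
    apply: eqmodM => //; apply: eqmod_sum => l; apply: eqmodM.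
      by apply: eqmodW (eqmod_gami gi_inverse gi'_inverse agree a l Ap).
    by apply: eqmodD1; apply: (eqmod_gam agree).
  apply: (eqmod_sum _ _ _ (ltnSn K)) => a.
  by apply: eqmod_sum => b; apply: eqmodM.
move: (tau_lead gi_inverse gi'_inverse agree Ap); rewrite /fpsD1.
move: (tau mu gi p K.+1) (tau mu' gi' p K.+1) (\tr _) => a b tr.
by move=> /eqP; rewrite subr_eq => /eqP ->; ring.
Qed.

End LeadingCoefficientRhoRho.

(** * The family g_flat + H(rho) du^2 *)

Section PPCoordinates.
Variables (R : realType) (m : nat).

Lemma sum_coord (W : nmodType) (f : 'I_m.+2 -> W) :
  \sum_i f i = \sum_(i < m) f (coord_x i) + f (coord_u m) + f (coord_r m).
Proof. by rewrite 2!big_ord_recr. Qed.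

Variant coord_spec : 'I_m.+2 -> Type :=
  | CoordX i : coord_spec (coord_x i)
  | CoordU : coord_spec (coord_u m)
  | CoordR : coord_spec (coord_r m).

Lemma coordP i : coord_spec i.
Proof.
case: i => i lt_i; case: (ltngtP i m) => [im|mi|im].
- suff -> : Ordinal lt_i = coord_x (Ordinal im) by constructor.
  exact: val_inj.
- suff -> : Ordinal lt_i = coord_r m by constructor.
  by apply: val_inj; apply/eqP; rewrite /= eqn_leq mi -ltnS lt_i.
- suff -> : Ordinal lt_i = coord_u m by constructor.
  exact: val_inj.
Qed.

Lemma coord_xu (i : 'I_m) : (coord_x i == coord_u m) = false.
Proof. by rewrite -val_eqE /= ltn_eqF. Qed.
Lemma coord_xr (i : 'I_m) : (coord_x i == coord_r m) = false.
Proof. by rewrite -val_eqE /= ltn_eqF // ltnW // ltnS. Qed.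
Lemma coord_ur : (coord_u m == coord_r m) = false.
Proof. by rewrite -val_eqE /= ltn_eqF. Qed.
Lemma coord_xx (i j : 'I_m) : (coord_x i == coord_x j) = (i == j).
Proof. by rewrite -val_eqE. Qed.
Definition coord_eqE := (coord_xu, coord_xr, coord_ur, coord_xx,
  fun i => etrans (eq_sym _ _) (coord_xu i),
  fun i => etrans (eq_sym _ _) (coord_xr i), etrans (eq_sym _ _) coord_ur).

(** The flat metric identifies the coordinates u and r with each other, so it is the
    permutation matrix of this transposition and contracting with it is
    re-indexing. *)
Definition swap_ur (i : 'I_m.+2) : 'I_m.+2 := tperm (coord_u m) (coord_r m) i.

Lemma swap_x i : swap_ur (coord_x i) = coord_x i.
Proof. by rewrite /swap_ur tpermD // eq_sym coord_eqE. Qed.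
Lemma swap_u : swap_ur (coord_u m) = coord_r m. Proof. exact: tpermL. Qed.
Lemma swap_r : swap_ur (coord_r m) = coord_u m. Proof. exact: tpermR. Qed.
Definition swapE := (swap_x, swap_u, swap_r).
Lemma swapK : involutive swap_ur. Proof. exact: tpermK. Qed.

Lemma swap_eq i j : (swap_ur i == j) = (swap_ur j == i).
Proof. by rewrite (can2_eq swapK swapK) eq_sym. Qed.

Definition flat_pp : 'M[R]_m.+2 := \matrix_(i, j) (swap_ur i == j)%:R.

Lemma pp_metricE (h : 'rV[R]_m.+1 -> R) p :
  pp_metric h p = flat_pp + (2 * h (forget_r p)) *: du2 R m.
Proof.
rewrite /pp_metric; congr (_ + _); apply/matrixP => i j; rewrite !mxE summxE.
under eq_bigr => k _ do rewrite mxE.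
case: (coordP i) => [a||]; rewrite ?swapE ?coord_eqE /=.
- rewrite (bigD1 a) //= eqxx big1 ?addr0 => [|k /negbTE ka].
    by rewrite /= [in RHS]eq_sym.
  by rewrite coord_xx eq_sym ka.
- by rewrite big1 => [|k _]; rewrite ?coord_eqE // eqxx add0r addr0 [in RHS]eq_sym.
- by rewrite big1 => [|k _]; rewrite ?coord_eqE // eqxx !add0r [in RHS]eq_sym.
Qed.

Lemma forget_rD (x y : 'rV[R]_m.+2) : forget_r (x + y) = forget_r x + forget_r y.
Proof. by apply/rowP => j; rewrite !mxE. Qed.
Lemma forget_rZ (a : R) (x : 'rV[R]_m.+2) : forget_r (a *: x) = a *: forget_r x.
Proof. by apply/rowP => j; rewrite !mxE. Qed.

Lemma forget_delta_r : forget_r (delta_mx 0 (coord_r m)) = 0 :> 'rV[R]_m.+1.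
Proof.
by apply/rowP => j; rewrite !mxE eqxx -[_ == coord_r m]val_eqE /= ltn_eqF.
Qed.

Lemma forget_delta_x (i : 'I_m) : forget_r (delta_mx 0 (coord_x i))
  = delta_mx 0 (widen_ord (leqnSn m) i) :> 'rV[R]_m.+1.
Proof. by apply/rowP => j; rewrite !mxE !eqxx -!val_eqE. Qed.

Lemma forget_r_affine (s : R) (v x : 'rV[R]_m.+2) :
  forget_r (s *: v + x) = s *: forget_r v + forget_r x.
Proof. by rewrite forget_rD forget_rZ. Qed.

Lemma derive_forget (f : 'rV[R]_m.+1 -> R) (v x : 'rV[R]_m.+2) :
  'D_v (fun y => f (forget_r y)) x = 'D_(forget_r v) f (forget_r x).
Proof. exact: (derive_comp_affine forget_r_affine f v x). Qed.

Lemma derivable_forget (f : 'rV[R]_m.+1 -> R) (v x : 'rV[R]_m.+2) :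
  derivable f (forget_r x) (forget_r v) ->
  derivable (fun y => f (forget_r y)) x v.
Proof. exact: (derivable_comp_affine forget_r_affine). Qed.

End PPCoordinates.

Section PPRicci.
Variables (R : realType) (m : nat) (M : set 'rV[R]_m.+2).
Variable f : nat -> 'rV[R]_m.+1 -> R.
Hypothesis M_open : open M.
Hypothesis f_derivable : forall k x v, M x -> derivable (f k) (forget_r x) v.
Local Notation n := m.+2.
Local Notation X := (fpsX R).
Local Notation D1 := (@fpsD1 R).
Implicit Types (p : 'rV[R]_n * R) (x : 'rV[R]_n) (i j l : 'I_n).

(** The series mu with gamma(rho) = g_flat + H(rho) du^2, H = sum_k rho^k f_k. *)
Definition pp_family k x : 'M[R]_n :=
  (k == 0%N)%:R *: flat_pp R m + f k (forget_r x) *: du2 R m.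

Definition ppH x : fps R := fun k => f k (forget_r x).
Definition ppDH i x : fps R :=
  fun k => 'D_(forget_r (delta_mx 0 i)) (f k) (forget_r x).
Definition ppLap x : fps R := fun k => laplacian_x (f k) (forget_r x).
(** The components of du and of d/dr.  That du is null, [isu_isr], and that dH
    annihilates d/dr, [ppDH_isr], make all the nonlinear terms vanish. *)
Definition isu i : fps R := (i == coord_u m)%:R.
Definition isr i : fps R := (i == coord_r m)%:R.

Lemma isu_mul i j :
  isu i * isu j = ((i == coord_u m) && (j == coord_u m))%:R.
Proof. by rewrite /isu -natrM mulnb. Qed.

Lemma isuE : (forall i : 'I_m, isu (coord_x i) = 0) * (isu (coord_u m) = 1)
  * (isu (coord_r m) = 0).
Proof. by rewrite /isu eqxx !coord_eqE; split=> // -; split=> // i; rewrite coord_eqE. Qed.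
Lemma isrE : (forall i : 'I_m, isr (coord_x i) = 0) * (isr (coord_u m) = 0)
  * (isr (coord_r m) = 1).
Proof. by rewrite /isr eqxx !coord_eqE; split=> // -; split=> // i; rewrite coord_eqE. Qed.

Lemma isu_isr i : isu i * isr i = 0.
Proof. by case: (coordP i) => [a||]; rewrite !isuE !isrE ?mul0r ?mulr0. Qed.

Lemma ppDH_r x : ppDH (coord_r m) x = 0.
Proof. by apply/funext => k; rewrite /ppDH forget_delta_r derive0. Qed.

Lemma ppDH_isr i x : ppDH i x * isr i = 0.
Proof.
by case: (coordP i) => [a||]; rewrite ?isrE ?mulr0 // ppDH_r mul0r.
Qed.

Lemma fps_natb (b : bool) k : (b%:R : fps R) k = ((k == 0%N) && b)%:R.
Proof. by case: b; rewrite ?andbT ?andbF. Qed.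

Lemma gam_pp x i j :
  gam pp_family x i j = (swap_ur i == j)%:R + isu i * isu j * ppH x.
Proof.
apply/funext => k; rewrite /gam !mxE fpsD fps_natb -natrM mulnb.
congr (_ + _).
rewrite /isu -natrM mulnb; case: (_ && _); first by rewrite mul1r mulr1.
by rewrite mul0r mulr0.
Qed.

Lemma D1gam_pp x i j : D1 (gam pp_family x i j) = isu i * isu j * D1 (ppH x).
Proof.
rewrite gam_pp raddfD /= [X in X + _](_ : _ = 0) ?add0r; last first.
  by case: (_ == _); [exact: (fpsD1C (1 : R)) | rewrite raddf0].
by rewrite /isu -natrM mulnb -mulr_natl; case: (_ && _); rewrite ?mul1r ?mul0r ?raddf0.
Qed.

Lemma dgam_pp l x i j : M x ->
  dgam pp_family l x i j = isu i * isu j * ppDH l x.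
Proof.
move=> Mx; apply/funext => k; rewrite /dgam /isu -natrM mulnb.
have -> : (fun y => pp_family k y i j) = fun y =>
    ((k == 0%N)%:R * (swap_ur i == j)%:R
    + ((i == coord_u m) && (j == coord_u m))%:R * f k (forget_r y)).
  by apply/funext => y; rewrite !mxE [X in _ + X = _]mulrC.
have df : derivable (fun y => f k (forget_r y)) x (delta_mx 0 l).
  by apply: derivable_forget; apply: f_derivable.
rewrite deriveD ?derive_cst ?add0r; [|exact: derivable_cst|exact: derivable_cmul].
rewrite derive_cmul // derive_forget; case: (_ && _); first by rewrite !mul1r.
by rewrite !mul0r.
Qed.

(** (g_flat + H du^2)^-1 = g_flat^-1 - H (d/dr)^2, because d/dr is null. *)
Definition pp_inverse : amb_tensor2 R n := fun a b k p =>
  match a, b with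
  | inl true, inl false | inl false, inl true => p.2^-1 *+ (k == 0%N)
  | inl false, inl false => - (2 * p.2^-1 ^+ 2) *+ (k == 1%N)
  | inr i, inr j => p.2^-1 ^+ 2 *
      ((k == 0%N)%:R * (swap_ur i == j)%:R
       - ((i == coord_r m) && (j == coord_r m))%:R * f k (forget_r p.1))
  | _, _ => 0
  end.

Lemma ev_pp_inverse a b p : ev (pp_inverse a b) p =
  match a, b with
  | inl true, inl false | inl false, inl true => fpsC p.2^-1
  | inl false, inl false => - (fpsC 2 * fpsC p.2^-1 ^+ 2 * X)
  | inr i, inr j => fpsC p.2^-1 ^+ 2 *
      ((swap_ur i == j)%:R - isr i * isr j * ppH p.1)
  | _, _ => 0
  end.
Proof.
case: a b => [[]|i] [[]|j] //; apply/funext => k;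
  rewrite /ev /pp_inverse -?rmorphXn ?(fpsN, fpsCM) /=.
- by rewrite /fpsC; case: k.
- by rewrite /fpsC; case: k.
- by rewrite -mulrA !fpsCM /fpsX mulrA mulr_natr mulNrn.
- rewrite fpsD fpsN fps_natb -natrM mulnb /isr -natrM mulnb.
  by congr (_ * (_ - _)); case: (_ && _); rewrite ?mul1r ?mul0r.
Qed.

Lemma sum_swap (F : 'I_n -> fps R) i : \sum_l (swap_ur i == l)%:R * F l = F (swap_ur i).
Proof.
rewrite (bigD1 (swap_ur i)) //= eqxx mul1r big1 ?addr0 // => l.
by rewrite eq_sym => /negbTE ->; rewrite mul0r.
Qed.

Lemma isu_swap i : isu (swap_ur i) = isr i.
Proof. by case: (coordP i) => [a||]; rewrite !swapE !isuE !isrE. Qed.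
Lemma isr_swap i : isr (swap_ur i) = isu i.
Proof. by case: (coordP i) => [a||]; rewrite !swapE !isuE !isrE. Qed.

Lemma pp_inverseP : is_inverse (ray_domain M) (normal_form pp_family) pp_inverse.
Proof.
move=> a b k p Ap.
have tti : fpsC p.2 * fpsC p.2^-1 = 1 by apply: fpsC_inv Ap.
suff E : \sum_c ev (normal_form pp_family a c) p * ev (pp_inverse c b) p
    = (a == b)%:R.
  have := congr1 (fun F : fps R => F k) E.
  by rewrite fps_sum fps_natb.
under eq_bigr => c _ do rewrite ev_normal_form ev_pp_inverse.
rewrite sum_amb.
case: a b => [[]|i] [[]|j] /=; [..|]; last first.
  rewrite !mul0r !add0r.
  pose E l := (swap_ur l == j)%:R - isr l * isr j * ppH p.1.
  transitivity (\sum_l (swap_ur i == l)%:R * E l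
                + isu i * ppH p.1 * \sum_l (swap_ur j == l)%:R * isu l).
    rewrite mulr_sumr -big_split; apply: eq_bigr => l _ /=.
    rewrite gam_pp /E [swap_ur j == l]swap_eq.
    move: (isu_isr l) ((swap_ur l == j)%:R) ((swap_ur i == l)%:R) => e1 d1 d2.
    have tti2 : fpsC p.2 ^+ 2 * fpsC p.2^-1 ^+ 2 = 1 :> fps R.
      by rewrite -exprMn tti expr1n.
    by ring: e1 tti2.
  rewrite !sum_swap /E swapK isr_swap isu_swap.
  have -> : (inr i == inr j :> amb_idx n) = (i == j) by [].
  by move: ((i == j)%:R) => d; ring.
all: rewrite ?big1 // ?(mul0r, mulr0, add0r, addr0) //;
  try (by move=> l _; rewrite ?mul0r ?mulr0); try by ring: tti.
Qed.

End PPRicci.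

(** * Ricci curvature of the family *)

Section PPRicciComputation.
Variables (R : realType) (m : nat) (M : set 'rV[R]_m.+2).
Variable f : nat -> 'rV[R]_m.+1 -> R.
Hypothesis M_open : open M.
Hypothesis f_derivable : forall k x v, M x -> derivable (f k) (forget_r x) v.
Hypothesis Df_derivable : forall k x v w, M x ->
  derivable ('D_v (f k)) (forget_r x) w.
Local Notation n := m.+2.
Local Notation X := (fpsX R).
Local Notation D1 := (@fpsD1 R).
Local Notation g := (normal_form (pp_family f)).
Local Notation gi := (pp_inverse f).
Local Notation H := (ppH f).
Local Notation DH := (ppDH f).
Local Notation isu := (@isu R m).
Local Notation isr := (@isr R m).
Implicit Types (p : 'rV[R]_n * R) (x : 'rV[R]_n) (i j l : 'I_n).

Lemma pp_family_derivable k x i j v : M x ->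
  derivable (fun y => pp_family f k y i j) x v.
Proof.
move=> Mx.
have -> : (fun y => pp_family f k y i j) = fun y =>
    ((k == 0%N)%:R * (swap_ur i == j)%:R
    + ((i == coord_u m) && (j == coord_u m))%:R * f k (forget_r y)).
  by apply/funext => y; rewrite !mxE [X in _ + X = _]mulrC.
apply: derivableD; first exact: derivable_cst.
by apply: derivable_cmul; apply: derivable_forget; apply: f_derivable.
Qed.

Lemma pp_family_sym k x i j : pp_family f k x i j = pp_family f k x j i.
Proof. by rewrite !mxE swap_eq andbC. Qed.

Let chrE := christoffel_normal_form (@pp_family_derivable)
  (fun k x i j _ => pp_family_sym k x i j) (@pp_inverseP R m M f).

Lemma gami_pp p i j : ray_domain M p ->
  gami gi p i j = (swap_ur i == j)%:R - isr i * isr j * H p.1.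
Proof.
move=> Ap; rewrite /gami ev_pp_inverse mulrA.
by rewrite -exprMn (fpsC_inv Ap) expr1n mul1r.
Qed.

Lemma sum_gami_isu p i (F : fps R) : ray_domain M p ->
  \sum_l gami gi p i l * (isu l * F) = isr i * F.
Proof.
move=> Ap.
transitivity (\sum_l (swap_ur i == l)%:R * (isu l * F)).
  apply: eq_bigr => l _; rewrite gami_pp //.
  move: (isu_isr R l); move: (isu l) (isr l) (isr i) (_%:R).
  by move=> ul rl ri d e; ring: e.
by rewrite sum_swap isu_swap.
Qed.

Lemma sum_gami_DH p i : ray_domain M p ->
  \sum_l gami gi p i l * DH l p.1 = DH (swap_ur i) p.1.
Proof.
move=> Ap.
transitivity (\sum_l (swap_ur i == l)%:R * DH l p.1).
  apply: eq_bigr => l _; rewrite gami_pp //.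
  move: (ppDH_isr f l p.1); move: (DH l p.1) (isr l) (isr i) (_%:R).
  by move=> Dl rl ri d e; ring: e.
by rewrite sum_swap.
Qed.

(** [chr_fps] after contraction with the inverse of the family. *)
Definition pp_chr c a b p : fps R :=
  match c, a, b with
  | inl true, inr i, inr j =>
      - (fpsC 2^-1 * (fpsC p.2 * (isu i * isu j * D1 (H p.1))))
  | inl false, inl true, inl false | inl false, inl false, inl true =>
      fpsC p.2^-1
  | inl false, inr i, inr j =>
      X * (isu i * isu j * D1 (H p.1)) - gam (pp_family f) p.1 i j
  | inr i, inl true, inr j | inr i, inr j, inl true => fpsC p.2^-1 * (i == j)%:R
  | inr i, inl false, inr j | inr i, inr j, inl false =>
      fpsC 2^-1 * (isr i * isu j * D1 (H p.1))
  | inr k, inr i, inr j => fpsC 2^-1 *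
     (isr k * (DH i p.1 * isu j + DH j p.1 * isu i)
      - DH (swap_ur k) p.1 * isu i * isu j)
  | _, _, _ => 0
  end.

Lemma pp_christoffel c a b p : ray_domain M p ->
  ev (christoffel g gi c a b) p = pp_chr c a b p.
Proof.
move=> Ap; have [Mx _] := Ap; rewrite chrE //.
have D1E i j : \sum_l gami gi p i l * D1 (gam (pp_family f) p.1 l j)
    = isr i * isu j * D1 (H p.1).
  under eq_bigr => l _ do rewrite D1gam_pp -[_ * _ * D1 _]mulrA.
  by rewrite sum_gami_isu // mulrA.
case: c => [[]|k]; case: a => [[]|i]; case: b => [[]|j] //=; rewrite ?D1gam_pp ?D1E //.
congr (_ * _).
transitivity (\sum_l gami gi p k l * (isu l * (DH i p.1 * isu j + DH j p.1 * isu i))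
  - (\sum_l gami gi p k l * DH l p.1) * (isu i * isu j)).
  rewrite mulr_suml -sumrB; apply: eq_bigr => l _.
  rewrite !(dgam_pp f_derivable) //.
  move: (gami _ _ _ _) (isu i) (isu j) (isu l) (DH i _) (DH j _) (DH l _).
  by move=> G ui uj ul Di Dj Dl; ring.
rewrite sum_gami_isu // sum_gami_DH //.
by congr (_ - _); rewrite mulrA.
Qed.

Lemma pp_tau p : ray_domain M p -> tau (pp_family f) gi p = 0.
Proof.
move=> Ap; rewrite /tau big1 // => i _.
under eq_bigr => l _ do rewrite D1gam_pp -[_ * _ * D1 _]mulrA.
by rewrite sum_gami_isu // mulrA [isr i * _]mulrC isu_isr mul0r.
Qed.

Lemma pp_quad p i j : ray_domain M p -> quad (pp_family f) gi p i j = 0.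
Proof.
move=> Ap; rewrite quadE big1 // => k _.
under eq_bigr => l _ do rewrite D1gam_pp -[_ * _ * D1 _]mulrA.
rewrite sum_gami_isu // D1gam_pp.
move: (isu_isr R k); move: (isu i) (isu k) (isr k) (isu j) (D1 _).
by move=> ui uk rk uj D e; ring: e.
Qed.

Lemma fpartial_zero a c b1 b2 p : ray_domain M p ->
  (forall q, ray_domain M q -> pp_chr c b1 b2 q = 0) ->
  ev (fpartial a (christoffel g gi c b1 b2)) p = 0.
Proof.
move=> Ap z; apply: (ev_fpartial_0 (M := M)) => // q Aq.
by rewrite pp_christoffel // z.
Qed.

(** Series depending on x only through [forget_r] are constant along d/dr. *)
Lemma fpartial_forget (F : fser R n) (G : 'rV[R]_m.+1 -> fps R) i p :
  (forall q, ray_domain M q -> ev F q = G (forget_r q.1)) ->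
  ray_domain M p ->
  ev (fpartial (ix i) F) p
  = fun k => 'D_(forget_r (delta_mx 0 i)) (G^~ k) (forget_r p.1).
Proof.
move=> FG Ap; rewrite (eq_fpartial
  (G := fun k q => G (forget_r q.1) k) M_open (ix i)) //.
apply/funext => k; rewrite /ev /=; case: p Ap => x t Ap.
by rewrite derive_pairl /= (derive_forget (G^~ k)).
Qed.

(** The determinant of gamma is constant, so its connection has no trace. *)
Lemma pp_chr_diag k i p : pp_chr (ix k) (ix k) (ix i) p = 0.
Proof.
by rewrite /=; case: (coordP k) => [a||];
  rewrite ?isuE ?isrE ?swapE ?ppDH_r !(oppr0, mul0r, mulr0, add0r, addr0).
Qed.

Lemma pp_chr_diag' k i p : pp_chr (ix k) (ix i) (ix k) p = 0.
Proof.
by rewrite /=; case: (coordP k) => [a||];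
  rewrite ?isuE ?isrE ?swapE ?ppDH_r !(oppr0, mul0r, mulr0, add0r, addr0).
Qed.

Definition ppD2 i x : fps R := fun z =>
  'D_(forget_r (delta_mx 0 i)) ('D_(forget_r (delta_mx 0 i)) (f z)) (forget_r x).

Lemma fpartial_pp_chr k i j p : ray_domain M p ->
  ev (fpartial (ix k) (christoffel g gi (ix k) (ix i) (ix j))) p
  = - (fpsC 2^-1 * (isu i * isu j * ((k != coord_u m)%:R * ppD2 k p.1))).
Proof.
move=> Ap; have [Mx _] := Ap.
case: (coordP k) => [a||].
- rewrite (fpartial_forget (G := fun y z => - 2^-1 *
      ((i == coord_u m) && (j == coord_u m))%:R *
      'D_(forget_r (delta_mx 0 (coord_x a))) (f z) y)) //.
    apply/funext => z; rewrite derive_cmul; last exact: Df_derivable.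
    rewrite coord_eqE mul1r fpsN fpsCM isu_mul; case: (_ && _).
      by rewrite mulr1 mul1r mulNr.
    by rewrite !mul0r !mulr0 mul0r oppr0.
  move=> q Aq; rewrite pp_christoffel //=; apply/funext => z.
  rewrite isrE swap_x mul0r sub0r -mulrA isu_mul fpsCM fpsN mulrN !mulNr.
  case: (_ && _); last by rewrite !mulr0 mul0r.
  by rewrite !mulr1.
- rewrite eqxx mul0r !mulr0 oppr0; apply: fpartial_zero => // q Aq /=.
  by rewrite isrE swap_u ppDH_r !mul0r subr0 mulr0.
- have -> : ppD2 (coord_r m) p.1 = 0.
    by apply/funext => z; rewrite /ppD2 forget_delta_r derive0.
  rewrite !mulr0 oppr0.
  pose D l (y : 'rV[R]_m.+1) : fps R :=
    fun z => 'D_(forget_r (delta_mx 0 l)) (f z) y.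
  rewrite (fpartial_forget (G := fun y => fpsC 2^-1 * (D i y * isu j
      + D j y * isu i - D (coord_u m) y * isu i * isu j)) _ _ Ap).
    by apply/funext => z; rewrite forget_delta_r derive0.
  move=> q Aq; rewrite (pp_christoffel _ _ _ Aq).
  apply: (congr1 (fun F => fpsC 2^-1 * F)).
  rewrite isrE swap_r; apply: (congr1 (fun F => F - _)).
  exact: mul1r.
Qed.

(** Of the tangential equation only the linear terms survive, all along du^2. *)
Lemma pp_ricci_xx i j p : ray_domain M p ->
  ev (ricci g gi (ix i) (ix j)) p =
  isu i * isu j * (X * D1 (D1 (H p.1)) + fpsC (1 - 2^-1 * n%:R) * D1 (H p.1)
    - fpsC 2^-1 * ppLap f p.1).
Proof.
move=> Ap; rewrite (ricci_xx M_open (@pp_family_derivable)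
  (fun k x i j _ => pp_family_sym k x i j) (@pp_inverseP R m M f)) //.
rewrite pp_tau // !pp_quad // D1gam_pp.
have -> : D1 (isu i * isu j * D1 (H p.1)) = isu i * isu j * D1 (D1 (H p.1)).
  rewrite isu_mul; case: (_ && _); first by rewrite !mul1r.
  by rewrite !mul0r raddf0.
have -> : intrinsic_ricci (pp_family f) gi i j p
    = - (fpsC 2^-1 * (isu i * isu j * ppLap f p.1)).
  rewrite /intrinsic_ricci.
  transitivity (\sum_k ev (fpartial (ix k) (christoffel g gi (ix k) (ix i) (ix j))) p).
    apply: eq_bigr => k _.
    rewrite [X in _ - X](_ : _ = 0); last first.
      by apply: fpartial_zero => // q Aq; apply: pp_chr_diag'.
    rewrite subr0 big1 ?addr0 // => l _.
    rewrite -!chrE // !pp_christoffel // pp_chr_diag mul0r sub0r /=.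
    by case: (coordP k) => [a||]; case: (coordP l) => [b||];
      rewrite ?isuE ?isrE ?swapE ?ppDH_r
        !(oppr0, mul0r, mulr0, add0r, addr0).
  under eq_bigr => k _ do rewrite fpartial_pp_chr //.
  rewrite sumrN -mulr_sumr -mulr_sumr; congr (- (_ * (_ * _))).
  rewrite sum_coord eqxx mul0r addr0 [X in _ + X](_ : _ = 0) ?addr0; last first.
    have -> : ppD2 (coord_r m) p.1 = 0.
      by apply/funext => z; rewrite /ppD2 forget_delta_r derive0.
    by rewrite mulr0.
  apply/funext => z; rewrite fps_sum; apply: eq_bigr => a _.
  by rewrite coord_eqE mul1r /ppD2 forget_delta_x.
rewrite addr0 !mulr0 mul0r !mulr0 mul0r mulr0 subr0 addr0 subr0.
move: (isu i * isu j) (D1 (H p.1)) (D1 (D1 (H p.1))) (fpsC (1 - _)) (ppLap _ _).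
by move=> u a b c d; ring.
Qed.

Lemma pp_ricci_xxE i j k p : ray_domain M p ->
  ricci g gi (ix i) (ix j) k p =
  2^-1 * (k.+1%:R * ((2 * k.+1)%:R - n%:R) * f k.+1 (forget_r p.1)
          - laplacian_x (f k) (forget_r p.1)) * du2 R m i j.
Proof.
move=> Ap; have := congr1 (fun F : fps R => F k) (pp_ricci_xx i j Ap).
rewrite isu_mul {1}/ev /= => ->; rewrite mxE.
case: (_ && _); last by rewrite mul0r mulr0.
rewrite mul1r mulr1 fpsD fpsD fpsN !fpsCM fpsXM natrM.
have -> : (if k is j.+1 then D1 (D1 (H p.1)) j else 0)
    = k%:R * k.+1%:R * f k.+1 (forget_r p.1).
  by case: (k) => [|k']; rewrite ?mul0r // -mulrA.
by rewrite /fpsD1 /ppH /ppLap -[k.+1%:R]natr1; field.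
Qed.

Lemma pp_ricci_rhorho p : ray_domain M p -> ev (ricci g gi irho irho) p = 0.
Proof.
move=> Ap; rewrite (ricci_rhorho M_open (@pp_family_derivable)
  (fun k x i j _ => pp_family_sym k x i j) (@pp_inverseP R m M f)) //.
rewrite pp_tau // raddf0 mulr0 oppr0 sub0r big1 ?oppr0 // => k _.
rewrite big1 // => l _; rewrite -!chrE // !pp_christoffel //=.
move: (isu_isr R k); move: (isu k) (isr k) (isu l) (isr l) (D1 _).
by move=> ? ? ? ? ? e; ring: e.
Qed.

End PPRicciComputation.

Section PPRicciRadialComponents.
Variables (R : realType) (m : nat) (M : set 'rV[R]_m.+2).
Variable f : nat -> 'rV[R]_m.+1 -> R.
Hypothesis M_open : open M.
Hypothesis f_derivable : forall k x v, M x -> derivable (f k) (forget_r x) v.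
Local Notation n := m.+2.
Local Notation g := (normal_form (pp_family f)).
Local Notation gi := (pp_inverse f).
Local Notation chr := (@pp_chr R m f).
Implicit Types (p : 'rV[R]_n * R) (i j l : 'I_n).

Let chrE := pp_christoffel f_derivable.
Let dchr0 := fpartial_zero M_open f_derivable.

Lemma ev_pp_ricci a b p : ray_domain M p ->
  ev (ricci g gi a b) p = \sum_c (
      ev (fpartial c (christoffel g gi c a b)) p
    - ev (fpartial b (christoffel g gi c a c)) p
    + \sum_d (chr c c d p * chr d a b p - chr c b d p * chr d a c p)).
Proof.
move=> Ap; rewrite ev_ricci.
by under eq_bigr => c _ do under eq_bigr => d _ do rewrite !chrE //.
Qed.

(** The only radial component in which terms cancel instead of vanishing one by one:
    - d_t of the trace (n + 1) / t against the square of the symbols 1 / t. *)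
Lemma pp_ricci_tt p : ray_domain M p -> ev (ricci g gi it it) p = 0.
Proof.
move=> Ap; rewrite ev_pp_ricci //.
have dt (F : fser R n) : (forall q, ray_domain M q -> ev F q = fpsC q.2^-1) ->
    ev (fpartial it F) p = - fpsC p.2^-1 ^+ 2.
  move=> FE; rewrite (eq_fpartial (G := fun k q => fpsC q.2^-1 k) M_open it) //.
  apply/funext => -[|k]; case: p Ap => x t [/= _ t0]; last first.
    by rewrite /ev /= -rmorphXn fpsN /= oppr0 derive_cst.
  rewrite /ev /= derive_pairr /= -rmorphXn fpsN /= deriveV ?gt_eqF //.
  by rewrite derive_id [_ *: _]mulr1 exprVn.
rewrite big1 // => c _.
rewrite dchr0 // => [|q Aq]; last by case: c => [[]|].
rewrite sub0r [X in _ + X](_ : _ = - \sum_d chr c it d p * chr d it c p); last first.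
  rewrite -sumrN; apply: eq_bigr => -[[]|l] _; by rewrite mulr0 sub0r.
rewrite sum_amb; case: c => [[]|k].
- rewrite dchr0 //= big1 => [|l _]; last by rewrite mul0r.
  by rewrite mul0r !addr0 oppr0 addr0.
- rewrite (dt _ (chrE irho it irho)) /= !mul0r add0r big1 => [|l _]; last by [].
  by rewrite addr0 opprK subrr.
- rewrite (dt _ (fun q Aq => _)) => [|q Aq]; last first.
    by rewrite chrE //= eqxx mulr1.
  rewrite /= !mul0r !add0r opprK.
  have -> : \sum_l fpsC p.2^-1 * (k == l)%:R * (fpsC p.2^-1 * (l == k)%:R)
      = \sum_l fpsC p.2^-1 ^+ 2 * (l == k)%:R.
    apply: eq_bigr => l _; rewrite [k == l]eq_sym; case: (l == k).
      by rewrite !mulr1.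
    by rewrite !mulr0.
  by rewrite sum_mul_delta subrr.
Qed.

(** For the other radial components each derivative and each product vanishes. *)
Lemma pp_ricci_zero a b p : ray_domain M p ->
  (forall c, ev (fpartial c (christoffel g gi c a b)) p = 0) ->
  (forall c, ev (fpartial b (christoffel g gi c a c)) p = 0) ->
  (forall c d, chr c c d p * chr d a b p = 0) ->
  (forall c d, chr c b d p * chr d a c p = 0) ->
  ev (ricci g gi a b) p = 0.
Proof.
move=> Ap dA dB A B; rewrite ev_pp_ricci // big1 // => c _.
by rewrite dA dB subrr add0r big1 // => d _; rewrite A B subrr.
Qed.

Lemma pp_chr_rho_diag k p : chr (ix k) irho (ix k) p = 0.
Proof. by rewrite /= mulrAC; case: (coordP k) => [a||]; rewrite ?isuE ?isrE ?(mul0r, mulr0). Qed.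

Lemma fpartial_fun_t i (F : fser R n) (G : fps R -> fps R) p :
  (forall q, ray_domain M q -> ev F q = G (fpsC q.2^-1)) -> ray_domain M p ->
  ev (fpartial (ix i) F) p = 0.
Proof.
move=> FE Ap; rewrite (eq_fpartial (G := fun k q => G (fpsC q.2^-1) k) M_open (ix i)) //.
apply/funext => k; case: p Ap => x t _; rewrite /ev /= derive_pairl.
exact: (derive_cst (G (fpsC t^-1) k)).
Qed.

Lemma pp_ricci_t_rho p : ray_domain M p -> ev (ricci g gi it irho) p = 0.
Proof.
move=> Ap; apply: pp_ricci_zero => //.
- case=> [[]|k]; [exact: dchr0| |exact: dchr0].
  transitivity (fpsD1 (ev (christoffel g gi irho it irho) p)) => //.
  by rewrite chrE //= fpsD1C.
- move=> c; transitivity (fpsD1 (ev (christoffel g gi c it c) p)) => //.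
  rewrite chrE //=; case: c => [[]|k] /=; rewrite ?raddf0 ?fpsD1C //.
  by rewrite eqxx mulr1 fpsD1C.
- case=> [[]|k] [[]|l] /=; rewrite ?(mul0r, mulr0) //.
  by have := pp_chr_rho_diag k p; rewrite /= => ->; rewrite mul0r.
- case=> [[]|k] [[]|l] /=; rewrite ?(mul0r, mulr0) //.
  have [->|_] := eqVneq l k; last by rewrite !mulr0.
  by have := pp_chr_rho_diag k p; rewrite /= => ->; rewrite mul0r.
Qed.

Lemma pp_ricci_rho_t p : ray_domain M p -> ev (ricci g gi irho it) p = 0.
Proof.
move=> Ap; apply: pp_ricci_zero => //.
- case=> [[]|k]; [exact: dchr0| |exact: dchr0].
  transitivity (fpsD1 (ev (christoffel g gi irho irho it) p)) => //.
  by rewrite chrE //= fpsD1C.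
- move=> c; apply: dchr0 => // q _; case: c => [[]|k] //.
  exact: pp_chr_rho_diag.
- case=> [[]|k] [[]|l] /=; rewrite ?(mul0r, mulr0) //.
  by have := pp_chr_rho_diag k p; rewrite /= => ->; rewrite mul0r.
- case=> [[]|k] [[]|l] /=; rewrite ?(mul0r, mulr0) //.
  have [->|_] := eqVneq k l; last by rewrite mulr0 mul0r.
  by have := pp_chr_rho_diag l p; rewrite /= => ->; rewrite mulr0.
Qed.

Lemma pp_chr_trace c i p : chr c c (ix i) p = 0 /\ chr c (ix i) c p = 0.
Proof.
by case: c => [[]|k] //; rewrite pp_chr_diag pp_chr_diag'.
Qed.

Lemma pp_ricci_t_x i p : ray_domain M p -> ev (ricci g gi it (ix i)) p = 0.
Proof.
move=> Ap; apply: pp_ricci_zero => //.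
- case=> [[]|k]; [exact: dchr0|exact: dchr0|].
  by apply: (@fpartial_fun_t _ _ (fun F => F * (k == i)%:R)) => // q Aq; rewrite chrE.
- case=> [[]|k]; first exact: dchr0.
    by apply: (@fpartial_fun_t _ _ id) => // q Aq; rewrite chrE.
  by apply: (@fpartial_fun_t _ _ (fun F => F * (k == k)%:R)) => // q Aq; rewrite chrE.
- move=> c [[]|l]; rewrite ?mulr0 //.
  by rewrite -[inr l]/(ix l) (pp_chr_trace c l p).1 mul0r.
- case=> [[]|k] [[]|l]; rewrite /= ?(mul0r, mulr0) //.
  have [->|_] := eqVneq l k; last by rewrite !mulr0.
  by have := pp_chr_diag' f k i p; rewrite /= => ->; rewrite mul0r.
Qed.

Lemma pp_ricci_x_t i p : ray_domain M p -> ev (ricci g gi (ix i) it) p = 0.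
Proof.
move=> Ap; apply: pp_ricci_zero => //.
- case=> [[]|k]; [exact: dchr0|exact: dchr0|].
  by apply: (@fpartial_fun_t _ _ (fun F => F * (k == i)%:R)) => // q Aq; rewrite chrE.
- by move=> c; apply: dchr0 => // q _; have [] := pp_chr_trace c i q.
- move=> c [[]|l]; rewrite ?mulr0 //.
  by rewrite -[inr l]/(ix l) (pp_chr_trace c l p).1 mul0r.
- case=> [[]|k] [[]|l]; rewrite /= ?(mul0r, mulr0) //.
  have [->|_] := eqVneq k l; last by rewrite mulr0 mul0r.
  by have := pp_chr_diag' f l i p; rewrite /= => ->; rewrite mulr0.
Qed.

Lemma fpartial_pp_chr_rho k i p : ray_domain M p ->
  ev (fpartial (ix k) (christoffel g gi (ix k) irho (ix i))) p = 0 /\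
  ev (fpartial (ix k) (christoffel g gi (ix k) (ix i) irho)) p = 0.
Proof.
pose G (y : 'rV[R]_m.+1) := fpsC 2^-1 * (isr R k * isu R i * fpsD1 (f^~ y)).
move=> Ap; case: (coordP k) @G => [a||] G.
- by split; apply: dchr0 => // q _ /=; rewrite isrE !mul0r mulr0.
- by split; apply: dchr0 => // q _ /=; rewrite isrE !mul0r mulr0.
- have z : (fun k => 'D_(forget_r (delta_mx 0 (coord_r m))) (G^~ k) (forget_r p.1))
      = 0 :> fps R.
    by apply/funext => j; rewrite forget_delta_r derive0.
  by split; rewrite (fpartial_forget (G := G) M_open) // => q Aq; rewrite chrE.
Qed.

Lemma pp_chr_chr_rho k l i p :
  chr (ix k) (ix i) (ix l) p * chr (ix l) irho (ix k) p = 0.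
Proof.
by rewrite /=; case: (coordP k) => [a||];
  rewrite ?isuE ?isrE ?swapE ?ppDH_r !(mul0r, mulr0, addr0, oppr0).
Qed.

Lemma pp_ricci_rho_x i p : ray_domain M p -> ev (ricci g gi irho (ix i)) p = 0.
Proof.
move=> Ap; apply: pp_ricci_zero => //.
- case=> [[]|k]; [exact: dchr0|exact: dchr0|].
  exact: (fpartial_pp_chr_rho k i Ap).1.
- move=> c; apply: dchr0 => // q _; case: c => [[]|k] //.
  exact: pp_chr_rho_diag.
- move=> c [[]|l]; rewrite ?mulr0 //.
  by rewrite -[inr l]/(ix l) (pp_chr_trace c l p).1 mul0r.
- case=> [[]|k] [[]|l]; rewrite ?mulr0 ?mul0r //.
  exact: pp_chr_chr_rho.
Qed.

Lemma pp_ricci_x_rho i p : ray_domain M p -> ev (ricci g gi (ix i) irho) p = 0.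
Proof.
move=> Ap; apply: pp_ricci_zero => //.
- case=> [[]|k]; [exact: dchr0|exact: dchr0|].
  exact: (fpartial_pp_chr_rho k i Ap).2.
- by move=> c; apply: dchr0 => // q _; have [] := pp_chr_trace c i q.
- move=> c [[]|l]; rewrite ?mulr0 //.
  by rewrite -[inr l]/(ix l) (pp_chr_trace c l p).1 mul0r.
- case=> [[]|k] [[]|l]; rewrite ?mulr0 ?mul0r //.
  by rewrite mulrC; exact: pp_chr_chr_rho.
Qed.

End PPRicciRadialComponents.

Lemma open_norm_ball (R : realType) (V : normedModType R) (x : V) (r : R) :
  open [set z : V | `|z - x| < r].
Proof.
have -> : [set z : V | `|z - x| < r] = ball x r.
  by rewrite -ball_normE; apply/seteqP; split => z /=; rewrite distrC.
exact: ball_open.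
Qed.

(** * Analytic functions are smooth *)

Section BoxSums.
Variables (R : realType) (d : nat).
Implicit Types (w b : ('I_d -> nat) -> R).

Definition boxsum (N : nat) w : R :=
  \sum_(alpha : {ffun 'I_d -> 'I_N}) w (fun i => alpha i).

Lemma boxsum_mono w N N' : (forall a, 0 <= w a) -> (N <= N')%N ->
  boxsum N w <= boxsum N' w.
Proof.
move=> w0 NN'.
pose wd (alpha : {ffun 'I_d -> 'I_N}) : {ffun 'I_d -> 'I_N'} :=
  [ffun i => widen_ord NN' (alpha i)].
have wd_inj : injective wd.
  move=> u v /ffunP uv; apply/ffunP => i; have := uv i.
  by rewrite !ffunE => /(congr1 val) /= e; apply: val_inj.
have -> : boxsum N w = \sum_(beta in [set wd alpha | alpha in
    [set: {ffun 'I_d -> 'I_N}]]%SET) w (fun i => beta i).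
  rewrite big_imset /=; last by move=> u v _ _; apply: wd_inj.
  rewrite /boxsum; apply: eq_big => [alpha|alpha _]; first by rewrite finset.in_setT.
  by congr w; apply/funext => i; rewrite ffunE.
rewrite /boxsum [X in _ <= X](bigID (mem [set wd alpha | alpha in
  [set: {ffun 'I_d -> 'I_N}]]%SET)) /=.
by rewrite lerDl sumr_ge0.
Qed.

Lemma boxsum_norm_le w b N : (forall a, `|w a| <= b a) ->
  `|boxsum N w| <= boxsum N b.
Proof.
by move=> wb; apply: le_trans (ler_norm_sum _ _ _) _; apply: ler_sum.
Qed.

(** A sequence bounded by b is a difference of two sequences w + |w| and |w| with
    monotone, bounded sums. *)
Lemma boxsum_is_cvg w b B : (forall a, `|w a| <= b a) ->
  (forall N, boxsum N b <= B) -> cvgn (boxsum^~ w).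
Proof.
move=> wb bB.
have absB N : boxsum N (fun a => `|w a|) <= B.
  by apply: le_trans (bB N); apply: ler_sum => alpha _.
have cabs : cvgn (boxsum^~ (fun a => `|w a|)).
  apply: nondecreasing_is_cvgn.
    by move=> N N' NN'; apply: boxsum_mono => // a; apply: normr_ge0.
  by exists B => _ [N _ <-].
have cpos : cvgn (boxsum^~ (fun a => w a + `|w a|)).
  apply: nondecreasing_is_cvgn.
    move=> N N' NN'; apply: boxsum_mono => // a.
    by rewrite -lerBlDl sub0r -normrN ler_norm.
  exists (B + B) => _ [N _ <-].
  rewrite /boxsum big_split /=; apply: lerD; last exact: absB.
  by apply: le_trans (absB N); apply: ler_sum => alpha _; apply: ler_norm.
have -> : boxsum^~ w = (boxsum^~ (fun a => w a + `|w a|))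
                       \- (boxsum^~ (fun a => `|w a|)).
  by apply/funext => N; rewrite /= /boxsum -sumrB; apply: eq_bigr => a _; rewrite addrK.
exact: is_cvgB.
Qed.

End BoxSums.

Section MonomialDerivatives.
Variables (R : realType) (d : nat).
Implicit Types (a b : 'I_d -> nat) (y v : 'rV[R]_d).

(** The k-th derivative of x ^ n; it is 0 for n < k because the falling factorial is. *)
Definition dpow (n k : nat) (x : R) : R := (n ^_ k)%:R * x ^+ (n - k).

Definition dmono (b a : 'I_d -> nat) y : R := \prod_i dpow (a i) (b i) (y 0 i).

Definition incr (b : 'I_d -> nat) (i : 'I_d) : 'I_d -> nat :=
  fun j => (b j + (j == i))%N.

Lemma coord_le_norm y i : `|y 0 i| <= `|y|.
Proof.
rewrite [leRHS]/Num.norm /= mx_normrE; apply/bigmax_geP; right => /=.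
by exists (0, i).
Qed.

(** A Cauchy estimate: the left-hand side times sigma ^ k / k! is at most one term of
    the binomial expansion of (rho + sigma) ^ n. *)
Lemma dpow_bound (n k : nat) (x rho sigma : R) :
  0 <= rho -> 0 < sigma -> `|x| <= rho ->
  `|dpow n k x| <= k`!%:R * sigma ^- k * (rho + sigma) ^+ n.
Proof.
move=> rho0 sigma0 xrho.
have rs0 : 0 <= rho + sigma by rewrite addr_ge0 // ltW.
have [kn|nk] := leqP k n; last first.
  rewrite /dpow ffact_small // mul0r normr0 mulr_ge0 ?exprn_ge0 //.
  by rewrite mulr_ge0 // invr_ge0 exprn_ge0 // ltW.
rewrite /dpow normrM normr_nat -bin_ffact natrM mulrC normrX.
have step : 'C(n, k)%:R * `|x| ^+ (n - k) * sigma ^+ k <= (rho + sigma) ^+ n.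
  rewrite exprDn (bigD1 (inord k)) //= inordK // -[leLHS]addr0; apply: lerD.
    rewrite -[leRHS]mulr_natl [leRHS]mulrA; apply: ler_wpM2r.
      by rewrite exprn_ge0 // ltW.
    by apply: ler_wpM2l => //; rewrite lerXn2r // nnegrE.
  by apply: sumr_ge0 => i _; rewrite mulrn_wge0 // mulr_ge0 ?exprn_ge0 // ltW.
rewrite mulrA mulrC -mulrA; apply: ler_wpM2l => //.
by rewrite [leRHS]mulrC ler_pdivlMr ?exprn_gt0 // [_ * 'C(_, _)%:R]mulrC.
Qed.

Lemma is_derive_coord y v i : is_derive y v (fun z : 'rV[R]_d => z 0 i) (v 0 i).
Proof.
have E : 'D_v (fun z : 'rV[R]_d => z 0 i) y = v 0 i.
  apply: lim_near_cst => //; near=> s.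
  have s0 : s != 0 by near: s; exact: nbhs_dnbhs_neq.
  by rewrite /= !mxE addrK [_ *: _]mulrA mulVf ?mul1r.
apply: DeriveDef => //.
apply: (is_cvg_near_cst (v 0 i)) => //; near=> s.
have s0 : s != 0 by near: s; exact: nbhs_dnbhs_neq.
by rewrite /= !mxE addrK [_ *: _]mulrA mulVf ?mul1r.
Unshelve. all: by end_near. Qed.

Lemma is_derive_dpow (n k : nat) y v i :
  is_derive y v (fun z : 'rV[R]_d => dpow n k (z 0 i))
    (v 0 i * dpow n k.+1 (y 0 i)).
Proof.
pose c : 'rV[R]_d -> R := fun z => z 0 i.
have dc : is_derive y v c (v 0 i) by apply: is_derive_coord.
have -> : (fun z : 'rV[R]_d => dpow n k (z 0 i)) = (n ^_ k)%:R \*: (c ^+ (n - k)).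
  by apply/funext => z; rewrite /dpow /= exprfctE.
apply: is_derive_eq.
rewrite /dpow ffactnSr natrM subnS /c [_ *: (_ *: _)]mulrA [LHS]mulrC.
by rewrite -mulrA mulrA.
Qed.

Lemma is_derive_prod (V : normedModType R) (I : eqType) (s : seq I)
    (F : I -> V -> R) (dF : I -> R) (y v : V) : uniq s ->
  (forall i, is_derive y v (F i) (dF i)) ->
  is_derive y v (fun z => \prod_(i <- s) F i z)
    (\sum_(i <- s) \prod_(j <- s) (if j == i then dF j else F j y)).
Proof.
move=> us dFP; elim: s us => [_|x s IH /= /andP[xs us]].
  have -> : (fun z => \prod_(i <- [::]) F i z) = cst 1.
    by apply/funext => z; rewrite big_nil.
  by rewrite big_nil; exact: is_derive_cst.
have -> : (fun z => \prod_(i <- x :: s) F i z) = F x * (fun z => \prod_(i <- s) F i z).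
  by apply/funext => z; rewrite big_cons.
have IHs := IH us; have dFx := dFP x.
apply: is_derive_eq.
rewrite !big_cons eqxx addrC [_ *: dF x]mulrC; congr (_ * _ + _).
  apply: eq_big_seq => j js; case: eqP => // jx.
  by move: xs; rewrite -jx js.
rewrite [LHS]mulr_sumr; apply: eq_big_seq => i si; rewrite big_cons.
by case: eqP => // xi; move: xs; rewrite xi si.
Qed.

Lemma is_derive_fin_sum (V : normedModType R) (T : finType)
    (F : T -> V -> R) (dF : T -> R) (y v : V) :
  (forall i, is_derive y v (F i) (dF i)) ->
  is_derive y v (fun z => \sum_i F i z) (\sum_i dF i).
Proof.
move=> dFP; elim: (index_enum T) => [|x s IH].
  have -> : (fun z => \sum_(i <- [::]) F i z) = cst 0.
    by apply/funext => z; rewrite big_nil.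
  by rewrite big_nil; exact: is_derive_cst.
have -> : (fun z => \sum_(i <- x :: s) F i z) = F x + (fun z => \sum_(i <- s) F i z).
  by apply/funext => z; rewrite big_cons.
by rewrite big_cons; exact: is_deriveD.
Qed.

Lemma is_derive_dmono a b y v :
  is_derive y v (dmono b a) (\sum_i v 0 i * dmono (incr b i) a y).
Proof.
have D := @is_derive_prod _ _ (index_enum 'I_d)
  (fun i (z : 'rV[R]_d) => dpow (a i) (b i) (z 0 i))
  (fun i => v 0 i * dpow (a i) (b i).+1 (y 0 i)) y v (index_enum_uniq _)
  (fun i => is_derive_dpow (a i) (b i) y v i).
apply: (@is_derive_eq _ _ _ _ _ _ _ _ D); apply: eq_bigr => i _.
rewrite /dmono (bigD1 i) //= eqxx [in RHS](bigD1 i) //= /incr eqxx addn1 [RHS]mulrA.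
congr (_ * _); apply: eq_bigr => j /negbTE ji.
by rewrite ji addn0.
Qed.

Lemma dmono_bound b rho sigma : 0 <= rho -> 0 < sigma ->
  exists2 C : R, 0 <= C & forall a y, `|y| <= rho ->
    `|dmono b a y| <= C * \prod_i (rho + sigma) ^+ a i.
Proof.
move=> rho0 sigma0.
exists (\prod_i ((b i)`!%:R * sigma ^- b i)).
  by apply: prodr_ge0 => i _; rewrite mulr_ge0 // invr_ge0 exprn_ge0 // ltW.
move=> a y yrho; rewrite /dmono normr_prod -big_split /=.
apply: ler_prod => i _; rewrite normr_ge0 /=; apply: dpow_bound => //.
exact: le_trans (coord_le_norm y i) yrho.
Qed.

End MonomialDerivatives.

Section TaylorBound.
Variable R : realType.

Lemma MVT_from0 (g g' : R -> R) (s : R) :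
  (forall x : R, is_derive x 1 g (g' x)) -> 0 <= s ->
  exists2 x, 0 <= x <= s & g s - g 0 = g' x * s.
Proof.
move=> dg s0.
have cg : {within `[0, s], continuous g}.
  apply: continuous_subspaceT => x; apply: differentiable_continuous.
  by apply/derivable1_diffP; have [] := dg x.
have [x xs ->] := MVT_segment s0 (fun x _ => dg x) cg.
by exists x; [move: xs; rewrite in_itv | rewrite subr0].
Qed.

Lemma taylor2_bound (g g' g'' : R -> R) (K s : R) :
  (forall x : R, is_derive x 1 g (g' x)) -> (forall x : R, is_derive x 1 g' (g'' x)) ->
  (forall x, 0 <= x <= s -> `|g'' x| <= K) -> 0 <= s ->
  `|g s - g 0 - s * g' 0| <= s ^+ 2 * K.
Proof.
move=> dg dg' g''K s0.
have [x /andP[x0 xs] ->] := MVT_from0 dg s0.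
have [z /andP[z0 zx] E] := MVT_from0 dg' x0.
rewrite mulrC -mulrBr E normrM (ger0_norm s0) expr2 -mulrA.
apply: ler_wpM2l => //; rewrite normrM (ger0_norm x0) mulrC.
have K0 : `|g'' z| <= K by apply: g''K; rewrite z0 (le_trans zx).
by apply: ler_pM.
Qed.

End TaylorBound.

Section PowerSeries.
Variables (R : realType) (d : nat) (c : ('I_d -> nat) -> R) (r : R).
Hypothesis c_abs : forall rho : R, 0 < rho -> rho < r -> exists B : R,
  forall N, boxsum N (fun a => `|c a| * \prod_i rho ^+ a i) <= B.
Implicit Types (a b : 'I_d -> nat) (y z v : 'rV[R]_d).

Definition psum b y N : R := boxsum N (fun a => c a * dmono b a y).
Definition pseries b y : R := limn (psum b y).

(** By [dmono_bound] a derivative costs a constant and a slightly larger radius, at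
    which the power series still converges absolutely. *)
Lemma psum_majorant b rho : 0 <= rho -> rho < r -> exists2 w,
  (forall a y, `|y| <= rho -> `|c a * dmono b a y| <= w a) &
  exists B : R, forall N, boxsum N w <= B.
Proof.
(* Any positive sigma with rho + sigma < r would do. *)
move=> rho0 rhor; pose sigma := (r - rho) / 2.
have sigma0 : 0 < sigma by rewrite divr_gt0 // subr_gt0.
have rs : rho + sigma < r by rewrite /sigma; lra.
have [C C0 HC] := dmono_bound b rho0 sigma0.
have [B HB] := c_abs (ltr_wpDl rho0 sigma0) rs.
exists (fun a => C * (`|c a| * \prod_i (rho + sigma) ^+ a i)).
  by move=> a y yrho; rewrite normrM mulrCA; apply: ler_wpM2l => //; apply: HC.
exists (C * B) => N.
by rewrite /boxsum -mulr_sumr; apply: ler_wpM2l => //; apply: HB.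
Qed.

Lemma psum_cvg b y : `|y| < r -> psum b y N @[N --> \oo] --> pseries b y.
Proof.
move=> yr; have [w Hw [B HB]] := psum_majorant b (normr_ge0 y) yr.
by apply: (@boxsum_is_cvg _ _ _ w B) => // a; apply: Hw.
Qed.

Lemma psum_bound b rho : 0 <= rho -> rho < r -> exists2 B : R, 0 <= B &
  forall N y, `|y| <= rho -> `|psum b y N| <= B.
Proof.
move=> rho0 rhor; have [w Hw [B HB]] := psum_majorant b rho0 rhor.
have HP N y : `|y| <= rho -> `|psum b y N| <= B.
  by move=> yrho; apply: le_trans (HB N); apply: boxsum_norm_le => a; apply: Hw.
exists B => //; apply: le_trans (HP 0%N 0 _); first exact: normr_ge0.
by rewrite normr0.
Qed.

Definition dpsum b v y N : R := \sum_i v 0 i * psum (incr b i) y N.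

Lemma is_derive_psum b N y v :
  is_derive y v (fun z => psum b z N) (dpsum b v y N).
Proof.
have D := is_derive_fin_sum (fun alpha : {ffun 'I_d -> 'I_N} =>
  is_deriveM (is_derive_cst (c (fun i => alpha i)) y v)
             (is_derive_dmono (fun i => alpha i) b y v)).
apply: (@is_derive_eq _ _ _ _ _ _ _ _ D).
rewrite /dpsum /psum /boxsum.
under [RHS]eq_bigr => i _ do rewrite mulr_sumr.
rewrite exchange_big /=; apply: eq_bigr => alpha _.
rewrite scaler0 addr0 [LHS]mulr_sumr; apply: eq_bigr => i _.
by rewrite mulrCA.
Qed.

Lemma is_derive_line (f : 'rV[R]_d -> R) (df : 'rV[R]_d -> R) y v s :
  (forall z, is_derive z v f (df z)) ->
  is_derive s (1 : R) (fun x : R => f (y + x *: v)) (df (y + s *: v)).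
Proof.
move=> fdf; have [fd <-] := fdf (y + s *: v).
pose L (x : R) := y + x *: v; pose L' (x : R) := x *: v.
have HL (x q w : R) : L (x *: q + w) = x *: L' q + L w.
  by rewrite /L /L' scalerDl scalerA addrCA.
have := @derivable_comp_affine R _ _ L L' HL f 1 s.
have := @derive_comp_affine R _ _ L L' HL f 1 s.
rewrite /L' scale1r => <- /(_ fd).
by move=> dfL; apply: DeriveDef.
Qed.

Lemma psum_bounds (I : Type) (bs : I -> 'I_d -> nat) rho : 0 <= rho -> rho < r ->
  exists B : I -> R, (forall i, 0 <= B i) /\
    forall i N y, `|y| <= rho -> `|psum (bs i) y N| <= B i.
Proof.
move=> rho0 rhor.
have /choice [B HB] : forall i, exists B : R, 0 <= B /\
    forall N y, `|y| <= rho -> `|psum (bs i) y N| <= B.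
  by move=> i; have [B B0 HB] := psum_bound (bs i) rho0 rhor; exists B.
by exists B; split=> i; have [] := HB i.
Qed.

Lemma norm_line y v s rho x : 0 <= x <= s -> `|y| + s * `|v| <= rho ->
  `|y + x *: v| <= rho.
Proof.
move=> /andP[x0 xs]; apply: le_trans; apply: le_trans (ler_normD _ _) _.
by rewrite lerD2l normrZ ger0_norm // ler_wpM2r.
Qed.

Lemma psum_lipschitz b rho : 0 <= rho -> rho < r -> exists K : R,
  forall N y v, `|y| + `|v| <= rho ->
    `|psum b (y + v) N - psum b y N| <= K * `|v|.
Proof.
move=> rho0 rhor; have [B [B0 HB]] := psum_bounds (incr b) rho0 rhor.
exists (\sum_i B i) => N y v yv.
have dg x := is_derive_line y x (fun z => is_derive_psum b N z v).
have [x x01] := MVT_from0 dg ler01.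
rewrite scale1r scale0r addr0 mulr1 => ->.
apply: le_trans (ler_norm_sum _ _ _) _; rewrite mulr_suml; apply: ler_sum => i _.
rewrite normrM mulrC; apply: ler_pM => //; last exact: coord_le_norm.
by apply: HB; apply: norm_line x01 _; rewrite mul1r.
Qed.

Lemma is_derive_dpsum b N y v :
  is_derive y v (fun z => dpsum b v z N)
    (\sum_i v 0 i * dpsum (incr b i) v y N).
Proof.
apply: (@is_derive_fin_sum _ _ _ (fun i z => v 0 i * psum (incr b i) z N)) => i.
have D := is_deriveM (is_derive_cst (v 0 i) y v) (is_derive_psum (incr b i) N y v).
by apply: (@is_derive_eq _ _ _ _ _ _ _ _ D); rewrite scaler0 addr0.
Qed.

(** The constant K does not depend on N, so the estimate survives the limit and
    proves that the limit is differentiable ([is_derive_pseries]). *)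
Lemma psum_taylor b v rho : 0 <= rho -> rho < r -> exists K : R,
  forall N y s, 0 <= s -> `|y| + s * `|v| <= rho ->
    `|psum b (y + s *: v) N - psum b y N - s * dpsum b v y N| <= s ^+ 2 * K.
Proof.
move=> rho0 rhor.
have [B [B0 HB]] := psum_bounds (fun ij => incr (incr b ij.1) ij.2) rho0 rhor.
exists (\sum_i `|v 0 i| * \sum_j `|v 0 j| * B (i, j)) => N y s s0 ys.
have dg x := is_derive_line y x (fun z => is_derive_psum b N z v).
have dg' x := is_derive_line y x (fun z => is_derive_dpsum b N z v).
have := taylor2_bound dg dg' _ s0; rewrite scale0r addr0; apply=> x xs.
apply: le_trans (ler_norm_sum _ _ _) _; apply: ler_sum => i _.
rewrite normrM; apply: ler_wpM2l => //.
apply: le_trans (ler_norm_sum _ _ _) _; apply: ler_sum => j _.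
rewrite normrM; apply: ler_wpM2l => //.
by apply: (HB (i, j)); apply: norm_line xs ys.
Qed.

Definition dpseries b v y : R := \sum_i v 0 i * pseries (incr b i) y.

Lemma dpsum_cvg b v y : `|y| < r -> dpsum b v y N @[N --> \oo] --> dpseries b v y.
Proof.
move=> yr; rewrite /dpsum /dpseries.
elim: (index_enum 'I_d) => [|i s IH].
  have -> : (fun N => \sum_(i <- [::]) v 0 i * psum (incr b i) y N) = fun=> 0.
    by apply/funext => N; rewrite big_nil.
  by rewrite big_nil; exact: cvg_cst.
have -> : (fun N => \sum_(j <- i :: s) v 0 j * psum (incr b j) y N)
    = fun N => v 0 i * psum (incr b i) y N + \sum_(j <- s) v 0 j * psum (incr b j) y N.
  by apply/funext => N; rewrite big_cons.
rewrite big_cons; apply: cvgD => //.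
by apply: cvgM; [exact: cvg_cst | exact: psum_cvg].
Qed.

Lemma norm_lim_le (u : R^nat) (l B : R) : u N @[N --> \oo] --> l ->
  (forall N, `|u N| <= B) -> `|l| <= B.
Proof.
move=> ul uB; have ul' : `|u N| @[N --> \oo] --> `|l| by exact: cvg_norm.
by apply: (ler_cvg_to ul' (cvg_cst B)); near=> N; apply: uB.
Unshelve. all: by end_near. Qed.

Lemma pseries_lipschitz b rho : 0 <= rho -> rho < r -> exists K : R,
  forall y v, `|y| + `|v| <= rho ->
    `|pseries b (y + v) - pseries b y| <= K * `|v|.
Proof.
move=> rho0 rhor; have [K HK] := psum_lipschitz b rho0 rhor.
exists K => y v yv.
have yr : `|y| < r by apply: le_lt_trans rhor; apply: le_trans yv; rewrite lerDl.
have yvr : `|y + v| < r.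
  by apply: le_lt_trans rhor; apply: le_trans yv; apply: ler_normD.
have C : psum b (y + v) N - psum b y N @[N --> \oo]
    --> pseries b (y + v) - pseries b y by apply: cvgB; apply: psum_cvg.
by apply: (norm_lim_le C) => N; apply: HK.
Qed.

(** For negative s the estimate is that of -s in the direction -v. *)
Lemma pseries_taylor b v rho : 0 <= rho -> rho < r -> exists K : R,
  forall y s, `|y| + `|s| * `|v| <= rho ->
    `|pseries b (y + s *: v) - pseries b y - s * dpseries b v y| <= s ^+ 2 * K.
Proof.
move=> rho0 rhor.
have pos w : exists K : R, forall y s, 0 <= s -> `|y| + s * `|w| <= rho ->
    `|pseries b (y + s *: w) - pseries b y - s * dpseries b w y| <= s ^+ 2 * K.
  have [K HK] := psum_taylor b w rho0 rhor; exists K => y s s0 ys.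
  have yr : `|y| < r.
    by apply: le_lt_trans rhor; apply: le_trans ys; rewrite lerDl mulr_ge0.
  have ysr : `|y + s *: w| < r.
    by apply: le_lt_trans rhor; apply: norm_line ys; rewrite s0 lexx.
  have C : psum b (y + s *: w) N - psum b y N - s * dpsum b w y N @[N --> \oo]
      --> pseries b (y + s *: w) - pseries b y - s * dpseries b w y.
    apply: cvgB; first by apply: cvgB; apply: psum_cvg.
    by apply: cvgM; [exact: cvg_cst | exact: dpsum_cvg].
  by apply: (norm_lim_le C) => N; apply: HK.
have [K HK] := pos v; have [K' HK'] := pos (- v).
exists (`|K| + `|K'|) => y s ys.
have [s0|s0] := leP 0 s.
  apply: le_trans (HK y s s0 _) _; first by move: ys; rewrite ger0_norm.
  by apply: ler_wpM2l; rewrite ?sqr_ge0 // (le_trans (ler_norm K)) // lerDl.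
have := HK' y (- s); rewrite scalerN scaleNr opprK sqrrN.
have -> : - s * dpseries b (- v) y = s * dpseries b v y.
  rewrite /dpseries mulNr -mulrN -sumrN; congr (_ * _); apply: eq_bigr => i _.
  by rewrite mxE mulNr opprK.
rewrite normrN oppr_ge0 => H; apply: le_trans (H (ltW s0) _) _.
  by move: ys; rewrite ltr0_norm.
by apply: ler_wpM2l; rewrite ?sqr_ge0 // (le_trans (ler_norm K')) // lerDr.
Qed.

Lemma is_derive_pseries b y v : `|y| < r ->
  is_derive y v (pseries b) (dpseries b v y).
Proof.
move=> yr; pose rho := (`|y| + r) / 2.
have yrho : `|y| < rho by rewrite /rho; lra.
have rhor : rho < r by rewrite /rho; lra.
have [K HK] := pseries_taylor b v (le_trans (normr_ge0 y) (ltW yrho)) rhor.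
have v1 : 0 < `|v| + 1 by rewrite ltr_wpDl.
have e0 : 0 < (rho - `|y|) / (`|v| + 1) by rewrite divr_gt0 ?subr_gt0.
(* The step s is so small that y + s v stays in the ball of radius rho. *)
have C : (fun s => s^-1 *: ((pseries b \o shift y) (s *: v) - pseries b y)
    - dpseries b v y) @ 0^' --> (0 : R).
  apply: (cvg_to_0_linear (K := K) e0) => s /andP[s0 se].
  have sn0 : s != 0 by rewrite -normr_gt0.
  have -> : s^-1 *: ((pseries b \o shift y) (s *: v) - pseries b y) - dpseries b v y
      = s^-1 * (pseries b (y + s *: v) - pseries b y - s * dpseries b v y).
    by rewrite /= [s *: v + y]addrC [_ *: _]/(_ * _) mulrBr mulrA mulVf // mul1r.
  rewrite normrM normfV ler_pdivrMl // mulrCA -expr2 real_normK ?num_real // [leRHS]mulrC.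
  apply: HK; move: se; rewrite ltr_pdivlMr // mulrDr mulr1 => se.
  by rewrite -lerBrDl; apply: le_trans (ltW se); rewrite lerDl.
have C' : (fun s => s^-1 *: ((pseries b \o shift y) (s *: v) - pseries b y))
    @ 0^' --> dpseries b v y.
  by apply/subr_cvg0.
apply: DeriveDef; first by apply/cvg_ex; exists (dpseries b v y).
exact: cvg_lim C'.
Qed.

Lemma continuous_pseries b y : `|y| < r -> {for y, continuous (pseries b)}.
Proof.
move=> yr; pose rho := (`|y| + r) / 2.
have yrho : `|y| < rho by rewrite /rho; lra.
have rhor : rho < r by rewrite /rho; lra.
have [K HK] := pseries_lipschitz b (le_trans (normr_ge0 y) (ltW yrho)) rhor.
have K1 : 0 < `|K| + 1 by rewrite ltr_wpDl.
apply/(@cvgrPdist_le _ _ _ (nbhs y) (nbhs_filter y)) => e e0; near=> z.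
have zy : `|z - y| < rho - `|y|.
  by near: z; apply: cvgr_distC_lt => //; rewrite subr_gt0.
have zy' : `|z - y| < e / (`|K| + 1).
  by near: z; apply: cvgr_distC_lt => //; rewrite divr_gt0.
have -> : z = y + (z - y) by rewrite subrKC.
rewrite distrC; apply: le_trans (HK y (z - y) _) _.
  by rewrite -lerBrDl ltW.
move: zy'; rewrite ltr_pdivlMr // mulrDr mulr1 => zy'.
apply: le_trans (_ : `|K| * `|z - y| <= _).
  by apply: ler_wpM2r => //; apply: ler_norm.
by rewrite mulrC; apply: le_trans (ltW zy'); rewrite lerDl.
Unshelve. all: by end_near. Qed.

(** The directional derivative of the termwise derivative of order b is a linear
    combination of those of order b + e_i, to which the induction applies. *)
Lemma Ck_pseries k b : Ck [set y : 'rV[R]_d | `|y| < r] k (pseries b).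
Proof.
have oU : open [set y : 'rV[R]_d | `|y| < r].
  have -> : [set y : 'rV[R]_d | `|y| < r] = [set y | `|y - 0| < r].
    by apply/seteqP; split => y /=; rewrite subr0.
  exact: open_norm_ball.
have C0 b' y : `|y| < r -> {for y, continuous (pseries b')} /\
    forall v, derivable (pseries b') y v.
  move=> yr; split=> [|v]; first exact: continuous_pseries.
  by have [] := is_derive_pseries b' v yr.
elim: k b => [|k IH] b; first by split=> // y; apply: C0.
split=> [y|v]; first exact: C0.
apply: (@Ck_eq _ _ _ _ (dpseries b v)) => //.
  by move=> y yr; have [_ ->] := is_derive_pseries b v yr.
rewrite /dpseries; elim: (index_enum 'I_d) => [|i s IHs].
  have -> : (fun y => \sum_(i <- [::]) v 0 i * pseries (incr b i) y) = cst 0.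
    by apply/funext => N; rewrite big_nil.
  exact: Ck_cst.
have -> : (fun y => \sum_(j <- i :: s) v 0 j * pseries (incr b j) y)
    = cst (v 0 i) * pseries (incr b i) + (fun y => \sum_(j <- s) v 0 j * pseries (incr b j) y).
  by apply/funext => N; rewrite big_cons.
by apply: CkD => //; apply: CkM => //; apply: Ck_cst.
Qed.

End PowerSeries.

Lemma real_analytic_smooth (R : realType) (d : nat) (h : 'rV[R]_d -> R)
    (A : set 'rV[R]_d) (x : 'rV[R]_d) : real_analytic_on h A -> A x ->
  exists U, [/\ open U, U x & smooth_on U h].
Proof.
move=> hA Ax; have [c [r [r0 hr]]] := hA x Ax.
pose b0 : 'I_d -> nat := fun=> 0%N.
have dmono0 a (y : 'rV[R]_d) : dmono b0 a y = \prod_(i < d) y 0 i ^+ a i.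
  by apply: eq_bigr => i _; rewrite /dpow ffactn0 mul1r subn0.
have c_abs rho : 0 < rho -> rho < r -> exists B : R,
    forall N, boxsum N (fun a => `|c a| * \prod_i rho ^+ a i) <= B.
  move=> rho0 rhor.
  have nr : `|const_mx rho : 'rV[R]_d| < r.
    apply: le_lt_trans rhor; rewrite [leLHS]/Num.norm /= mx_normrE.
    apply: bigmax_le => [|ij _]; first exact: ltW.
    by rewrite mxE gtr0_norm.
  have [cv _] := hr _ nr.
  have E a : `|c a * \prod_(i < d) (const_mx rho : 'rV[R]_d) 0 i ^+ a i|
      = `|c a| * \prod_i rho ^+ a i.
    rewrite normrM [X in _ * X]ger0_norm.
      by congr (_ * _); apply: eq_bigr => i _; rewrite mxE.
    by apply: prodr_ge0 => i _; rewrite mxE exprn_ge0 // ltW.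
  have Ebox : (fun N => \sum_(alpha : {ffun 'I_d -> 'I_N})
      `|c (fun i => alpha i) * \prod_(i < d) (const_mx rho : 'rV[R]_d) 0 i ^+ alpha i|)
      = fun N => boxsum N (fun a => `|c a| * \prod_i rho ^+ a i).
    by apply/funext => N; apply: eq_bigr => alpha _; rewrite E.
  rewrite Ebox in cv.
  exists (limn (fun N => boxsum N (fun a => `|c a| * \prod_i rho ^+ a i))) => N.
  apply: nondecreasing_cvgn_le cv N => N N' NN'; apply: boxsum_mono => // a.
  by rewrite mulr_ge0 //; apply: prodr_ge0 => i _; rewrite exprn_ge0 // ltW.
exists [set z | `|z - x| < r]; split.
- exact: open_norm_ball.
- by rewrite /= subrr normr0.
apply: (smooth_on_eq (f := pseries c b0 \o (fun z => z - x))).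
- exact: open_norm_ball.
- move=> z zr /=; have [_ hz] := hr (z - x) zr.
  have pz := psum_cvg c_abs (b := b0) zr.
  rewrite subrKC in hz.
  suff E : psum c b0 (z - x) = (fun N => \sum_(alpha : {ffun 'I_d -> 'I_N})
      c (fun i => alpha i) * \prod_(i < d) (z - x) 0 i ^+ alpha i).
    by rewrite -E in hz; apply: (cvg_unique _ pz hz).
  by apply/funext => N; apply: eq_bigr => alpha _; rewrite dmono0.
apply: (@smooth_on_comp_affine _ _ _ (fun z => z - x) id _ _ _ [set y | `|y| < r]) => //.
- by move=> s v z; rewrite addrA.
- move=> z; apply: (@cvgD _ _ _ (nbhs z) _ id (cst (- x))).
    exact: cvg_id.
  exact: cvg_cst.
- by apply/smooth_onP => k; apply: Ck_pseries.
Qed.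

(** * Pre-ambient conditions *)

Section Signature.
Variable R : realType.

(** The basis d/dx^i, d/du + (1/2 - h) d/dr, d/du - (1/2 + h) d/dr is orthonormal. *)
Lemma pp_metric_signature (m : nat) (h : 'rV[R]_m.+1 -> R) x :
  has_signature m.+1 1 (pp_metric h x).
Proof.
pose H := h (forget_r x).
pose P (a c : 'I_m.+2) : R :=
  if a == coord_u m then (c == coord_u m)%:R + (2^-1 - H) * (c == coord_r m)%:R
  else if a == coord_r m then (c == coord_u m)%:R - (2^-1 + H) * (c == coord_r m)%:R
  else (a == c)%:R.
exists P, [set coord_r m]%SET; split.
- by rewrite cardsC1 card_ord.
- by rewrite cards1.
move=> a b.
have E c : \sum_d P a c * pp_metric h x c d * P b d
    = P a c * (P b (swap_ur c) + 2 * H * (c == coord_u m)%:R * P b (coord_u m)).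
  under eq_bigr => d _ do rewrite pp_metricE !mxE -mulrA.
  rewrite -mulr_sumr; congr (_ * _).
  rewrite -[in RHS](sum_mul_delta (P b) (swap_ur c)).
  rewrite -[in RHS](sum_mul_delta (P b) (coord_u m)) mulr_sumr -big_split /=.
  apply: eq_bigr => d _; rewrite [swap_ur c == d]eq_sym -mulnb natrM.
  by move: (d == _) (c == _) (d == _) => b1 b2 b3; rewrite -/H; move: b1%:R b2%:R b3%:R => *; ring.
under eq_bigr => c _ do rewrite E.
rewrite sum_coord !swapE eqxx !coord_eqE.
case: (coordP a) => [i||]; case: (coordP b) => [j||];
  rewrite finset.in_set1 /P ?coord_eqE ?eqxx ?coord_eqE /=.
  rewrite expr0 [i == j]eq_sym -(sum_mul_delta (fun l => (j == l)%:R) i) !mul0r !addr0.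
  apply: eq_bigr => l _.
  by rewrite swapE !coord_eqE mulr0 addr0 mulrC [i == l]eq_sym.
all: rewrite big1 => [|l _]; last first.
all: try by rewrite ?swapE ?coord_eqE /= !(mul0r, mulr0, addr0, oppr0).
all: rewrite ?mulr0n ?mulr1n.
all: by field.
Qed.

(** At rho = 0 the pair rho, t spans a hyperbolic plane, with orthonormal basis
    (1/t) d/drho + (1/2) d/dt and (1/t) d/drho - (1/2) d/dt. *)
Lemma normal_form_signature n (mu : nat -> 'rV[R]_n -> 'M[R]_n) x t p q : 0 < t ->
  has_signature p q (mu 0 x) ->
  has_signature p.+1 q.+1 (fun a b => normal_form mu a b 0%N (x, t)).
Proof.
move=> t0 [P [neg [cp cq HP]]].
have tn0 : t != 0 by rewrite gt_eqF.
pose P' (a c : amb_idx n) : R := match a, c with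
  | inl true, inl true => 2^-1 | inl true, inl false => t^-1
  | inl false, inl true => - 2^-1 | inl false, inl false => t^-1
  | inr i, inr j => t^-1 * P i j
  | _, _ => 0 end.
pose neg' : {set amb_idx n} := irho |: [set ix i | i in neg]%SET.
have in_ix i : (inr i \in neg') = (i \in neg).
  rewrite !inE /=; apply/imsetP/idP => [[j jn [->]]//|i_neg].
  by exists i.
have in_inl (b : bool) : (inl b \in neg') = ~~ b.
  rewrite !inE; case: b => //=.
  by apply/negbTE/imsetP => -[].
have cneg' : #|neg'| = q.+1.
  rewrite cardsU1 card_imset ?cq; last by move=> i j [].
  rewrite (_ : irho \notin _) //.
  by apply/imsetP => -[].
exists P', neg'; split => //.
- have := cardsC neg'; rewrite cneg' card_sum card_bool card_ord.
  have nE := cardsC neg; rewrite cp cq card_ord in nE => E.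
  by apply/eqP; rewrite -(eqn_add2l q.+1) E -[X in (2 + X)%N]nE addSn addnS.
move=> a b; rewrite sum_amb; under [X in _ + X = _]eq_bigr => i _ do rewrite sum_amb.
rewrite !sum_amb /=.
have s0 : \sum_(i < n) 0 = 0 :> R by rewrite big1.
have s1 (F : 'I_n -> R) : \sum_i 0 * F i = 0.
  by rewrite big1 // => k _; rewrite mul0r.
have s2 (F : 'I_n -> 'I_n -> R) (G : 'I_n -> R) :
    \sum_i (0 + \sum_k 0 * F i k * G k) = 0.
  by rewrite big1 // => k _; rewrite big1 ?addr0 // => l _; rewrite !mul0r.
case: a b => [[]|i] [[]|j]; rewrite ?in_inl ?in_ix /=; rewrite ?(mulr0, mul0r, addr0, add0r).
1,2,4,5: by rewrite !s0 s2 !addr0 ?mulr0n ?mulr1n; field.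
1,2: by rewrite !s1 s2 !addr0 mulr0n.
1,2: rewrite !s0 !add0r big1 ?mulr0n // => k _;
  rewrite big1 => [|l _]; by rewrite !(mulr0, mul0r, addr0).
rewrite !s1 !add0r -[(inr i == inr j)]/(i == j) -HP; apply: eq_bigr => k _.
rewrite !mulr0 !addr0 add0r; by apply: eq_bigr => l _; field.
Qed.

End Signature.

Section LieDerivative.
Variables (R : realType) (n : nat) (M : set 'rV[R]_n).
Variable mu : nat -> 'rV[R]_n -> 'M[R]_n.
Hypothesis mu_derivable : forall k x i j v, M x ->
  derivable (fun y => mu k y i j) x v.

Lemma lie_derivative_normal_form a b k p : ray_domain M p ->
  lie_derivative (@fundamental_field R n) (normal_form mu) a b k p
  = 2 * normal_form mu a b k p.
Proof.
move=> Ap.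
have F c : ev (@fundamental_field R n c) p = (c == it)%:R * fpsC p.2.
  apply/funext => j; rewrite /ev /fundamental_field.
  case: (c == it); last by rewrite mul0r.
  by rewrite mul1r /fpsC; case: j.
have dF a' c : ev (fpartial a' (@fundamental_field R n c)) p
    = ((a' == it) && (c == it))%:R.
  apply/funext => j; rewrite /ev /fpartial /fundamental_field fps_natb.
  case: p {F} Ap => x t _; case: a' => [[]|i].
  - rewrite derive_pairr /=; case: (c == it); case: (j == 0%N) => /=;
      by [exact: derive_id | exact: derive_cst].
  - by rewrite andbF mulr0n mulr0 andbF.
  - rewrite derive_pairl /= andbF; exact: derive_cst.
suff E : \sum_c (ev (@fundamental_field R n c) p * ev (fpartial c (normal_form mu a b)) p
   + ev (fpartial a (@fundamental_field R n c)) p * ev (normal_form mu c b) p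
   + ev (fpartial b (@fundamental_field R n c)) p * ev (normal_form mu a c) p)
  = fpsC 2 * ev (normal_form mu a b) p.
  have := congr1 (fun G : fps R => G k) E.
  by rewrite fpsCM fps_sum.
under eq_bigr => c _ do
  rewrite F !dF (ev_fpartial_normal_form mu_derivable) // !ev_normal_form.
have i0 : (inl false == inl true :> amb_idx n) = false by [].
rewrite sum_amb big1 => [|l _]; last by rewrite !andbF !mul0r !addr0.
rewrite addr0 !eqxx i0 !andbT !andbF !mul0r !addr0 mul1r.
have two2 : fpsC 2 = 1 + 1 :> fps R by rewrite rmorph_nat.
rewrite ev_normal_form.
by case: a b => [[]|i] [[]|j] /=; rewrite ?eqxx ?i0 ?two2; ring.
Qed.

End LieDerivative.

Section PPFamilyPreAmbient.
Variables (R : realType) (m : nat) (M : set 'rV[R]_m.+2).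
Hypothesis M_open : open M.
Local Notation n := m.+2.

(** Dropping a coordinate does not increase the sup norm. *)
Lemma forget_r_continuous : continuous (@forget_r R m).
Proof.
move=> x; apply/(@cvgrPdist_le _ _ _ (nbhs x) (nbhs_filter x)) => e e0.
near=> y.
have xy : `|x - y| <= e.
  by near: y; apply: cvgr_dist_le.
apply: le_trans xy; rewrite [leLHS]/Num.norm /= mx_normrE.
apply: bigmax_le => // -[i j] _ /=; rewrite !mxE.
have := coord_le_norm (x - y) (widen_ord (leqnSn m.+1) j).
by rewrite !mxE.
Unshelve. all: by end_near. Qed.

Lemma smooth_on_snd (V : normedModType R) (A : set (V * R)) :
  smooth_on A (snd : V * R -> R).
Proof.
have sid : smooth_on setT (id : R -> R).
  apply/smooth_onP; case=> [|k].
    by split=> // p _; split=> [|v]; [exact: cvg_id | exact: derivable_id].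
  split=> [p _|v]; first by split=> [|v]; [exact: cvg_id | exact: derivable_id].
  have -> : 'D_v (id : R -> R) = cst v by apply/funext => p; rewrite derive_id.
  exact: Ck_cst.
have -> : (snd : V * R -> R) = id \o snd by [].
by apply: (@smooth_on_comp_affine _ _ _ snd snd _ _ A setT id) => // p; apply: cvg_snd.
Qed.

Variable f : nat -> 'rV[R]_m.+1 -> R.
Hypothesis f_smooth : forall x, M x ->
  exists2 U, open U /\ U (forget_r x) & forall k, smooth_on U (f k).

Lemma f_smooth_derivable k x v : M x -> derivable (f k) (forget_r x) v.
Proof.
by move=> /f_smooth [U [_ Ux] sf]; apply: smooth_on_derivable (sf k) Ux.
Qed.

Lemma f_smooth_derivable2 k x v w : M x ->
  derivable ('D_v (f k)) (forget_r x) w.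
Proof.
move=> /f_smooth [U [_ Ux] sf].
by apply: smooth_on_derivable (smooth_on_derive v (sf k)) Ux.
Qed.

Lemma pp_family_smooth a b k :
  smooth_on (ray_domain M) (normal_form (pp_family f) a b k).
Proof.
have s1 (j : nat) : smooth_on (ray_domain M) (fun p => p.2 *+ (j == 0%N)).
  by case: (j == 0%N); [exact: smooth_on_snd | exact: smooth_on_cst].
case: a b => [[]|i] [[]|j];
  [exact: smooth_on_cst | exact: s1 | exact: smooth_on_cst | exact: s1
  | exact: smooth_on_cst .. | idtac].
apply: smooth_on_local => p [Mp p0].
have [U [oU Up] sf] := f_smooth Mp.
pose L (q : 'rV[R]_n * R) := forget_r q.1.
have cL : continuous L.
  by move=> q; apply: continuous_comp; [exact: cvg_fst | exact: forget_r_continuous].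
have oLU : open (L @^-1` U) by apply: open_comp => // q _; apply: cL.
exists (L @^-1` U) => //.
have sL : smooth_on (L @^-1` U) (f k \o L).
  apply: (@smooth_on_comp_affine _ _ _ L L _ cL _ U) => // s v q.
  exact: forget_r_affine.
pose A : 'rV[R]_n * R -> R := cst ((k == 0%N)%:R * flat_pp R m i j).
pose B : 'rV[R]_n * R -> R := cst (du2 R m i j).
have -> : normal_form (pp_family f) (inr i) (inr j) k
    = snd * snd * (A + (f k \o L) * B).
  apply/funext => q; transitivity (q.2 * q.2 *
      ((k == 0%N)%:R * flat_pp R m i j + f k (L q) * du2 R m i j)) => //.
  by rewrite /= /pp_family !mxE expr2.
have sS := @smooth_on_snd _ (L @^-1` U).
have sA : smooth_on (L @^-1` U) A by exact: smooth_on_cst.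
have sB : smooth_on (L @^-1` U) B by exact: smooth_on_cst.
exact: (smooth_onM oLU (smooth_onM oLU sS sS)
  (smooth_onD oLU sA (smooth_onM oLU sL sB))).
Qed.

Lemma pp_pre_ambient h : f 0%N = (fun y => 2 * h y) ->
  is_pre_ambient M (pp_metric h) (normal_form (pp_family f)).
Proof.
move=> f0.
have g0 x : pp_family f 0 x = pp_metric h x.
  by rewrite pp_metricE /pp_family f0 scale1r.
split.
- case=> [[]|i] [[]|j] k p //= _; congr (_ * _).
  exact: pp_family_sym.
- exact: pp_family_smooth.
- move=> x t Mx t0; exists m.+1, 1%N; split; first exact: pp_metric_signature.
  by apply: normal_form_signature => //; rewrite g0; apply: pp_metric_signature.
- move=> a b k p Ap; apply: (lie_derivative_normal_form (M := M)) => //.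
  by move=> *; apply: (@pp_family_derivable _ _ M) => //; apply: f_smooth_derivable.
- by move=> x t Mx t0; split=> // i j; rewrite /= g0.
Qed.

End PPFamilyPreAmbient.

(** * The series of the theorem *)

Section PPSeries.
Variables (R : realType) (m : nat) (M : set 'rV[R]_m.+2) (h : 'rV[R]_m.+1 -> R).
Hypothesis h_smooth : forall x, M x ->
  exists U, [/\ open U, U (forget_r x) & smooth_on U h].
Local Notation n := m.+2.
Local Notation Lap k := (iter k (@laplacian_x R m) h).

Definition pp_scale (k : nat) : R := 2 / (k`!%:R * p_coef R n k).

(** In even dimension the terms of order at least n / 2 are dropped. *)
Definition pp_truncated (k : nat) : bool := ~~ odd n && (n <= 2 * k)%N.

Definition pp_series (k : nat) : 'rV[R]_m.+1 -> R := fun y =>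
  if pp_truncated k then 0 else pp_scale k * Lap k y.

Lemma pp_scale0 : pp_scale 0 = 2.
Proof. by rewrite /pp_scale /p_coef big_geq // fact0 mulr1 divr1. Qed.

Lemma pp_series0 : pp_series 0 = fun y => 2 * h y.
Proof.
by apply/funext => y; rewrite /pp_series /pp_truncated muln0 andbF pp_scale0.
Qed.

Lemma pp_ambient_coefE : pp_ambient_coef h = pp_family pp_series.
Proof.
apply/funext => -[|k]; apply/funext => x.
  by rewrite /pp_ambient_coef /= pp_metricE /pp_family pp_series0 scale1r.
rewrite /pp_ambient_coef /pp_family scale0r add0r /= /pp_series /pp_truncated.
by case: ifP => // _; [rewrite scale0r | rewrite /pp_scale mulrAC -mulrA mulrA].
Qed.

Lemma p_coefS k : p_coef R n k.+1 = p_coef R n k * ((2 * k.+1)%:R - n%:R).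
Proof. by rewrite /p_coef big_nat_recr. Qed.

(** The scalar recursion behind the factors 1 / (k! p_k); the factor 2 k - n of p_k
    is the one that vanishes at the obstructed order. *)
Lemma pp_scaleS k : n != (2 * k.+1)%N ->
  k.+1%:R * ((2 * k.+1)%:R - n%:R) * pp_scale k.+1 = pp_scale k.
Proof.
move=> nk; have d0 : (2 * k.+1)%:R - n%:R != 0 :> R.
  by rewrite subr_eq0 eqr_nat eq_sym.
have k0 : k.+1%:R != 0 :> R by rewrite pnatr_eq0.
rewrite /pp_scale p_coefS; move: (_ - _) d0 => D d0.
have f0 : k`!%:R != 0 :> R by rewrite pnatr_eq0 -lt0n fact_gt0.
rewrite factS natrM !invfM; move: (p_coef _ _ _)^-1 => q.
by field; rewrite f0 d0 nat1r.
Qed.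

Lemma smooth_on_laplacian U (g : 'rV[R]_m.+1 -> R) : open U ->
  smooth_on U g -> smooth_on U (laplacian_x g).
Proof.
move=> oU sg; apply: (smooth_on_sum oU) => i.
exact: (smooth_on_derive _ (smooth_on_derive _ sg)).
Qed.

Lemma smooth_on_iter_laplacian U k : open U -> smooth_on U h -> smooth_on U (Lap k).
Proof.
move=> oU sh; elim: k => [|k IH]; first exact: sh.
exact: (smooth_on_laplacian oU IH).
Qed.

Lemma pp_series_smooth x : M x ->
  exists2 U, open U /\ U (forget_r x) & forall k, smooth_on U (pp_series k).
Proof.
move=> /h_smooth [U [oU Ux sh]]; exists U; [by split|move=> k].
rewrite /pp_series.
case: (pp_truncated k); first exact: smooth_on_cst.
have -> : (fun y => pp_scale k * Lap k y) = cst (pp_scale k) * Lap k by [].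
have sc : smooth_on U (cst (pp_scale k)) by exact: smooth_on_cst.
exact: (smooth_onM oU sc (smooth_on_iter_laplacian k oU sh)).
Qed.

Lemma laplacian_pp_series k x : M x -> laplacian_x (pp_series k) (forget_r x)
  = if pp_truncated k then 0 else pp_scale k * Lap k.+1 (forget_r x).
Proof.
move=> /h_smooth [U [oU Ux sh]]; rewrite /laplacian_x /pp_series.
case: (pp_truncated k).
  rewrite big1 // => i _.
  have -> : (fun z : 'rV[R]_m.+1 => 'D_(delta_mx 0 (widen_ord (leqnSn m) i)) (fun=> 0 : R) z : R)
    = cst 0 by apply/funext => z; rewrite (derive_cst 0).
  by rewrite derive_cst.
rewrite /= mulr_sumr; apply: eq_bigr => i _.
set e := delta_mx _ _.
have sL := smooth_on_iter_laplacian k oU sh.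
transitivity ('D_e (fun z => pp_scale k * 'D_e (Lap k) z) (forget_r x)).
  apply: near_eq_derive; near=> z; rewrite derive_cmul //.
  apply: smooth_on_derivable sL _.
  by near: z; apply: open_nbhs_nbhs.
rewrite derive_cmul //.
by apply: smooth_on_derivable (smooth_on_derive e sL) Ux.
Unshelve. all: by end_near. Qed.

(** The equation k (2 k - n) H_k = Delta H_(k-1) holds at every order except the
    obstructed one, where Delta^(n/2) h is left over. *)
Lemma pp_series_recursion k x : M x ->
  k.+1%:R * ((2 * k.+1)%:R - n%:R) * pp_series k.+1 (forget_r x)
    - laplacian_x (pp_series k) (forget_r x)
  = - (pp_scale k * Lap k.+1 (forget_r x) *+ (n == 2 * k.+1)%N).
Proof.
move=> Mx; rewrite laplacian_pp_series // /pp_series.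
have [nk|nk] := eqVneq n (2 * k.+1)%N.
  rewrite nk subrr mulr0 mul0r sub0r mulr1n /pp_truncated nk.
  by rewrite leq_pmul2l // ltnn andbF.
have -> : pp_truncated k.+1 = pp_truncated k.
  rewrite /pp_truncated; move: (n) nk => N; case: (boolP (odd N)) => //= No.
  rewrite -(odd_double_half N) (negbTE No) add0n !mul2n => Nk.
  by rewrite !leq_double leq_eqVlt -(inj_eq double_inj) (negbTE Nk) ltnS.
case: (pp_truncated k); first by rewrite mulr0 subrr oppr0.
by rewrite mulrA pp_scaleS // subrr oppr0.
Qed.

End PPSeries.

(** * Uniqueness and obstruction *)

Section FlatMetric.
Variables (R : realType) (m : nat).

Lemma flat_mul_delta (a b : 'I_m.+2) :
  flat_pp R m *m delta_mx a b = delta_mx (swap_ur a) b.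
Proof.
apply/matrixP => i j; rewrite !mxE.
under eq_bigr => l _ do rewrite !mxE mulrC [swap_ur i == l]eq_sym.
by rewrite sum_mul_delta swap_eq eq_sym.
Qed.

Lemma delta_mul_flat (a b : 'I_m.+2) :
  delta_mx a b *m flat_pp R m = delta_mx a (swap_ur b).
Proof.
apply/matrixP => i j; rewrite !mxE.
under eq_bigr => l _ do rewrite !mxE -mulnb natrM -mulrA
  [_ * (swap_ur l == j)%:R]mulrC swap_eq [swap_ur j == l]eq_sym mulrA.
rewrite sum_mul_delta -natrM mulnb; congr ((_ && _)%:R).
by rewrite eq_sym swap_eq eq_sym.
Qed.

Lemma flat_mul_flat : flat_pp R m *m flat_pp R m = 1%:M.
Proof.
apply/matrixP => i j; rewrite !mxE.
under eq_bigr => l _ do rewrite !mxE mulrC [swap_ur i == l]eq_sym.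
by rewrite sum_mul_delta swapK.
Qed.

End FlatMetric.

Section NormalFormConditions.
Variables (R : realType) (n : nat) (M : set 'rV[R]_n) (g : 'rV[R]_n -> 'M[R]_n).
Variable mu : nat -> 'rV[R]_n -> 'M[R]_n.
Hypothesis pre : is_pre_ambient M g (normal_form mu).

Lemma pre_ambient_sym k x i j : M x -> mu k x i j = mu k x j i.
Proof.
move=> Mx; have [sym _ _ _ _] := pre.
have := sym (ix i) (ix j) k (x, 1); rewrite /= expr1n !mul1r.
by apply; split => //=.
Qed.

Lemma pre_ambient_derivable k x i j v : M x ->
  derivable (fun y => mu k y i j) x v.
Proof.
move=> Mx; have [_ smooth _ _ _] := pre.
have D : derivable (normal_form mu (ix i) (ix j) k) (x, 1) (v, 0).
  by apply: (smooth_on_derivable (smooth _ _ _)); split => //=.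
have -> : (fun y => mu k y i j) = fun y => normal_form mu (ix i) (ix j) k (y, 1).
  by apply/funext => y; rewrite /= expr1n mul1r.
exact: derivable_pairl.
Qed.

Lemma pre_ambient_mu0 x : M x -> mu 0 x = g x.
Proof.
move=> Mx; have [_ _ _ _ pb] := pre.
have [_ _ E] := pb x 1 Mx ltr01; apply/matrixP => i j.
by have := E i j; rewrite /= expr1n !mul1r.
Qed.

End NormalFormConditions.

Section Uniqueness.
Variables (R : realType) (m : nat) (M : set 'rV[R]_m.+2) (h : 'rV[R]_m.+1 -> R).
Hypothesis M_open : open M.
Hypothesis h_smooth : forall x, M x ->
  exists U, [/\ open U, U (forget_r x) & smooth_on U h].
Local Notation n := m.+2.
Local Notation Lap k := (iter k (@laplacian_x R m) h).
Local Notation pp := (pp_family (pp_series h)).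
Local Notation ppi := (pp_inverse (pp_series h)).

Let f_smooth := pp_series_smooth h_smooth.

Lemma pp_series_derivable k x v : M x -> derivable (pp_series h k) (forget_r x) v.
Proof. exact: f_smooth_derivable. Qed.

Lemma pp_series_derivable2 k x v w : M x -> derivable ('D_v (pp_series h k)) (forget_r x) w.
Proof. exact: f_smooth_derivable2. Qed.

Lemma pp_series_pre_ambient : is_pre_ambient M (pp_metric h) (normal_form pp).
Proof. by apply: pp_pre_ambient => //; apply: pp_series0. Qed.

Lemma pp_series_ricci_xx i j k p : ray_domain M p ->
  ricci (normal_form pp) ppi (ix i) (ix j) k p
  = - (2^-1 * (pp_scale R m k * Lap k.+1 (forget_r p.1)) *+ (n == 2 * k.+1)%N)
    * du2 R m i j.
Proof.
move=> Ap; rewrite (pp_ricci_xxE M_open pp_series_derivable pp_series_derivable2) //.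
rewrite (pp_series_recursion h_smooth); last by case: Ap.
by rewrite mulrN mulrnAr.
Qed.

Lemma pp_series_ricci_radial (b : bool) a k p : ray_domain M p ->
  ricci (normal_form pp) ppi (inl b) a k p = 0 /\
  ricci (normal_form pp) ppi a (inl b) k p = 0.
Proof.
move=> Ap; suff [E1 E2] : ev (ricci (normal_form pp) ppi (inl b) a) p = 0 /\
    ev (ricci (normal_form pp) ppi a (inl b)) p = 0.
  split; first exact: (congr1 (fun F : fps R => F k) E1).
  exact: (congr1 (fun F : fps R => F k) E2).
case: b a => [] [[]|i]; split.
- exact: (pp_ricci_tt M_open pp_series_derivable).
- exact: (pp_ricci_tt M_open pp_series_derivable).
- exact: (pp_ricci_t_rho M_open pp_series_derivable).
- exact: (pp_ricci_rho_t M_open pp_series_derivable).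
- exact: (pp_ricci_t_x M_open pp_series_derivable).
- exact: (pp_ricci_x_t M_open pp_series_derivable).
- exact: (pp_ricci_rho_t M_open pp_series_derivable).
- exact: (pp_ricci_t_rho M_open pp_series_derivable).
- exact: (pp_ricci_rhorho M_open pp_series_derivable).
- exact: (pp_ricci_rhorho M_open pp_series_derivable).
- exact: (pp_ricci_rho_x M_open pp_series_derivable).
- exact: (pp_ricci_x_rho M_open pp_series_derivable).
Qed.

Lemma pp_series_ambient :
  odd n \/ (exists2 s : nat, n = (2 * s)%N &
    forall p, M p -> Lap s (forget_r p) = 0) ->
  is_ambient M (pp_metric h) (normal_form pp).
Proof.
move=> cond; split; first exact: pp_series_pre_ambient.
exists ppi; split; first exact: pp_inverseP.
case=> [b|i] a k p Ap; first exact: (pp_series_ricci_radial b a k Ap).1.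
case: a => [b|j]; first exact: (pp_series_ricci_radial b (ix i) k Ap).2.
rewrite pp_series_ricci_xx //.
case: cond => [no|[s ns Ls]].
  have -> : (n == 2 * k.+1)%N = false.
    by apply/negP => /eqP nk; move: no; rewrite nk oddM.
  by rewrite mulr0n oppr0 mul0r.
have [nk|_] := eqVneq n (2 * k.+1)%N; last by rewrite mulr0n oppr0 mul0r.
have <- : s = k.+1 by apply/eqP; rewrite -(@eqn_pmul2l 2) // -ns nk.
by rewrite Ls ?mulr0 ?mul0rn ?oppr0 ?mul0r //; case: Ap.
Qed.

Lemma pp_metric_unit x : pp_metric h x \in unitmx.
Proof.
pose a := 2 * h (forget_r x).
(* The inverse is the flat metric with - 2 h (d/dr)^2 added to it. *)
suff E : pp_metric h x *m
    (flat_pp R m - a *: delta_mx (coord_r m) (coord_r m)) = 1%:M.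
  by have [] := mulmx1_unit E.
rewrite pp_metricE -/a mulmxDl !mulmxBr -!scalemxAr -!scalemxAl.
rewrite flat_mul_flat flat_mul_delta delta_mul_flat !swapE.
by rewrite mul_delta_mx_0 ?coord_eqE // !scaler0 subr0 subrK.
Qed.

(** This trace is the squared norm of du, which is null. *)
Lemma tr_inv_du2 x : \tr (invmx (pp_metric h x) *m du2 R m) = 0.
Proof.
have -> : du2 R m = pp_metric h x *m delta_mx (coord_r m) (coord_u m).
  rewrite pp_metricE mulmxDl -scalemxAl flat_mul_delta swapE.
  by rewrite mul_delta_mx_0 ?coord_eqE // scaler0 addr0.
rewrite mulKmx ?pp_metric_unit // /mxtrace big1 // => i _.
by rewrite mxE; have [->|//] := eqVneq i (coord_r m); rewrite eq_sym coord_eqE.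
Qed.

Section Leading.
Variables (mu : nat -> 'rV[R]_n -> 'M[R]_n) (gi : amb_tensor2 R n).
Hypothesis pre : is_pre_ambient M (pp_metric h) (normal_form mu).
Hypothesis gi_inverse : is_inverse (ray_domain M) (normal_form mu) gi.

Let mu_der := pre_ambient_derivable pre.
Let mu_sym := pre_ambient_sym pre.
Let mu_0 := pre_ambient_mu0 pre.
Let pp_der := @pp_family_derivable R m M (pp_series h) pp_series_derivable.
Let pp_sym k x i j (_ : M x) := pp_family_sym (pp_series h) k x i j.
Let ppi_inverse := @pp_inverseP R m M (pp_series h).

(** [ricci_xx_lead] with the series of the theorem as the reference solution. *)
Lemma lead_xx K x i j : (forall k y, (k <= K)%N -> M y -> mu k y = pp k y) ->
  M x ->
  ricci (normal_form mu) gi (ix i) (ix j) K (x, 1)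
  = K.+1%:R * (K.+1%:R - 2^-1 * n%:R) * (mu K.+1 x - pp K.+1 x) i j
    - 2^-1 * K.+1%:R * \tr (invmx (pp_metric h x) *m (mu K.+1 x - pp K.+1 x))
      * pp_metric h x i j
    - (2^-1 * (pp_scale R m K * Lap K.+1 (forget_r x)) *+ (n == 2 * K.+1)%N)
      * du2 R m i j.
Proof.
move=> agree Mx; have Ap : ray_domain M (x, 1) by split => //=.
have := ricci_xx_lead M_open mu_der mu_sym gi_inverse pp_der pp_sym ppi_inverse
  agree i j Ap.
rewrite pp_series_ricci_xx //= mu_0 // => /eqP; rewrite subr_eq => /eqP ->.
by rewrite mulNr.
Qed.

(** Away from the obstructed order the tangential equation makes the difference D a
    multiple of the metric, and its trace gives (K + 1 - n) tr D = 0.  For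
    K + 1 = n the trace vanishes by the rho-rho equation instead. *)
Lemma lead_unique K x : (forall k y, (k <= K)%N -> M y -> mu k y = pp k y) ->
  (forall a b k y, (k <= K)%N -> M y ->
     ricci (normal_form mu) gi a b k (y, 1) = 0) ->
  n != (2 * K.+1)%N -> M x -> mu K.+1 x = pp K.+1 x.
Proof.
move=> agree flat nK Mx; have Ap : ray_domain M (x, 1) by split => //=.
set D := mu K.+1 x - pp K.+1 x; set tr := \tr (invmx (pp_metric h x) *m D).
have E : (K.+1%:R - 2^-1 * n%:R) *: D = (2^-1 * tr) *: pp_metric h x.
  apply/matrixP => i j; have := lead_xx i j agree Mx.
  rewrite flat // (negbTE nK) mulr0n mul0r subr0 -/D -/tr => E.
  rewrite mxE [RHS]mxE; apply: (@mulfI _ K.+1%:R); first by rewrite pnatr_eq0.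
  apply/eqP; rewrite -subr_eq0; apply/eqP; rewrite [RHS]E.
  by move: (D i j) (pp_metric h x i j) => d e; ring.
have trE : (K.+1%:R - n%:R) * tr = 0.
  have := congr1 (fun A => \tr (invmx (pp_metric h x) *m A)) E.
  rewrite -!scalemxAr !mxtraceZ mulVmx ?pp_metric_unit // mxtrace1 -/tr => e.
  by rewrite -(subrr (2^-1 * tr * n%:R)) -{1}e; field.
have tr0 : tr = 0.
  move/eqP: trE; rewrite mulf_eq0 => /orP[|/eqP //].
  (* Here K + 1 = n >= 2, so the rho-rho equation of order K - 1 is available. *)
  rewrite subr_eq0 eqr_nat => /eqP Kn.
  case: K agree flat nK Kn @D @tr E => [//|K] agree flat nK Kn D tr E.
  have := ricci_rhorho_lead M_open mu_der mu_sym gi_inverse pp_der pp_sym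
    ppi_inverse agree Ap.
  rewrite flat // (pp_series_ricci_radial false irho K Ap).1 subrr /=.
  rewrite mu_0 // -/(coef_gap _ _ _ _) -/D -/tr => /esym/eqP.
  by rewrite !mulf_eq0 !pnatr_eq0 oppr_eq0 invr_eq0 pnatr_eq0 => /eqP.
have D0 : D = 0.
  move/eqP: E; rewrite tr0 mulr0 scale0r scalemx_eq0 => /orP[/eqP e|/eqP //].
  have : n%:R = (2 * K.+1)%:R :> R by rewrite natrM; lra.
  by move/eqP; rewrite eqr_nat (negbTE nK).
by apply/eqP; rewrite -subr_eq0 -/D D0.
Qed.

End Leading.

End Uniqueness.

Section MainResults.
Variables (R : realType) (m : nat) (M : set 'rV[R]_m.+2) (h : 'rV[R]_m.+1 -> R).
Hypothesis M_open : open M.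
Hypothesis h_smooth : forall x, M x ->
  exists U, [/\ open U, U (forget_r x) & smooth_on U h].
Local Notation n := m.+2.
Local Notation Lap k := (iter k (@laplacian_x R m) h).
Local Notation pp := (pp_family (pp_series h)).
Local Notation ppi := (pp_inverse (pp_series h)).

Lemma pp_family0 x : pp 0 x = pp_metric h x.
Proof. by rewrite pp_metricE /pp_family pp_series0 scale1r. Qed.

(** The equations are assumed up to order N, so that the lemma also applies to the
    approximate solutions that define the obstruction tensor. *)
Lemma pp_unique mu gi N : is_pre_ambient M (pp_metric h) (normal_form mu) ->
  is_inverse (ray_domain M) (normal_form mu) gi ->
  (forall a b k y, (k < N)%N -> M y ->
     ricci (normal_form mu) gi a b k (y, 1) = 0) ->
  forall k y, (k <= N)%N -> odd n || (2 * k < n)%N -> M y -> mu k y = pp k y.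
Proof.
move=> pre inv flat; elim/ltn_ind => -[_ y _ _ My|K IH y KN oK My].
  by rewrite (pre_ambient_mu0 pre) // pp_family0.
apply: (lead_unique M_open h_smooth pre inv) => //.
- move=> k z kK Mz; apply: IH => //; first exact: leq_trans (ltnW KN).
  case/orP: oK => [->//|oK]; apply/orP; right; apply: leq_ltn_trans oK.
  by rewrite leq_mul2l /= leqW.
- by move=> a b k z kK Mz; apply: flat => //; apply: leq_ltn_trans KN.
- apply/eqP => nK; move: oK; rewrite {1}nK oddM /= => lt.
  by move: lt; rewrite -nK ltnn.
Qed.

(** For n = 2 (K + 1) the factors 2 j - n are -2 times K, ..., 1. *)
Lemma p_coef_half K : n = (2 * K.+1)%N -> p_coef R n K = (-2) ^+ K * K`!%:R.
Proof.
move=> nK; rewrite /p_coef nK fact_prod natr_prod big_nat_rev /=.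
have -> : (-2 : R) ^+ K = \prod_(1 <= i < K.+1) (-2).
  by rewrite prodr_const_nat subSS subn0.
rewrite -big_split /=; apply: eq_big_nat => i /andP[i1 iK].
by rewrite add1n subSS !natrM natrB; [ring | exact: ltnW].
Qed.

Lemma pp_scale_half K : n = (2 * K.+1)%N ->
  pp_scale R m K = 2 / (K`!%:R ^+ 2 * (-2) ^+ K).
Proof.
move=> nK; rewrite /pp_scale p_coef_half //; congr (2 / _).
by rewrite mulrCA -expr2 mulrC.
Qed.

(** The entries (u, r) and (u, u) of [lead_xx] separate the multiple of the metric
    from the multiple of du^2. *)
Lemma pp_ambient_necessary mu s : is_ambient M (pp_metric h) (normal_form mu) ->
  n = (2 * s)%N -> forall p, M p -> Lap s (forget_r p) = 0.
Proof.
move=> [pre [gi [inv flat]]]; case: s => [//|K] nK p Mp.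
have flat1 a b k y : M y -> ricci (normal_form mu) gi a b k (y, 1) = 0.
  by move=> My; apply: flat; split => //=.
have agree k y : (k <= K)%N -> M y -> mu k y = pp k y.
  move=> kK My; apply: (pp_unique (N := K) pre inv) => //.
    by move=> a b j z _ Mz; apply: flat1.
  by apply/orP; right; rewrite nK ltn_pmul2l.
have K0 : K.+1%:R != 0 :> R by rewrite pnatr_eq0.
have nKb : (n == 2 * K.+1)%N = true by apply/eqP.
(* The difference of the coefficients of order K + 1 drops out of the equation,
   except for its trace; in the entry (u, r) the term du^2 is absent. *)
have half0 : K.+1%:R - 2^-1 * n%:R = 0 :> R by rewrite nK natrM; field.
have tr0 := lead_xx M_open h_smooth pre inv (coord_u m) (coord_r m) agree Mp.
have := lead_xx M_open h_smooth pre inv (coord_u m) (coord_u m) agree Mp.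
move: tr0; rewrite !flat1 // half0 nKb mulr1n !mulr0 !mul0r !sub0r.
rewrite !pp_metricE !mxE !swapE !eqxx !coord_eqE /= mulr0 addr0 !mulr1 mulr0 subr0.
move=> /esym/eqP; rewrite oppr_eq0 !mulf_eq0 invr_eq0 pnatr_eq0 (negbTE K0) /=.
move=> /eqP ->; rewrite mulr0 mul0r oppr0 add0r => E.
have sc0 : pp_scale R m K != 0.
  have f0 : K`!%:R != 0 :> R by rewrite pnatr_eq0 -lt0n fact_gt0.
  have t0 : -2 != 0 :> R by rewrite oppr_eq0 pnatr_eq0.
  rewrite pp_scale_half // mulf_neq0 ?pnatr_eq0 // invr_neq0 // mulf_neq0 //.
  exact: expf_neq0.
apply: (mulfI sc0); rewrite mulr0.
by move: (pp_scale R m K * _) E => x E; lra.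
Qed.

(** The trace-free condition removes the free multiple of the metric at the obstructed
    order; the constant cE matches the normalisation of the obstruction tensor. *)
Lemma pp_obstruction s O : (0 < m)%N -> n = (2 * s)%N ->
  is_obstruction_tensor M (pp_metric h) O <->
  forall p, M p -> O p = (Lap s (forget_r p) / (2 - n%:R)) *: du2 R m.
Proof.
case: s => [//|K] m0 nK.
have nKb : (n == 2 * K.+1)%N = true by apply/eqP.
have half : (n./2 = K.+1)%N by rewrite nK mul2n doubleK.
have cE : obstruction_constant R n * - (2^-1 * pp_scale R m K) = (2 - n%:R)^-1.
  rewrite /obstruction_constant half /= pp_scale_half //.
  have : K`!%:R != 0 :> R by rewrite pnatr_eq0 -lt0n fact_gt0.
  have : (-2) ^+ K != 0 :> R by rewrite expf_neq0 // oppr_eq0 pnatr_eq0.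
  have : 2 - n%:R != 0 :> R by rewrite subr_eq0 (eqr_nat R 2) !eqSS eq_sym -lt0n.
  have : n%:R - 2 != 0 :> R by rewrite subr_eq0 (eqr_nat R _ 2) !eqSS -lt0n.
  move: (n%:R) ((-2) ^+ K) (K`!%:R) => N q f N0 N0' q0 f0.
  by field; rewrite q0 f0 N0 N0'.
rewrite /is_obstruction_tensor half /=; split.
- move=> [mu [gi [T [pre inv flat pb TO]]]] p Mp.
  have [trT ->] := TO p Mp.
  have agree k y : (k <= K)%N -> M y -> mu k y = pp k y.
    move=> kK My; apply: (pp_unique (N := K) pre inv) => //.
      by move=> a b j z jK Mz; apply: flat => //; split => //=.
    by apply/orP; right; rewrite nK ltn_pmul2l.
  set D := mu K.+1 p - pp K.+1 p; set tr := \tr (invmx (pp_metric h p) *m D).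
  have half0 : K.+1%:R - 2^-1 * n%:R = 0 :> R by rewrite nK natrM; field.
  have TE : T p = (- (2^-1 * K.+1%:R * tr)) *: pp_metric h p
      + (- (2^-1 * (pp_scale R m K * Lap K.+1 (forget_r p)))) *: du2 R m.
    apply/matrixP => i j; have [_ _ E] := pb p 1 Mp ltr01.
    have := E i j; rewrite expr0 mul1r => <-.
    rewrite (lead_xx M_open h_smooth pre inv i j agree Mp) half0 -/D -/tr.
    by rewrite nKb mulr1n mulr0 mul0r sub0r [RHS]mxE [X in _ = X + _]mxE
      [X in _ = _ + X]mxE !mulNr.
  (* The metric has trace n and du^2 has trace 0. *)
  have tr0 : tr = 0.
    move: trT; rewrite TE mulmxDr -!scalemxAr mxtraceD !mxtraceZ tr_inv_du2.
    rewrite mulVmx ?pp_metric_unit // mxtrace1 mulr0 addr0 => /eqP.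
    by rewrite !(mulf_eq0, oppr_eq0) invr_eq0 !pnatr_eq0 /= orbF => /eqP.
  rewrite TE tr0 mulr0 oppr0 scale0r add0r scalerA; congr (_ *: _).
  rewrite -cE; move: (obstruction_constant R n) (pp_scale R m K) => c a.
  rewrite /=; move: (laplacian_x _ _) => L; ring.
- move=> OE.
  exists pp, ppi, (fun p =>
    (- (2^-1 * (pp_scale R m K * Lap K.+1 (forget_r p)))) *: du2 R m).
  split.
  + exact: pp_series_pre_ambient.
  + exact: pp_inverseP.
  + move=> a b k p kK Ap.
    case: a => [a|i].
      exact: (pp_series_ricci_radial M_open h_smooth a b k Ap).1.
    case: b => [b|j].
      exact: (pp_series_ricci_radial M_open h_smooth b (ix i) k Ap).2.
    have nk : (n == 2 * k.+1)%N = false.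
      by rewrite nK eqn_pmul2l // eqSS gtn_eqF.
    by rewrite (pp_series_ricci_xx M_open h_smooth) // nk mulr0n oppr0 mul0r.
  + move=> x t Mx t0; have Ap : ray_domain M (x, t) by [].
    split.
    * exact: (pp_series_ricci_radial M_open h_smooth true it K Ap).1.
    * move=> i; split.
        exact: (pp_series_ricci_radial M_open h_smooth true (ix i) K Ap).1.
      exact: (pp_series_ricci_radial M_open h_smooth true (ix i) K Ap).2.
    * move=> i j; rewrite (pp_series_ricci_xx M_open h_smooth) // nKb mulr1n.
      by rewrite expr0 mul1r [in RHS]mxE.
  + move=> x Mx; split.
      by rewrite -scalemxAr mxtraceZ tr_inv_du2 mulr0.
    rewrite OE // scalerA -cE; congr (_ *: _).
    move: (obstruction_constant R n) (pp_scale R m K) => c a.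
    by rewrite /=; move: (laplacian_x _ _) => L; ring.
Qed.

End MainResults.

Theorem theorem1 (R : realType) (m : nat) (m_gt0 : (0 < m)%N)
    (M : set 'rV[R]_m.+2) (M_open : open M) (h : 'rV[R]_m.+1 -> R)
    (h_analytic : real_analytic_on h [set forget_r p | p in M]) :
  let n := m.+2 in
  let g := pp_metric h in
  let condition :=
    odd n \/
    exists2 s : nat, n = (2 * s)%N &
      forall p, M p -> iter s (@laplacian_x R m) h (forget_r p) = 0 in
  [/\ has_ambient_metric M g <-> condition,
      condition ->
        is_ambient M g (normal_form (pp_ambient_coef h)) /\
        (forall mu, is_ambient M g (normal_form mu) ->
           forall k p, odd n || (2 * k < n)%N -> M p ->
             mu k p = pp_ambient_coef h k p) &
      forall s : nat, n = (2 * s)%N ->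
        forall O : 'rV[R]_n -> 'M[R]_n,
          is_obstruction_tensor M g O <->
          forall p, M p ->
            O p = (iter s (@laplacian_x R m) h (forget_r p) / (2 - n%:R))
                    *: du2 R m].
Proof.
move=> n g condition.
have h_smooth x : M x -> exists U, [/\ open U, U (forget_r x) & smooth_on U h].
  by move=> Mx; apply: real_analytic_smooth h_analytic _; exists x.
have ambient : condition -> is_ambient M g (normal_form (pp_ambient_coef h)).
  by rewrite pp_ambient_coefE; apply: pp_series_ambient.
split.
- split=> [[mu amb]|/ambient amb]; last by exists (pp_ambient_coef h).
  have [no|ne] := boolP (odd n); first by left.
  have nE : n = (2 * n./2)%N.
    by rewrite -[LHS]odd_double_half (negbTE ne) add0n mul2n.
  right; exists n./2 => //.
  exact: (pp_ambient_necessary M_open h_smooth amb nE).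
- move=> cond; split; first exact: ambient.
  move=> mu [pre [gi [inv flat]]] k p kn Mp; rewrite pp_ambient_coefE.
  apply: (pp_unique M_open h_smooth (N := k) pre inv) => //.
  by move=> a b j y _ My; apply: flat; split => //=.
- move=> s ns O; exact: (pp_obstruction M_open h_smooth O m_gt0 ns).
Qed.
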